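(* Let $\mathrm{Prob}$ be a probability measure on $\overline{\triangle}$, absolutely continuous with respect to the Lebesgue measure $m$. Let $(a_n(S))_{n\ge0}$ be the sequence of positive real numbers realising the pointwise dual ergodicity of $(\overline{\triangle},\mu,S)$, and let $(\alpha_k(x,y))_{k\ge1}$ denote the triangle sequence digits of $(x,y)$. If $(a_n(S))_{n\ge0}$ is regularly varying of index $\alpha=1$, then there exists a sequence $(b_n)_{n\ge0}$ such that for all $\varepsilon>0$ $$\lim_{n\to\infty}\mathrm{Prob}\left(\left|\frac{1}{b_n}\sum_{k=1}^{n}\alpha_k(x,y)-1\right|>\varepsilon\right)=0,$$ and $b_n\asymp n\log^2 n$. In particular, for $m$-almost every $(x,y)\in\overline{\triangle}$ $$\lim_{n\to\infty}\frac1n\sum_{k=1}^{n}\alpha_k(x,y)=+\infty.$$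
   Context: $\overline{\triangle}=\{(x,y)\in\mathbb{R}^2: 1\ge x\ge y\ge 0\}$, $\triangle=\{(x,y)\in\mathbb{R}^2: 1\ge x\ge y>0\}$, $\Gamma_0=\{(x,y): 1\ge x\ge y>1-x\}$, $\Gamma_1=\overline{\triangle}\setminus\Gamma_0$. The map $S:\overline{\triangle}\to\overline{\triangle}$ is $S(x,y)=\left(\frac{y}{x},\frac{1-x}{x}\right)$ if $(x,y)\in\Gamma_0$ and $S(x,y)=\left(\frac{x}{1-y},\frac{y}{1-y}\right)$ if $(x,y)\in\Gamma_1$. The measure $\mu$ is the infinite $S$-invariant measure on $\overline{\triangle}$ with density $\frac{1}{xy}$ with respect to Lebesgue measure. Triangle sequence: for $k\ge0$ let $\triangle_k=\{(x,y)\in\triangle: 1-x-ky\ge0>1-x-(k+1)y\}$; these sets partition $\triangle$. The triangle map $T:\triangle\to\overline{\triangle}$ is $T(x,y)=\left(\frac{y}{x},\frac{1-x-ky}{x}\right)$ for $(x,y)\in\triangle_k$. For $k\ge1$ the digit $\alpha_k(x,y)$ is the non-negative integer $j$ such that $T^{k-1}(x,y)\in\triangle_j$; all the digits are defined for Lebesgue-almost every $(x,y)$. Return sequence: $\widehat{S}:L^1(\mu)\to L^1(\mu)$ is the transfer (dual) operator, determined by $\int (\widehat{S}f)\,g\,d\mu=\int f\,(g\circ S)\,d\mu$ for all $f\in L^1(\mu)$, $g\in L^\infty(\mu)$. The system $(\overline{\triangle},\mu,S)$ is pointwise dual ergodic, and $(a_n(S))_{n\ge0}$ is a sequence of positive real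 numbers such that $\lim_{n\to\infty}\frac{1}{a_n(S)}\sum_{k=0}^{n-1}\widehat{S}^k f=\int f\,d\mu$ $\mu$-almost everywhere for all $f\in L^1(\overline{\triangle},\mu)$; it satisfies $a_n(S)\asymp\frac{n}{\log^2 n}$. Here $a_n\asymp b_n$ means $a_n=O(b_n)$ and $b_n=O(a_n)$ as $n\to\infty$. A sequence $(a_n)_{n\ge0}$ is regularly varying of index $\alpha\in\mathbb{R}$ if $\lim_{n\to\infty}\frac{a_{\lfloor cn\rfloor}}{a_n}=c^\alpha$ for all $c>0$. *)

(* Defs.v *)
From HB Require Import structures.
From mathcomp Require Import all_boot all_order all_algebra.
From mathcomp Require Import all_classical all_reals all_analysis measurable_realfun.

Set Implicit Arguments.
Unset Strict Implicit.
Unset Printing Implicit Defensive.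

Import Order.TTheory GRing.Theory Num.Theory.
Import numFieldNormedType.Exports.

Local Open Scope classical_set_scope.
Local Open Scope ring_scope.

Notation plane R := (measurableTypeR R * measurableTypeR R)%type.

Notation lebesgue2 R := (@lebesgue_measure R \x @lebesgue_measure R)%E.

Definition tri_bar (R : realType) : set (plane R) :=
  [set p | 1 >= p.1 /\ p.1 >= p.2 /\ p.2 >= 0].

Definition tri (R : realType) : set (plane R) :=
  [set p | 1 >= p.1 /\ p.1 >= p.2 /\ p.2 > 0].

Definition Gamma0 (R : realType) : set (plane R) :=
  [set p | 1 >= p.1 /\ p.1 >= p.2 /\ p.2 > 1 - p.1].

Definition Gamma1 (R : realType) : set (plane R) :=
  @tri_bar R `\` @Gamma0 R.

(* Smap is only meaningful on tri_bar, the union of Gamma0 and Gamma1; points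
   outside tri_bar form a mu-null set and are left fixed. *)
Definition Smap (R : realType) (p : plane R) : plane R :=
  if p \in @Gamma0 R then (p.2 / p.1, (1 - p.1) / p.1)
  else if p \in @Gamma1 R then (p.1 / (1 - p.2), p.2 / (1 - p.2))
  else p.

Definition tri_k (R : realType) (k : nat) : set (plane R) :=
  [set p | tri p /\ 1 - p.1 - k%:R * p.2 >= 0 /\
           0 > 1 - p.1 - k.+1%:R * p.2].

(* Default value 0 outside tri; on tri the sets tri_k form a partition. *)
Definition tri_index (R : realType) (p : plane R) : nat :=
  xget 0%N [set k | tri_k k p].

(* Points of tri_bar outside tri (where y = 0) are left fixed, so an orbit that
   leaves tri never returns to it; such orbits form a Lebesgue-null set. *)
Definition Tmap (R : realType) (p : plane R) : plane R :=
  if p \in @tri R then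
    (p.2 / p.1, (1 - p.1 - (tri_index p)%:R * p.2) / p.1)
  else p.

Definition digit (R : realType) (k : nat) (p : plane R) : nat :=
  tri_index (iter k.-1 (@Tmap R) p).

Lemma measurable_tri_bar (R : realType) : measurable (@tri_bar R).
Proof.
have -> : @tri_bar R =
    ((fun p : plane R => 1 - p.1) @^-1` `[0, +oo[) `&`
    (((fun p : plane R => p.1 - p.2) @^-1` `[0, +oo[) `&`
     ((fun p : plane R => p.2) @^-1` `[0, +oo[)).
  by apply/seteqP; split=> p; rewrite /tri_bar /= !in_itv /= !andbT !subr_ge0.
have m1 : measurable_fun setT (fun p : plane R => p.1) by exact: measurable_fst.
have m2 : measurable_fun setT (fun p : plane R => p.2) by exact: measurable_snd.
have m3 : measurable_fun setT (fun p : plane R => 1 - p.1 : R).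
  by apply: measurable_funB.
have m4 : measurable_fun setT (fun p : plane R => p.1 - p.2 : R).
  by apply: measurable_funB.
apply: measurableI; last apply: measurableI; rewrite -[X in measurable X]setTI.
- by apply: m3 => //; exact: measurable_itv.
- by apply: m4 => //; exact: measurable_itv.
- by apply: m2 => //; exact: measurable_itv.
Qed.

Definition mu (R : realType) (A : set (plane R)) : \bar R :=
  (\int[lebesgue2 R]_(p in A `&` @tri_bar R) ((p.1 * p.2)^-1)%:E)%E.

Section mu_is_measure.
Variable R : realType.

Let dens (p : plane R) : \bar R := ((p.1 * p.2)^-1)%:E.

Let dens_ge0 p : tri_bar p -> (0 <= dens p)%E.
Proof.
move=> [_ [xy y0]]; rewrite lee_fin invr_ge0 mulr_ge0//.
exact: le_trans xy.
Qed.

Let measurable_dens : measurable_fun (@tri_bar R) dens.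
Proof.
apply: (@eq_measurable_fun _ _ _ _ _
    (fun p : plane R => ((p.1 * p.2) `^ (-1))%:E)).
  move=> p; rewrite inE => -[_ [xy y0]]; rewrite /dens powR_inv1//.
  by rewrite mulr_ge0//; exact: le_trans xy.
apply: measurable_funTS; apply: measurableT_comp => //.
apply: (measurableT_comp (measurable_powR (-1))).
by apply: measurable_funM; [exact: measurable_fst|exact: measurable_snd].
Qed.

Let mu0 : @mu R set0 = 0%E.
Proof. by rewrite /mu set0I integral_set0. Qed.

Let mu_ge0 A : (0 <= @mu R A)%E.
Proof. by apply: integral_ge0 => p [_]; exact: dens_ge0. Qed.

Let mu_sigma_additive : semi_sigma_additive (@mu R).
Proof.
move=> F mF tF mUF; rewrite /mu; apply: cvg_toP.
  apply: ereal_nondecreasing_is_cvgn => m n mn.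
  apply: lee_sum_nneg_natr => // k _ _.
  by apply: integral_ge0 => p [_]; exact: dens_ge0.
rewrite setI_bigcupl ge0_integral_bigcup//=.
- by move=> n; apply: measurableI => //; exact: measurable_tri_bar.
- apply: (measurable_funS (@measurable_tri_bar R)) measurable_dens.
  by move=> p [n _ []].
- by move=> p [n _ [_]]; exact: dens_ge0.
- exact: trivIset_setIr.
Qed.

HB.instance Definition _ :=
  isMeasure.Build _ _ _ (@mu R) mu0 mu_ge0 mu_sigma_additive.

End mu_is_measure.

(* An operator on representatives of classes in L^1: the duality determines
   Shat f up to a null set. *)
Definition transfer_operator d (X : measurableType d) (R : realType)
    (nu : {measure set X -> \bar R}) (f : X -> X)
    (fhat : (X -> R) -> X -> R) : Prop :=
  forall u, u \in Lfun nu 1 ->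
    fhat u \in Lfun nu 1 /\
    forall g, g \in Lfun nu +oo%E ->
      (\int[nu]_x (fhat u x * g x)%:E = \int[nu]_x (u x * g (f x))%:E)%E.

Definition return_sequence d (X : measurableType d) (R : realType)
    (nu : {measure set X -> \bar R}) (fhat : (X -> R) -> X -> R)
    (a : nat -> R) : Prop :=
  (forall n, 0 < a n) /\
  forall u, u \in Lfun nu 1 ->
    {ae nu, forall x,
      (a n)^-1 * (\sum_(0 <= k < n) iter k fhat u x) @[n --> \oo]
        --> \int[nu]_y u y}.

Definition regularly_varying (R : realType) (alpha : R) (a : nat -> R) : Prop :=
  forall c : R, 0 < c ->
    a (Num.truncn (c * n%:R)) / a n @[n --> \oo] --> c `^ alpha.

Definition asymp (R : realType) (a b : nat -> R) : Prop :=
  a =O_\oo b /\ b =O_\oo a.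

(* Main.v *)
(* The map T is S induced by the visits to Gamma0: if N_n(p) is the number of
   visits to Gamma0 before time n, then N_m >= n exactly when
   alpha_1 + ... + alpha_n + n <= m. So everything follows from the asymptotics
   of N_n.

   The transfer operator of S for Lebesgue measure acts on 1 by a recursion whose
   solutions are homogeneous and monotone in each variable. Harnack inequalities
   and decomposition of an orbit at its last visit to Gamma0 show that
   A_n = (sum over k < n of the k-th density at (1, 1)) is comparable to
   n / log^2 n and controls these sums on all of Gamma0. Hence the expected value
   of N_n is O(n / log^2 n), which along n = 2^j is summable after division by n:
   N_n / n -> 0 almost everywhere, i.e. the averages of the digits tend to
   infinity.

   For the weak law, pointwise dual ergodicity applied to the mu-integrable
   function xy (whose images under the transfer operator are xy times the above
   densities) and to indicators gives the first moments and the correlation sums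
   of the visits to an Egorov set E of Gamma0. Regular variation of index 1 then
   makes the second moment of the number of visits to E asymptotic to what the
   first moment requires, so by Chebyshev N_n / a_n -> mu(Gamma0) in measure, the
   visits to the rest of Gamma0 being small in mean. Absolute continuity passes
   this to Prob, and inverting a monotone sequence asymptotic to
   a_n mu(Gamma0) yields b_n. *)
From mathcomp Require Import zify.
Require Import Defs.
From HB Require Import structures.
From mathcomp Require Import all_boot all_order all_algebra.
From mathcomp Require Import all_classical all_reals all_analysis.
From mathcomp Require Import measurable_realfun ring lra.
Set Implicit Arguments.
Unset Strict Implicit.
Unset Printing Implicit Defensive.
Import Order.TTheory GRing.Theory Num.Theory.
Import numFieldNormedType.Exports.
Local Open Scope classical_set_scope.
Local Open Scope ring_scope.

Section density_measure.
Local Open Scope ereal_scope.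
Context d (T : measurableType d) (R : realType).
Context (nu : {measure set T -> \bar R}).

Import HBNNSimple.

Lemma ge0_integral_density (w : T -> R) (kappa : {measure set T -> \bar R}) :
  measurable_fun setT w -> (forall x, (0 <= w x)%R) ->
  (forall A, measurable A -> kappa A = \int[nu]_(x in A) (w x)%:E) ->
  forall f : T -> \bar R, measurable_fun setT f -> (forall x, 0 <= f x) ->
  \int[kappa]_x f x = \int[nu]_x (f x * (w x)%:E).
Proof.
move=> mw w0 kappaE f mf f0.
pose f_ := nnsfun_approx measurableT mf.
have mwE : measurable_fun setT (fun x => (w x)%:E) by exact/measurable_EFinP.
have fE x : f x = lim ((f_ n x)%:E @[n --> \oo]).
  by apply/esym/cvg_lim => //; apply: cvg_nnsfun_approx.
transitivity (limn (fun n => \int[kappa]_x (f_ n x)%:E)).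
  rewrite -monotone_convergence//.
  - by apply: eq_integral => x _; exact: fE.
  - by move=> n; exact/measurable_EFinP/measurable_funP.
  - by move=> n x _; rewrite lee_fin; exact: fun_ge0.
  - by move=> x _ m n mn; rewrite lee_fin; exact/lefP/nd_nnsfun_approx.
transitivity (limn (fun n => \int[nu]_x ((f_ n x)%:E * (w x)%:E))); last first.
  rewrite -monotone_convergence//.
  - apply: eq_integral => x _; apply/cvg_lim => //.
    by apply: cvgeZr => //; apply: cvg_nnsfun_approx.
  - move=> n; apply: emeasurable_funM => //.
    exact/measurable_EFinP/measurable_funP.
  - by move=> n x _; apply: mule_ge0; rewrite lee_fin//; exact: fun_ge0.
  - move=> x _ m n mn; apply: lee_wpmul2r; first by rewrite lee_fin.
    by rewrite lee_fin; exact/lefP/nd_nnsfun_approx.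
congr (limn _); apply/funext => n.
under eq_integral do rewrite fimfunE -fsumEFin//.
transitivity (\int[nu]_x (\sum_(i \in range (f_ n))
    ((i * \1_(f_ n @^-1` [set i]) x)%:E * (w x)%:E))); last first.
  apply: eq_integral => x _; rewrite [in RHS]fimfunE -fsumEFin// ge0_mule_fsuml//.
  by move=> r; rewrite nnfun_muleindic_ge0.
rewrite !ge0_integral_fsum//; last 4 first.
- by move=> r; apply: emeasurable_funM => //; exact/measurable_EFinP/measurable_funM.
- by move=> r x _; apply: mule_ge0; rewrite ?lee_fin// -lee_fin nnfun_muleindic_ge0.
- by move=> r; exact/measurable_EFinP/measurable_funM.
- by move=> r x _; rewrite nnfun_muleindic_ge0.
apply: eq_fsbigr => r; rewrite inE => -[t _ rE].
have r0 : (0 <= r)%R by rewrite -rE; exact: fun_ge0.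
rewrite integralZl_indic_nnsfun// integral_indic// setIT kappaE//.
under [RHS]eq_integral do rewrite EFinM -muleA.
rewrite ge0_integralZl//; last first.
- by move=> x _; rewrite mule_ge0 ?lee_fin//.
- by apply: emeasurable_funM => //; exact/measurable_EFinP.
congr (_ * _); rewrite [LHS]integral_mkcond; apply: eq_integral => x _.
by rewrite epatch_indic muleC.
Qed.

Definition density (w : T -> R) & measurable_fun setT w & (forall x, (0 <= w x)%R) :=
  fun A => \int[nu]_(x in A) (w x)%:E.

Section density.
Context (w : T -> R) (mw : measurable_fun setT w) (w0 : forall x, (0 <= w x)%R).
Notation kappa := (density mw w0).

Let density0 : kappa set0 = 0.
Proof. by rewrite /density integral_set0. Qed.

Let density_ge0 A : 0 <= kappa A.
Proof. by apply: integral_ge0 => x _; rewrite lee_fin. Qed.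

Let density_sigma_additive : semi_sigma_additive kappa.
Proof.
move=> F mF tF mUF; rewrite /density; apply: cvg_toP.
  apply: ereal_nondecreasing_is_cvgn => m n mn.
  apply: lee_sum_nneg_natr => // k _ _.
  by apply: integral_ge0 => p _; rewrite lee_fin.
rewrite ge0_integral_bigcup//=.
- by apply/measurable_EFinP; apply: measurable_funTS.
- by move=> p _; rewrite lee_fin.
Qed.

HB.instance Definition _ := isMeasure.Build _ _ _ kappa
  density0 density_ge0 density_sigma_additive.

Lemma ge0_integral_densityE (f : T -> \bar R) :
  measurable_fun setT f -> (forall x, 0 <= f x) ->
  \int[kappa]_x f x = \int[nu]_x (f x * (w x)%:E).
Proof. by move=> mf f0; apply: ge0_integral_density. Qed.

End density.
End density_measure.

Section substitution.
Local Open Scope ereal_scope.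
Context (R : realType).
Local Notation lam := (@lebesgue_measure R).

Lemma eq_measure_lebesgue_integral (kappa : {measure set (measurableTypeR R) -> \bar R})
    (f : R -> \bar R) :
  (forall a b : R, lam `]a, b]%classic = kappa `]a, b]%classic) ->
  \int[lam]_x f x = \int[kappa]_x f x.
Proof.
move=> H; apply: eq_measure_integral => A mA _.
apply: lebesgue_measure_unique => // _ [[a b]] _ <- /=.
exact: H.
Qed.

Definition pushm d1 d2 (T1 : measurableType d1) (T2 : measurableType d2)
    (m : {measure set T1 -> \bar R}) (f : T1 -> T2) (mf : measurable_fun setT f) :
    {measure set T2 -> \bar R} :=
  measure_function_pushforward__canonical__measure_function_Measure m mf.

Lemma ge0_integral_pushm d1 d2 (T1 : measurableType d1) (T2 : measurableType d2)
    (m : {measure set T1 -> \bar R}) (phi : T1 -> T2)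
    (mphi : measurable_fun setT phi) (f : T2 -> \bar R) :
  measurable_fun setT f -> (forall x, 0 <= f x) ->
  \int[pushm m mphi]_x f x = \int[m]_x f (phi x).
Proof. by move=> mf f0; rewrite ge0_integral_pushforward// preimage_setT. Qed.

Lemma integral_lebesgue_scale (c : R) (f : R -> \bar R) : (0 < c)%R ->
  measurable_fun [set: measurableTypeR R] f -> (forall x, 0 <= f x) ->
  \int[lam]_x f x = \int[lam]_x (f (c * x)%R * c%:E).
Proof.
move=> c0 mf f0.
have mc : measurable_fun setT (fun x : measurableTypeR R => c * x : measurableTypeR R)%R.
  exact: measurable_funM.
pose kappa : {measure set (measurableTypeR R) -> \bar R} :=
  mscale (NngNum (ltW c0)) (pushm lam mc).
rewrite (@eq_measure_lebesgue_integral kappa _).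
  rewrite /kappa ge0_integral_mscale//=.
  rewrite ge0_integral_pushm//=.
  rewrite -ge0_integralZl//=.
  - by apply: eq_integral => x _; rewrite muleC.
  - exact: measurableT_comp.
  - by rewrite lee_fin ltW.
move=> a b; rewrite /kappa /pushm /= /mscale /= /pushforward /=.
rewrite (_ : _ @^-1` _ = `](a / c)%R, (b / c)%R]%classic); last first.
  apply/seteqP; split => x /=; rewrite !in_itv/=.
    by rewrite ltr_pdivrMr// ler_pdivlMr// mulrC.
  by rewrite ltr_pdivrMr// ler_pdivlMr// mulrC.
rewrite !lebesgue_measure_itv /= !lte_fin ltr_pM2r ?invr_gt0//.
case: ifPn => _; last by rewrite mule0.
rewrite -!EFinB -EFinM -mulrBl; congr (_%:E); field.
by rewrite gt_eqF.
Qed.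

Lemma integral_lebesgue_onem (f : R -> \bar R) :
  measurable_fun [set: measurableTypeR R] f -> (forall x, 0 <= f x) ->
  \int[lam]_x f x = \int[lam]_x (f (1 - x)%R).
Proof.
move=> mf f0.
have mc : measurable_fun setT (fun x : measurableTypeR R => 1 - x : measurableTypeR R)%R.
  exact: measurable_funB.
pose kappa : {measure set (measurableTypeR R) -> \bar R} :=
  pushm lam mc.
rewrite (@eq_measure_lebesgue_integral kappa _).
  by rewrite ge0_integral_pushm.
move=> a b; rewrite /kappa /pushm /= /pushforward/=.
rewrite (_ : _ @^-1` _ = `[(1 - b)%R, (1 - a)%R[%classic); last first.
  apply/seteqP; split => x /=; rewrite !in_itv/= => /andP[? ?]; apply/andP; split; lra.
rewrite !lebesgue_measure_itv /= !lte_fin.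
have -> : (1 - b < 1 - a)%R = (a < b)%R by apply/idP/idP => ?; lra.
case: ifPn => // _; rewrite -!EFinB; congr (_%:E); ring.
Qed.

Lemma integral_inv_sqr (c d : R) : (-1 < c)%R -> (c <= d)%R ->
  \int[lam]_(v in `[c, d]) (((1 + v) ^+ 2)^-1)%:E = ((1 + c)^-1 - (1 + d)^-1)%:E.
Proof.
move=> c1; rewrite le_eqVlt => /predU1P[->|cd].
  by rewrite set_itv1 integral_set1 subrr.
have P x : (c <= x)%R -> (0 < 1 + x)%R by move=> ?; lra.
have D x : (c <= x)%R -> is_derive x (1%R : R) (fun v => - (1 + v)^-1)%R (((1 + x) ^+ 2)^-1)%R.
  move=> cx; have h := P _ cx.
  have h1 : is_derive x (1%R : R) (fun v : R => 1 + v)%R 1%R.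
    rewrite -[X in is_derive _ _ _ X]add0r; exact: is_deriveD.
  apply: is_derive_eq.
    by apply: is_deriveN; apply: is_deriveV; exact: lt0r_neq0.
  by rewrite /GRing.scale /= mulr1 opprK.
have C x : (c <= x)%R -> {for x, continuous (fun v : R => - (1 + v)^-1)%R}.
  by move=> cx; apply: differentiable_continuous; apply/derivable1_diffP; case: (D _ cx).
rewrite (@continuous_FTC2 _ _ (fun v => - (1 + v)^-1)%R)//.
- by rewrite -EFinB; congr (_%:E); ring.
- apply: continuous_in_subspaceT => x; rewrite inE/= in_itv/= => /andP[cx _].
  have h := P _ cx.
  apply: cvgV; first by rewrite expf_neq0// gt_eqF.
  apply: (@continuous_comp _ _ _ (fun v : R => 1 + v)%R (fun y : R => y ^+ 2)%R); last exact: exprn_continuous.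
  by apply: cvgD; [exact: cvg_cst|exact: cvg_id].
- split.
  + by move=> x; rewrite in_itv/= => /andP[/ltW cx _]; case: (D _ cx).
  + by apply: cvg_at_right_filter; apply: C.
  + by apply: cvg_at_left_filter; apply: C; exact: ltW.
- by move=> x; rewrite in_itv/= => /andP[/ltW cx _]; rewrite derive1E; case: (D _ cx).
Qed.

Local Notation I01 := (`[(0 : R)%R, (1 : R)%R]%classic).
Local Notation I21 := (`[(2^-1 : R)%R, (1 : R)%R]%classic).
Local Notation I02 := (`[(0 : R)%R, (2^-1 : R)%R]%classic).

Lemma lebesgue_measure_inv (A : set (measurableTypeR R)) : measurable A ->
  lam (A `&` I21) =
  \int[lam]_(v in (fun v : R => (1 + v) `^ (-1))%R @^-1` A)
    (\1_I01 v * ((1 + v) `^ (-1)) ^+ 2)%:E.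
Proof.
pose phi (v : measurableTypeR R) : measurableTypeR R := ((1 + v) `^ (-1))%R.
have mphi : measurable_fun setT phi.
  by apply: (measurableT_comp (measurable_powR (-1))); exact: measurable_funD.
pose w (v : measurableTypeR R) : R := (\1_I01 v * (phi v) ^+ 2)%R.
have mw : measurable_fun setT w.
  by apply: measurable_funM => //; apply: measurable_funX.
have w0 x : (0 <= w x)%R by rewrite mulr_ge0// sqr_ge0.
have mI : measurable (I21 : set (measurableTypeR R)) by exact: measurable_itv.
move=> mA.
have intw (B I : set (measurableTypeR R)) :
   (phi @^-1` B) `&` I01 = I ->
   \int[lam]_(v in phi @^-1` B) (w v)%:E = \int[lam]_(v in I) (((1 + v) ^+ 2)^-1)%:E.
  move=> <-; rewrite [LHS]integral_mkcond [RHS]integral_mkcond.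
  apply: eq_integral => v _; rewrite !patchE in_setI.
  case: ifPn => //= _; rewrite /w /phi indicE; case: ifPn => [|_]; last by rewrite mul0r.
  rewrite inE/= in_itv/= => /andP[v0 _]; rewrite mul1r powR_inv1; last lra.
  by rewrite exprVn.
have phi01 (v : R) : (0 <= v)%R -> phi v = (1 + v)^-1%R by move=> v0; rewrite /phi powR_inv1//; lra.
have invlt (a v : R) : (0 < a)%R -> (0 <= v)%R -> (a < (1 + v)^-1)%R = (v < a^-1 - 1)%R.
  move=> a0 v0; have v1 : (0 < 1 + v)%R by lra.
  by rewrite -[in LHS](invrK a) ltf_pV2 ?posrE ?invr_gt0// ltrBrDl.
have invle (d v : R) : (0 < d)%R -> (0 <= v)%R -> ((1 + v)^-1 <= d)%R = (d^-1 - 1 <= v)%R.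
  move=> d0 v0; have v1 : (0 < 1 + v)%R by lra.
  by rewrite -[in LHS](invrK d) lef_pV2 ?posrE ?invr_gt0// lerBlDl.
have half (v : R) : (0 <= v)%R -> (v <= 1)%R -> (2^-1 <= (1 + v)^-1 <= 1)%R.
  by move=> v0 v1; rewrite -[X in (_ <= _ <= X)%R]invr1 !lef_pV2 ?posrE//; lra.
have mi (c d : R) : (0 <= c)%R -> measurable_fun `[c, d[%classic (fun v : R => (((1 + v) ^+ 2)^-1)%:E).
  move=> c0; apply/measurable_EFinP.
  apply: (@eq_measurable_fun _ _ _ _ _ (fun v : R => (phi v ^+ 2)%R)).
    move=> v; rewrite inE/= in_itv/= => /andP[cv _].
    by rewrite phi01 ?exprVn//; lra.
  by apply: measurable_funTS; apply: measurable_funX.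
change (mrestr lam mI A = pushm (density lam mw w0) mphi A).
pose kappa1 : {measure set (measurableTypeR R) -> \bar R} := mrestr lam mI.
have H := @measure_unique _ R (measurableTypeR R) (@ocitv R) (fun k => `](- k%:R)%R, k%:R]%classic)
  erefl (@ocitvI R) _ _ kappa1 (pushm (density lam mw w0) mphi).
apply: H => //.
- by move=> i; exists (- i%:R, i%:R)%R.
- by rewrite bigcup_itvT.
- move=> _ [[a b]] _ <- /=; rewrite /pushm/= /pushforward/= /density /kappa1/= /mrestr/=.
  set d := Num.min b 1%R.
  have d1 : (d <= 1)%R by rewrite /d ge_min lexx orbT.
  have db : (d <= b)%R by rewrite /d ge_min lexx.
  have dP x : (x <= 1)%R -> (x <= b)%R = (x <= d)%R by move=> x1; rewrite /d le_min x1 andbT.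
  have [a2|a2] := ltP a (2^-1)%R.
  + have [d2|d2] := ltP d (2^-1 : R)%R.
    * rewrite (_ : _ `&` _ = set0); last first.
        rewrite -subset0 => x /= []; rewrite !in_itv/= => /andP[_ xb] /andP[x2 x1].
        by move: xb; rewrite dP//; lra.
      rewrite measure0 (intw _ set0) ?integral_set0//.
      rewrite -subset0 => x /= []; rewrite !in_itv/= => /andP[_ xb] /andP[x0 x1].
      move: xb; rewrite phi01// => xb; have /andP[h1 h2] := half x x0 x1.
      by move: xb; rewrite dP//; lra.
    * have d0 : (0 < d)%R by lra.
      rewrite (_ : _ `&` _ = `[(2^-1 : R)%R, d]%classic); last first.
        apply/seteqP; split => x /=; rewrite !in_itv/=.
          by move=> [/andP[_ xb] /andP[x2 x1]]; rewrite x2 -dP.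
        by move=> /andP[x2 xd]; split; apply/andP; split; lra.
      have d'1 : (d^-1 <= 2)%R by rewrite -[X in (_ <= X)%R]invrK lef_pV2 ?posrE.
      have d'0 : (1 <= d^-1)%R by rewrite invf_ge1.
      rewrite (intw _ `[(d^-1 - 1)%R, (1 : R)%R]%classic); last first.
        apply/seteqP; split => x /=; rewrite !in_itv/=.
          move=> [/andP[_ xb] /andP[x0 x1]]; have /andP[h1 h2] := half x x0 x1.
          by move: xb; rewrite phi01// dP// invle// => ->.
        move=> /andP[xd x1]; have x0 : (0 <= x)%R by lra.
        have /andP[h1 h2] := half x x0 x1.
        rewrite x0 x1; split=> //; rewrite phi01// dP// invle// xd andbT; lra.
      rewrite integral_inv_sqr; [|lra..].
      rewrite lebesgue_measure_itv/= lte_fin; case: ifPn => hd.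
        by rewrite -EFinB; congr (_%:E); rewrite (_ : 1 + (d^-1 - 1) = d^-1)%R ?invrK//; ring.
      rewrite (_ : d = 2^-1)%R; last by apply/eqP; rewrite eq_le d2 andbT leNgt.
      by congr (_%:E); field.
  + have a0 : (0 < a)%R by lra.
    have [da|ad] := leP d a.
    * rewrite (_ : _ `&` _ = set0); last first.
        rewrite -subset0 => x /= []; rewrite !in_itv/= => /andP[ax xb] /andP[x2 x1].
        by move: xb; rewrite dP//; lra.
      rewrite measure0 (intw _ set0) ?integral_set0//.
      rewrite -subset0 => x /= []; rewrite !in_itv/= => /andP[ax xb] /andP[x0 x1].
      move: ax xb; rewrite phi01// => ax xb; have /andP[h1 h2] := half x x0 x1.
      by move: xb; rewrite dP//; lra.
    * have d0 : (0 < d)%R by lra.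
      rewrite (_ : _ `&` _ = `]a, d]%classic); last first.
        apply/seteqP; split => x /=; rewrite !in_itv/=.
          by move=> [/andP[-> xb] /andP[x2 x1]]; rewrite -dP.
        by move=> /andP[x2 xd]; split; apply/andP; split; lra.
      have a'1 : (a^-1 <= 2)%R by rewrite -[X in (_ <= X)%R]invrK lef_pV2 ?posrE.
      have d'0 : (1 <= d^-1)%R by rewrite invf_ge1.
      have da' : (d^-1 < a^-1)%R by rewrite ltf_pV2 ?posrE.
      rewrite (intw _ `[(d^-1 - 1)%R, (a^-1 - 1)%R[%classic); last first.
        apply/seteqP; split => x /=; rewrite !in_itv/=.
          move=> [/andP[ax xb] /andP[x0 x1]]; have /andP[h1 h2] := half x x0 x1.
          by move: ax xb; rewrite phi01// dP// invle// invlt// => -> ->.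
        move=> /andP[xd xa]; have x0 : (0 <= x)%R by lra.
        have x1 : (x <= 1)%R by lra.
        have /andP[h1 h2] := half x x0 x1.
        by rewrite x0 x1; split=> //; rewrite phi01// dP// invle// invlt// xd xa.
      rewrite integral_itv_bndo_bndc ?integral_inv_sqr; [|lra..|by apply: mi; lra].
      rewrite lebesgue_measure_itv/= lte_fin ad -EFinB; congr (_%:E).
      rewrite (_ : 1 + (d^-1 - 1) = d^-1)%R; last ring.
      by rewrite (_ : 1 + (a^-1 - 1) = a^-1)%R ?invrK//; ring.
- move=> k; rewrite /kappa1/= /mrestr/=; apply: (@le_lt_trans _ _ (lam I21)).
    by apply: le_measure; rewrite ?inE//; apply: measurableI => //; exact: measurable_itv.
  by rewrite lebesgue_measure_itv/=; case: ifP => _; rewrite ?ltry.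
Qed.

Lemma integral_lebesgue_inv (f : R -> \bar R) :
  measurable_fun [set: measurableTypeR R] f -> (forall x, 0 <= f x) ->
  \int[lam]_(x in I21) f x =
  \int[lam]_(v in I01) (f (1 + v)^-1%R * (((1 + v) ^+ 2)^-1)%:E).
Proof.
move=> mf f0.
pose phi (v : measurableTypeR R) : measurableTypeR R := ((1 + v) `^ (-1))%R.
have mphi : measurable_fun setT phi.
  by apply: (measurableT_comp (measurable_powR (-1))); exact: measurable_funD.
pose w (v : measurableTypeR R) : R := (\1_I01 v * (phi v) ^+ 2)%R.
have mw : measurable_fun setT w.
  by apply: measurable_funM => //; apply: measurable_funX.
have w0 x : (0 <= w x)%R by rewrite mulr_ge0// sqr_ge0.
pose kappa := pushm (density lam mw w0) mphi.
transitivity (\int[kappa]_(x in I21) f x).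
  apply: eq_measure_integral => A mA AI.
  by rewrite /kappa /pushm/= /pushforward/= /density -lebesgue_measure_inv// setIidl.
rewrite integral_mkcond ge0_integral_pushm//; last 2 first.
- by apply/(measurable_restrictT _ _).1 => //; exact: measurable_funTS.
- by move=> x; rewrite patchE; case: ifPn.
rewrite ge0_integral_densityE//; last 2 first.
- apply: measurableT_comp => //.
  by apply/(measurable_restrictT _ _).1 => //; exact: measurable_funTS.
- by move=> x; rewrite patchE; case: ifPn.
rewrite [RHS]integral_mkcond; apply: eq_integral => v _.
rewrite !patchE /w indicE.
have [|] := boolP (v \in I01); last by rewrite mul0r mule0.
rewrite inE/= in_itv/= => /andP[v0 v1].
have phiE : phi v = (1 + v)^-1%R by rewrite /phi powR_inv1//; lra.
rewrite mem_set; last first.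
  rewrite /= in_itv/= phiE -[X in (_ <= _ <= X)%R]invr1 !lef_pV2 ?posrE//; lra.
by rewrite mul1r phiE exprVn.
Qed.

Lemma integral_lebesgue_divD1 (f : R -> \bar R) :
  measurable_fun [set: measurableTypeR R] f -> (forall x, 0 <= f x) ->
  \int[lam]_(x in I02) f x =
  \int[lam]_(v in I01) (f (v / (1 + v))%R * (((1 + v) ^+ 2)^-1)%:E).
Proof.
move=> mf f0.
rewrite [LHS]integral_mkcond integral_lebesgue_onem//; last 2 first.
- by apply/(measurable_restrictT _ _).1 => //; exact: measurable_funTS.
- by move=> x; rewrite patchE; case: ifPn.
transitivity (\int[lam]_(x in I21) f (1 - x)%R).
  rewrite [RHS]integral_mkcond; apply: eq_integral => x _; rewrite !patchE.
  have -> // : ((1 - x)%R \in I02) = (x \in I21).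
  apply/idP/idP; rewrite !inE/= !in_itv/=; lra.
rewrite integral_lebesgue_inv//; last first.
  by apply: measurableT_comp => //; exact: measurable_funB.
apply: eq_integral => v; rewrite inE/= in_itv/= => /andP[v0 v1].
congr (f _ * _); field; lra.
Qed.

End substitution.

Section plane_substitution.
Context (R : realType).
Local Notation lam := (@lebesgue_measure R).
Local Notation leb2 := (lebesgue2 R).
Local Notation I01 := (`[(0 : R)%R, (1 : R)%R]%classic).
Local Notation I21 := (`[(2^-1 : R)%R, (1 : R)%R]%classic).
Local Notation I02 := (`[(0 : R)%R, (2^-1 : R)%R]%classic).

Lemma measurable_invr : measurable_fun [set: measurableTypeR R]
  (fun x : measurableTypeR R => x^-1 : measurableTypeR R).
Proof.
have -> : (fun x : measurableTypeR R => x^-1) =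
    (fun x : measurableTypeR R => if 0 <= x then x `^ (-1) * (x != 0)%:R
      else - ((- x) `^ (-1)) : measurableTypeR R).
  apply/funext => x; have [x0|x0] := leP 0 x.
    rewrite powR_inv1//; have [->|] := eqVneq x 0; first by rewrite invr0 mulr0.
    by rewrite mulr1.
  by rewrite powR_inv1 ?invrN ?opprK// oppr_ge0 ltW.
apply: measurable_fun_ifT.
- by apply: measurable_fun_ler => //; exact: measurable_id.
- apply: measurable_funM; first exact: measurable_powR.
  apply: (@measurableT_comp _ _ _ _ _ _ (fun b : bool => b%:R : measurableTypeR R)) => //.
  apply: measurable_neg; apply: measurable_fun_eqr => //.
- apply: measurable_funN; apply: (measurableT_comp (measurable_powR (-1))).
  exact: measurable_funN.
Qed.

Lemma measurable_fst_plane : measurable_fun [set: plane R] (fun p : plane R => p.1 : measurableTypeR R).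
Proof. exact: measurable_fst. Qed.

Lemma measurable_snd_plane : measurable_fun [set: plane R] (fun p : plane R => p.2 : measurableTypeR R).
Proof. exact: measurable_snd. Qed.

Definition branch0 (q : plane R) : plane R := ((1 + q.2)^-1, q.1 / (1 + q.2)).
Definition branch1 (q : plane R) : plane R := (q.1 / (1 + q.2), q.2 / (1 + q.2)).

Lemma measurable_inv1D : measurable_fun [set: plane R] (fun p : plane R => (1 + p.2)^-1 : measurableTypeR R).
Proof.
by apply: (measurableT_comp measurable_invr); apply: measurable_funD.
Qed.

Lemma measurable_branch0 : measurable_fun [set: plane R] branch0.
Proof.
apply: measurable_fun_pair; first exact: measurable_inv1D.
by apply: measurable_funM; [exact: measurable_fst_plane|exact: measurable_inv1D].
Qed.

Lemma measurable_branch1 : measurable_fun [set: plane R] branch1.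
Proof.
apply: measurable_fun_pair; apply: measurable_funM; try exact: measurable_inv1D.
- exact: measurable_fst_plane.
- exact: measurable_snd_plane.
Qed.

Local Open Scope ereal_scope.

Let jac (v : R) : R := ((1 + v) ^+ 3)^-1%R.

Lemma measurable_jac : measurable_fun [set: plane R] (fun p : plane R => jac p.2).
Proof.
rewrite (_ : (fun _ => _) = (fun p : plane R => ((1 + p.2)^-1) ^+ 3)%R); last first.
  by apply/funext => p; rewrite exprVn.
by apply: measurable_funX; exact: measurable_inv1D.
Qed.

Lemma integral_branch0 (F : plane R -> \bar R) :
  measurable_fun setT F -> (forall p, 0 <= F p) ->
  \int[leb2]_(p in I21 `*` setT) F p =
  \int[leb2]_(q in setT `*` I01) (F (branch0 q) * (jac q.2)%:E).
Proof.
move=> mF F0.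
have mI : measurable (I21 `*` setT : set (plane R)) by apply: measurableX => //; exact: measurable_itv.
have mI' : measurable (setT `*` I01 : set (plane R)) by apply: measurableX => //; exact: measurable_itv.
have mh : measurable_fun setT (fun q => F (branch0 q) * (jac q.2)%:E).
  apply: emeasurable_funM; first by apply: (measurableT_comp mF); exact: measurable_branch0.
  by apply/measurable_EFinP; exact: measurable_jac.
rewrite [LHS]integral_mkcond fubini_tonelli1; last 2 first.
- by apply/(measurable_restrictT _ _).1 => //; exact: measurable_funTS.
- by move=> x; rewrite patchE; case: ifPn.
transitivity (\int[lam]_(x in I21) \int[lam]_y F (x, y)).
  rewrite [RHS]integral_mkcond; apply: eq_integral => x _; rewrite /fubini_F patchE.
  case: ifPn => xI.
    by apply: eq_integral => y _; rewrite patchE in_setX xI in_setT.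
  by rewrite integral0_eq// => y _; rewrite patchE in_setX (negbTE xI).
rewrite integral_lebesgue_inv; last 2 first.
- exact: measurable_fun_fubini_tonelli_F.
- by move=> x; apply: integral_ge0.
rewrite [RHS]integral_mkcond fubini_tonelli2; last 2 first.
- by apply/(measurable_restrictT _ _).1 => //; exact: measurable_funTS.
- move=> q; rewrite patchE; case: ifPn => //; rewrite inE => -[_ /=]; rewrite in_itv/= => /andP[v0 _].
  by rewrite mule_ge0// lee_fin invr_ge0 exprn_ge0//; lra.
rewrite [LHS]integral_mkcond; apply: eq_integral => v _; rewrite /fubini_G patchE.
case: ifPn => vI; last first.
  by rewrite integral0_eq// => u _; rewrite patchE in_setX (negbTE vI) andbF.
transitivity (\int[lam]_u (F (branch0 (u, v)) * (jac v)%:E)); last first.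
  by apply: eq_integral => u _; rewrite patchE in_setX vI in_setT.
move: vI; rewrite inE/= in_itv/= => /andP[v0 v1].
have V : (0 < 1 + v)%R by lra.
have mFv : measurable_fun [set: measurableTypeR R] (fun y => F ((1 + v)^-1%R, y)).
  exact: measurableT_comp.
rewrite (@integral_lebesgue_scale _ (1 + v)^-1%R) ?invr_gt0//.
rewrite -ge0_integralZr//.
- apply: eq_integral => u _; rewrite /branch0 /= -muleA -EFinM /jac.
  by congr (F (_, _) * _%:E); [rewrite mulrC|rewrite -invfM -exprS].
- apply: emeasurable_funM => //; apply: (measurableT_comp mFv); exact: measurable_funM.
- by move=> u _; rewrite mule_ge0// lee_fin invr_ge0 ltW.
- by rewrite lee_fin invr_ge0 sqr_ge0.
Qed.

Lemma integral_branch1 (F : plane R -> \bar R) :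
  measurable_fun setT F -> (forall p, 0 <= F p) ->
  \int[leb2]_(p in setT `*` I02) F p =
  \int[leb2]_(q in setT `*` I01) (F (branch1 q) * (jac q.2)%:E).
Proof.
move=> mF F0.
have mI : measurable (setT `*` I02 : set (plane R)) by apply: measurableX => //; exact: measurable_itv.
have mI' : measurable (setT `*` I01 : set (plane R)) by apply: measurableX => //; exact: measurable_itv.
have mh : measurable_fun setT (fun q => F (branch1 q) * (jac q.2)%:E).
  apply: emeasurable_funM; first by apply: (measurableT_comp mF); exact: measurable_branch1.
  by apply/measurable_EFinP; exact: measurable_jac.
rewrite [LHS]integral_mkcond fubini_tonelli2; last 2 first.
- by apply/(measurable_restrictT _ _).1 => //; exact: measurable_funTS.
- by move=> x; rewrite patchE; case: ifPn.
transitivity (\int[lam]_(y in I02) \int[lam]_x F (x, y)).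
  rewrite [RHS]integral_mkcond; apply: eq_integral => y _; rewrite /fubini_G patchE.
  case: ifPn => xI.
    by apply: eq_integral => x _; rewrite patchE in_setX xI in_setT.
  by rewrite integral0_eq// => x _; rewrite patchE in_setX (negbTE xI) andbF.
rewrite integral_lebesgue_divD1; last 2 first.
- exact: measurable_fun_fubini_tonelli_G.
- by move=> x; apply: integral_ge0.
rewrite [RHS]integral_mkcond fubini_tonelli2; last 2 first.
- by apply/(measurable_restrictT _ _).1 => //; exact: measurable_funTS.
- move=> q; rewrite patchE; case: ifPn => //; rewrite inE => -[_ /=]; rewrite in_itv/= => /andP[v0 _].
  by rewrite mule_ge0// lee_fin invr_ge0 exprn_ge0//; lra.
rewrite [LHS]integral_mkcond; apply: eq_integral => v _; rewrite /fubini_G patchE.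
case: ifPn => vI; last first.
  by rewrite integral0_eq// => u _; rewrite patchE in_setX (negbTE vI) andbF.
transitivity (\int[lam]_u (F (branch1 (u, v)) * (jac v)%:E)); last first.
  by apply: eq_integral => u _; rewrite patchE in_setX vI in_setT.
move: vI; rewrite inE/= in_itv/= => /andP[v0 v1].
have V : (0 < 1 + v)%R by lra.
have mFv : measurable_fun [set: measurableTypeR R] (fun x => F (x, (v / (1 + v))%R)).
  exact: measurableT_comp.
rewrite (@integral_lebesgue_scale _ (1 + v)^-1%R) ?invr_gt0//.
rewrite -ge0_integralZr//.
- apply: eq_integral => u _; rewrite /branch1 /= -muleA -EFinM /jac.
  by congr (F (_, _) * _%:E); [rewrite mulrC|rewrite -invfM -exprS].
- apply: emeasurable_funM => //; apply: (measurableT_comp mFv); exact: measurable_funM.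
- by move=> u _; rewrite mule_ge0// lee_fin invr_ge0 ltW.
- by rewrite lee_fin invr_ge0 sqr_ge0.
Qed.

Lemma lebesgue2_graph (f : R -> R) :
  measurable [set p : plane R | p.2 = f p.1] -> leb2 [set p : plane R | p.2 = f p.1] = 0.
Proof.
move=> mA; rewrite /product_measure1/= integral0_eq// => x _.
rewrite /= (_ : xsection _ _ = [set f x]) ?lebesgue_measure_set1//.
by apply/seteqP; split => y; rewrite /xsection/= inE.
Qed.

End plane_substitution.

Section transfer.
Context (R : realType).
Local Notation leb2 := (lebesgue2 R).
Local Notation D := (@tri_bar R).
Local Notation G0 := (@Gamma0 R).
Local Notation G1 := (@Gamma1 R).
Local Notation S := (@Smap R).

Lemma measurable_set_ler (f g : plane R -> R) :
  measurable_fun [set: plane R] f -> measurable_fun [set: plane R] g ->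
  measurable [set p | f p <= g p].
Proof.
move=> mf mg; have := measurable_fun_ler mf mg.
by move=> /(_ measurableT [set true]); rewrite setTI; apply.
Qed.

Lemma measurable_set_ltr (f g : plane R -> R) :
  measurable_fun [set: plane R] f -> measurable_fun [set: plane R] g ->
  measurable [set p | f p < g p].
Proof.
move=> mf mg; have := measurable_fun_ltr mf mg.
by move=> /(_ measurableT [set true]); rewrite setTI; apply.
Qed.

Let mfst := @measurable_fst_plane R.
Let msnd := @measurable_snd_plane R.

Lemma measurable_Gamma0 : measurable G0.
Proof.
have -> : G0 = [set p : plane R | p.1 <= 1] `&` [set p : plane R | p.2 <= p.1]
     `&` [set p : plane R | 1 - p.1 < p.2].
  by apply/seteqP; split => p /=; rewrite /Gamma0 /=; tauto.
apply: measurableI; first apply: measurableI.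
- exact: measurable_set_ler.
- exact: measurable_set_ler.
- by apply: measurable_set_ltr => //; apply: measurable_funB.
Qed.

Lemma Gamma0_tri_bar : G0 `<=` D.
Proof. by move=> p [? [? ?]]; split => //; split => //; lra. Qed.

Lemma measurable_Gamma1 : measurable G1.
Proof. exact: (measurableD (@measurable_tri_bar R) measurable_Gamma0). Qed.

Lemma measurable_mem (A : set (plane R)) : measurable A ->
  measurable_fun [set: plane R] (fun p => p \in A).
Proof.
move=> mA; apply: (measurable_fun_bool true).
by rewrite setTI preimage_mem_true.
Qed.

Lemma measurable_Smap : measurable_fun [set: plane R] S.
Proof.
have mi1 : measurable_fun [set: plane R] (fun p : plane R => p.1^-1 : measurableTypeR R).
  exact: (measurableT_comp (@measurable_invr R)).
have mi2 : measurable_fun [set: plane R] (fun p : plane R => (1 - p.2)^-1 : measurableTypeR R).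
  by apply: (measurableT_comp (@measurable_invr R)); exact: measurable_funB.
rewrite /Smap; apply: measurable_fun_ifT; first by apply: measurable_mem; exact: measurable_Gamma0.
  by apply: measurable_fun_pair; apply: measurable_funM => //; exact: measurable_funB.
apply: measurable_fun_ifT => //; first by apply: measurable_mem; exact: measurable_Gamma1.
by apply: measurable_fun_pair; exact: measurable_funM.
Qed.

Lemma Smap_Gamma0 p : G0 p -> S p = (p.2 / p.1, (1 - p.1) / p.1).
Proof. by move=> h; rewrite /Smap mem_set. Qed.

Lemma Smap_Gamma1 p : G1 p -> S p = (p.1 / (1 - p.2), p.2 / (1 - p.2)).
Proof.
move=> h; rewrite /Smap memNset; last by case: h.
by rewrite mem_set.
Qed.

Definition off_diag : set (plane R) := [set p | D p /\ p.2 < p.1].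

Lemma branch0P (q : plane R) : 0 <= q.2 -> G0 (branch0 q) <-> (q.1 <= 1 /\ q.2 < q.1).
Proof.
move=> v0; have V : 0 < 1 + q.2 by lra.
rewrite /Gamma0 /branch0/=.
have -> : 1 - (1 + q.2)^-1 = q.2 / (1 + q.2) by field; lra.
rewrite ltr_pM2r ?invr_gt0// -[X in _ / _ <= X]mul1r ler_pM2r ?invr_gt0//.
have -> : ((1 + q.2)^-1 <= 1) by rewrite invf_le1//; lra.
by split => [[_]|].
Qed.

Lemma branch1P (q : plane R) : 0 <= q.2 -> G1 (branch1 q) <-> D q.
Proof.
move=> v0; have V : 0 < 1 + q.2 by lra.
rewrite /Gamma1 /Gamma0 /tri_bar /branch1/=.
have -> : 1 - q.1 / (1 + q.2) = (1 + q.2 - q.1) / (1 + q.2) by field; lra.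
have e : (q.1 / (1 + q.2) <= 1) = (q.1 <= 1 + q.2) by rewrite ler_pdivrMr ?mul1r.
rewrite e !ltr_pM2r ?invr_gt0// !ler_pM2r ?invr_gt0// divr_ge0 ?(ltW V)//.
split.
  move=> [[a [b _]] /= h]; split => //; rewrite leNgt; apply/negP => h1.
  by apply: h; split => //; split => //; lra.
move=> [q1 [q12 _]]; split; first by split => //; lra.
by move=> [_ [_]]; lra.
Qed.

Lemma Smap_branch0 (q : plane R) : off_diag q -> S (branch0 q) = q.
Proof.
move=> [[q1 [_ q2]] q12]; rewrite Smap_Gamma0; last exact/branch0P.
case: q q1 q2 q12 => u v /= *; rewrite /branch0/=.
by congr (_, _); field; lra.
Qed.

Lemma Smap_branch1 (q : plane R) : D q -> S (branch1 q) = q.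
Proof.
move=> Dq; have [q1 [q12 q2]] := Dq; rewrite Smap_Gamma1; last exact/branch1P.
case: q q1 q2 q12 {Dq} => u v /= *; rewrite /branch1/=.
by congr (_, _); field; lra.
Qed.

Lemma branch0_tri_bar q : D q -> D (branch0 q).
Proof.
move=> [q1 [q12 q2]]; have V : 0 < 1 + q.2 by lra.
rewrite /tri_bar /branch0/= -[X in _ / _ <= X]mul1r ler_pM2r ?invr_gt0// invf_le1// divr_ge0//; lra.
Qed.

Lemma branch1_tri_bar q : D q -> D (branch1 q).
Proof. by move=> [q1 [q12 q2]]; have [] : G1 (branch1 q) by exact/branch1P. Qed.

Lemma Smap_tri_bar p : D p -> D (S p).
Proof.
move=> Dp; have [p1 [p12 p2]] := Dp.
have [h|h] := pselect (G0 p).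
  rewrite Smap_Gamma0//; have [_ [_ h3]] := h; have x0 : 0 < p.1 by lra.
  rewrite /tri_bar/= ler_pM2r ?invr_gt0// ler_pdivrMr// mul1r divr_ge0//; lra.
rewrite Smap_Gamma1; last by split.
have h3 : p.2 <= 1 - p.1.
  by rewrite leNgt; apply/negP => h3; apply: h.
have y0 : 0 < 1 - p.2 \/ (p.1 = 1 /\ p.2 = 1).
  have [?|?] := ltP p.2 1; [left; lra|right; lra].
case: y0 => [y0|]; last lra.
rewrite /tri_bar/= ler_pM2r ?invr_gt0// ler_pdivrMr// mul1r divr_ge0//; lra.
Qed.

Lemma iter_Smap_tri_bar k p : D p -> D (iter k S p).
Proof. by move=> Dp; elim: k => //= k; exact: Smap_tri_bar. Qed.

Local Open Scope ereal_scope.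

Let jac (v : R) : R := ((1 + v) ^+ 3)^-1%R.

Lemma off_diag_ae_tri_bar (f : plane R -> \bar R) :
  measurable_fun setT f -> (forall q, D q -> 0 <= f q) ->
  \int[leb2]_(q in D) f q = \int[leb2]_(q in off_diag) f q.
Proof.
move=> mf f0; have mA : measurable [set p : plane R | p.2 = id p.1].
  rewrite (_ : [set _ | _] = [set p : plane R | p.2 <= p.1]%R `&` [set p : plane R | p.1 <= p.2]%R).
    by apply: measurableI; exact: measurable_set_ler.
  apply/seteqP; split => p /=; first by move=> ->.
  by move=> [? ?]; apply/eqP; rewrite eq_le; apply/andP.
rewrite (ge0_negligible_integral mA)//; last 3 first.
- exact: measurable_tri_bar.
- exact: measurable_funTS.
- exact: (@lebesgue2_graph R id).
congr integral; apply/seteqP; split => p /=.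
  by move=> [Dp /= np]; split => //; have [_ [h _]] := Dp; rewrite lt_neqAle h andbT; apply/eqP.
by move=> [Dp np]; split => // e; rewrite e ltxx in np.
Qed.

Lemma transfer0 (H : plane R -> \bar R) : measurable_fun setT H ->
  (forall p, G0 p -> 0 <= H p) ->
  \int[leb2]_(p in G0) H p = \int[leb2]_(q in off_diag) (H (branch0 q) * (jac q.2)%:E).
Proof.
move=> mH H0; rewrite integral_mkcond.
have mHG : measurable_fun setT (H \_ G0).
  apply/(measurable_restrictT _ _).1; first exact: measurable_Gamma0.
  exact: measurable_funTS.
transitivity (\int[leb2]_(p in `[(2^-1 : R)%R, (1 : R)%R]%classic `*` setT) (H \_ G0) p).
  rewrite [RHS]integral_mkcond; apply: eq_integral => p _; rewrite !patchE in_setX in_setT andbT.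
  case: ifPn => [|_]; last by case: ifPn.
  rewrite inE => -[p1 [p2 p3]]; rewrite mem_set//= in_itv/= p1 andbT; lra.
rewrite integral_branch0//; last first.
  by move=> p; rewrite patchE; case: ifPn => //; rewrite inE; exact: H0.
rewrite [LHS]integral_mkcond [RHS]integral_mkcond; apply: eq_integral => q _.
rewrite !patchE; case: ifPn => [|h].
  rewrite inE => -[_ /=]; rewrite in_itv/= => /andP[v0 v1].
  have [/[dup] /(branch0P v0) [h1 h2] h|h] := pselect (G0 (branch0 q)).
    by rewrite !mem_set//; split => //; split => //; split => //; exact: ltW.
  rewrite [in RHS]memNset; last by move=> [[h1 _] h2]; apply: h; apply/branch0P.
  by rewrite memNset// -[point]/(0 : \bar R) mul0e.
case: ifPn => //; rewrite inE => -[[q1 [q2 q3]] _]; case/negP: h.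
by rewrite inE; split => //=; rewrite in_itv/= q3/=; lra.
Qed.

Lemma transfer1 (H : plane R -> \bar R) : measurable_fun setT H ->
  (forall p, G1 p -> 0 <= H p) ->
  \int[leb2]_(p in G1) H p = \int[leb2]_(q in D) (H (branch1 q) * (jac q.2)%:E).
Proof.
move=> mH H0; rewrite integral_mkcond.
have mHG : measurable_fun setT (H \_ G1).
  apply/(measurable_restrictT _ _).1; first exact: measurable_Gamma1.
  exact: measurable_funTS.
transitivity (\int[leb2]_(p in setT `*` `[(0 : R)%R, (2^-1 : R)%R]%classic) (H \_ G1) p).
  rewrite [RHS]integral_mkcond; apply: eq_integral => p _; rewrite !patchE in_setX in_setT/=.
  case: ifPn => [|_]; last by case: ifPn.
  rewrite inE => -[[p1 [p2 p3]] h]; rewrite mem_set//= in_itv/= p3/= leNgt; apply/negP => h1.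
  by apply: h; split => //; split => //; lra.
rewrite integral_branch1//; last first.
  by move=> p; rewrite patchE; case: ifPn => //; rewrite inE; exact: H0.
rewrite [LHS]integral_mkcond [RHS]integral_mkcond; apply: eq_integral => q _.
rewrite !patchE; case: ifPn => [|h].
  rewrite inE => -[_ /=]; rewrite in_itv/= => /andP[v0 v1].
  have [/[dup] /(branch1P v0) h' h|h] := pselect (G1 (branch1 q)).
    by rewrite !mem_set.
  rewrite [in RHS]memNset; last by move=> h'; apply: h; apply/branch1P.
  by rewrite memNset// -[point]/(0 : \bar R) mul0e.
case: ifPn => //; rewrite inE => -[q1 [q2 q3]]; case/negP: h.
by rewrite inE; split => //=; rewrite in_itv/= q3/=; lra.
Qed.

Definition transferP (w : plane R -> R) (q : plane R) : R :=
  ((w (branch0 q) + w (branch1 q)) * jac q.2)%R.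

Lemma integral_transferP (g : plane R -> \bar R) (w : plane R -> R) :
  measurable_fun setT g -> (forall p, D p -> 0 <= g p) ->
  measurable_fun setT w -> (forall p, D p -> 0 <= w p)%R ->
  \int[leb2]_(p in D) (g (S p) * (w p)%:E) =
  \int[leb2]_(q in D) (g q * (transferP w q)%:E).
Proof.
move=> mg g0 mw w0.
have jac0 q : D q -> (0 <= jac q.2)%R.
  by move=> [_ [_ q2]]; rewrite invr_ge0 exprn_ge0//; lra.
have mb0 : measurable_fun setT (w \o @branch0 R).
  by apply: measurableT_comp => //; exact: measurable_branch0.
have mb1 : measurable_fun setT (w \o @branch1 R).
  by apply: measurableT_comp => //; exact: measurable_branch1.
have mj := @measurable_jac R.
have mH : measurable_fun setT (fun p => g (S p) * (w p)%:E).
  apply: emeasurable_funM; last exact/measurable_EFinP.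
  by apply: measurableT_comp => //; exact: measurable_Smap.
have H0 p : D p -> 0 <= g (S p) * (w p)%:E.
  by move=> Dp; rewrite mule_ge0 ?lee_fin ?w0// g0//; exact: Smap_tri_bar.
have DE : D = G0 `|` G1.
  apply/seteqP; split => p; first by move=> ?; have [?|?] := pselect (G0 p); [left|right].
  by move=> [/Gamma0_tri_bar//|[]].
rewrite [in LHS]DE ge0_integral_setU; last 5 first.
- exact: measurable_Gamma0.
- exact: measurable_Gamma1.
- exact: measurable_funTS.
- by rewrite -DE.
- by apply/disj_setPS => p [? []].
rewrite transfer0//; last by move=> p /Gamma0_tri_bar; exact: H0.
rewrite transfer1//; last by move=> p []; move=> /H0.
transitivity (\int[leb2]_(q in D) (g q * (w (branch0 q) * jac q.2)%:E) +
  \int[leb2]_(q in D) (g q * (w (branch1 q) * jac q.2)%:E)).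
  congr (_ + _); last first.
    by apply: eq_integral => q; rewrite inE => Dq; rewrite Smap_branch1// -muleA.
  rewrite off_diag_ae_tri_bar.
  - by apply: eq_integral => q; rewrite inE => Dq; rewrite Smap_branch0// -muleA.
  - by apply: emeasurable_funM => //; apply/measurable_EFinP; exact: measurable_funM.
  - by move=> q Dq; rewrite mule_ge0 ?g0// lee_fin mulr_ge0 ?jac0 ?w0//; exact: branch0_tri_bar.
rewrite -ge0_integralD//; last 5 first.
- exact: measurable_tri_bar.
- by move=> q Dq; rewrite mule_ge0 ?g0// lee_fin mulr_ge0 ?jac0 ?w0//; exact: branch0_tri_bar.
- by apply: measurable_funTS; apply: emeasurable_funM => //; apply/measurable_EFinP; exact: measurable_funM.
- by move=> q Dq; rewrite mule_ge0 ?g0// lee_fin mulr_ge0 ?jac0 ?w0//; exact: branch1_tri_bar.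
- by apply: measurable_funTS; apply: emeasurable_funM => //; apply/measurable_EFinP; exact: measurable_funM.
apply: eq_integral => q; rewrite inE => Dq.
rewrite /transferP mulrDl EFinD ge0_muleDr// lee_fin mulr_ge0 ?jac0 ?w0//.
  exact: branch0_tri_bar.
exact: branch1_tri_bar.
Qed.

End transfer.

Section densities.
Context (R : realType).
Implicit Types a b c : R.

(* [gdens k 1 u v] is the density at [(u, v)] of the image of Lebesgue measure
   under [S^k]; homogenising in a third variable removes the Jacobians from the
   transfer recursion. *)
Fixpoint gdens (k : nat) (a b c : R) : R :=
  if k is k'.+1 then gdens k' (a + c) a b + gdens k' (a + c) b c else (a ^+ 3)^-1.

Lemma gdens_ge0 k a b c : 0 < a -> 0 <= b -> 0 <= c -> 0 <= gdens k a b c.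
Proof.
elim: k a b c => [|k IH] a b c a0 b0 c0 /=; first by rewrite invr_ge0 exprn_ge0// ltW.
by apply: addr_ge0; apply: IH => //; lra.
Qed.

Lemma gdens_anti k a b c a' b' c' : 0 < a -> 0 <= b -> 0 <= c ->
  a <= a' -> b <= b' -> c <= c' -> gdens k a' b' c' <= gdens k a b c.
Proof.
elim: k a b c a' b' c' => [|k IH] a b c a' b' c' a0 b0 c0 aa bb cc /=.
  rewrite lef_pV2 ?posrE ?exprn_gt0//; last lra.
  by apply: lerXn2r => //; rewrite nnegrE; lra.
by apply: lerD; apply: IH => //; lra.
Qed.

Lemma gdensZ k t a b c : gdens k (t * a) (t * b) (t * c) = (t ^+ 3)^-1 * gdens k a b c.
Proof.
elim: k a b c => [|k IH] a b c /=; first by rewrite exprMn invfM.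
by rewrite -mulrDr !IH mulrDr.
Qed.

Definition gsum (n : nat) a b c : R := \sum_(k < n) gdens k a b c.

Lemma gsum_ge0 n a b c : 0 < a -> 0 <= b -> 0 <= c -> 0 <= gsum n a b c.
Proof. by move=> *; apply: sumr_ge0 => k _; exact: gdens_ge0. Qed.

Lemma gsum_anti n a b c a' b' c' : 0 < a -> 0 <= b -> 0 <= c ->
  a <= a' -> b <= b' -> c <= c' -> gsum n a' b' c' <= gsum n a b c.
Proof. by move=> *; apply: ler_sum => k _; exact: gdens_anti. Qed.

Lemma gsumZ n t a b c : gsum n (t * a) (t * b) (t * c) = (t ^+ 3)^-1 * gsum n a b c.
Proof. by rewrite /gsum mulr_sumr; apply: eq_bigr => k _; exact: gdensZ. Qed.

Lemma gsum_homo m n a b c : 0 < a -> 0 <= b -> 0 <= c -> (m <= n)%N ->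
  gsum m a b c <= gsum n a b c.
Proof.
move=> a0 b0 c0 mn; rewrite /gsum -(big_mkord xpredT (fun k => gdens k a b c)).
rewrite -(big_mkord xpredT (fun k => gdens k a b c)) (@big_cat_nat _ _ _ m 0 n)//= lerDl.
by apply: sumr_ge0 => k _; exact: gdens_ge0.
Qed.

Lemma gsum_harnack n t b c b' c' : 0 < t -> t <= 1 -> 0 <= b' -> 0 <= c' ->
  t * b' <= b -> t * c' <= c -> gsum n 1 b c <= (t ^+ 3)^-1 * gsum n 1 b' c'.
Proof.
move=> t0 t1 b0 c0 bb cc; rewrite -gsumZ mulr1.
by apply: gsum_anti => //; rewrite mulr_ge0// ltW.
Qed.

Lemma gsumS n a b c :
  gsum n.+1 a b c = (a ^+ 3)^-1 + gsum n (a + c) a b + gsum n (a + c) b c.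
Proof. by rewrite /gsum big_ord_recl/= -addrA -big_split/=. Qed.

(* Following the second branch [j] times before taking the first one. *)
Lemma gsum_unroll n a b c :
  gsum n a b c = \sum_(j < n) ((a + j%:R * c) ^+ 3)^-1
    + \sum_(j < n) gsum (n.-1 - j) (a + j.+1%:R * c) (a + j%:R * c) b.
Proof.
elim: n a => [|n IH] a; first by rewrite /gsum !big_ord0 addr0.
rewrite gsumS IH big_ord_recl [in RHS]big_ord_recl /= subn0 mul0r addr0 mul1r.
rewrite [in RHS]addrACA -!addrA; congr (_ + (_ + _)); congr (_ + _); apply: eq_bigr => j _.
  by congr ((_ ^+ 3)^-1); rewrite -[bump 0 j]/(j.+1) -natr1; ring.
rewrite /bump /= add1n.
have -> : (n - j.+1 = n.-1 - j)%N by rewrite -subn1 -subnDA add1n.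
by congr gsum; rewrite -!natr1; ring.
Qed.

Lemma sum_telescope_inv n (c v : R) : 0 < c -> 0 <= v ->
  \sum_(j < n) v / (c + j%:R * v) ^+ 2 <= v / c ^+ 2 + c^-1.
Proof.
move=> c0 v0.
have P (k : nat) : 0 < c + k%:R * v by rewrite ltr_pwDl// mulr_ge0.
suff H : \sum_(j < n.+1) v / (c + j%:R * v) ^+ 2 <= v / c ^+ 2 + c^-1 - (c + n%:R * v)^-1.
  apply: le_trans (_ : \sum_(j < n.+1) v / (c + j%:R * v) ^+ 2 <= _).
    by rewrite big_ord_recr/= lerDl divr_ge0// sqr_ge0.
  by apply: le_trans H _; rewrite gerBl invr_ge0 ltW.
elim: n => [|n IH].
  by rewrite big_ord1 mul0r addr0 addrK.
rewrite big_ord_recr/=; apply: le_trans (lerD IH (lexx _)) _.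
rewrite -!addrA !lerD2l [leLHS]addrC -lerBrDr.
have -> : - (c + n.+1%:R * v)^-1 - - (c + n%:R * v)^-1 = v / ((c + n%:R * v) * (c + n.+1%:R * v)).
  by rewrite -natr1; field; rewrite natr1 !gt_eqF.
rewrite ler_wpM2l// lef_pV2 ?posrE ?exprn_gt0 ?mulr_gt0// expr2 ler_wpM2r ?(ltW (P _))//.
by rewrite lerD2l ler_wpM2r// ler_nat.
Qed.

Definition adiag n : R := gsum n 1 1 1.

Lemma adiag_ge1 n : (0 < n)%N -> 1 <= adiag n.
Proof.
case: n => // n _; rewrite /adiag gsumS expr1n invr1.
by rewrite -addrA lerDl addr_ge0// gsum_ge0//; lra.
Qed.

Lemma adiag_ge0 n : 0 <= adiag n.
Proof. by apply: gsum_ge0 => //; lra. Qed.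

Lemma adiag_homo m n : (m <= n)%N -> adiag m <= adiag n.
Proof. by move=> mn; apply: gsum_homo => //; lra. Qed.

(* Induction on [n] through [gsum_unroll]: by Harnack and the induction
   hypothesis the [j]-th term is at most [144 / (7 + j w) ^ 2], which telescopes. *)
Lemma gsum_cusp n (w : R) : 0 < w -> w <= 1 -> w * gsum n 1 1 w <= 36 * adiag n.
Proof.
elim/ltn_ind: n w => n IH w w0 w1.
have [->|n0] := posnP n; first by rewrite /gsum/adiag /gsum !big_ord0 !mulr0.
have A1 := adiag_ge1 n0.
have term (j : 'I_n) : gsum (n.-1 - j) (1 + j.+1%:R * w) (1 + j%:R * w) 1
    <= 144 / (7 + j%:R * w) ^+ 2 * adiag n.
  set s := 1 + j%:R * w.
  have s1 : 1 <= s by rewrite /s lerDl mulr_ge0// ltW.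
  have s0 : 0 < s by lra.
  have jn : (n.-1 - j < n)%N by rewrite (leq_ltn_trans (leq_subr _ _))// prednK.
  have sV0 : 0 < s^-1 by rewrite invr_gt0.
  have sV1 : s^-1 <= 1 by rewrite invf_le1.
  have An : adiag (n.-1 - j) <= adiag n by apply: adiag_homo; exact: ltnW.
  have h1 : gsum (n.-1 - j) (1 + j.+1%:R * w) s 1 <= (s ^+ 3)^-1 * gsum (n.-1 - j) 1 1 s^-1.
    rewrite -gsumZ mulr1 divff ?gt_eqF//; apply: gsum_anti => //; try lra.
    by rewrite /s lerD2l ler_wpM2r ?(ltW w0)// ler_nat.
  have h2 : gsum (n.-1 - j) 1 1 s^-1 <= s ^+ 3 * adiag n.
    apply: le_trans (_ : s ^+ 3 * adiag (n.-1 - j) <= _); last by rewrite ler_wpM2l// exprn_ge0// ltW.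
    by have := @gsum_harnack (n.-1 - j) s^-1 1 s^-1 1 1; rewrite exprVn invrK; apply => //; lra.
  have h3 : gsum (n.-1 - j) 1 1 s^-1 <= 36 * s * adiag n.
    have := IH _ jn s^-1 sV0 sV1; rewrite mulrC ler_pdivrMr// => /le_trans; apply.
    by rewrite mulrAC ler_wpM2l// mulr_ge0// ltW.
  apply: (le_trans h1); rewrite (_ : 7 + _ = s + 6); last by rewrite /s; ring.
  have [s6|s6] := leP s 6.
    apply: le_trans (_ : 1 * adiag n <= _).
      by rewrite mul1r ler_pdivrMl ?exprn_gt0.
    apply: ler_wpM2r; first exact: adiag_ge0.
    by rewrite ler_pdivlMr ?exprn_gt0//; nra.
  apply: le_trans (_ : 36 / s ^+ 2 * adiag n <= _).
    rewrite ler_pdivrMl ?exprn_gt0//; apply: (le_trans h3).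
    by rewrite le_eqVlt; apply/orP; left; apply/eqP; field; lra.
  apply: ler_wpM2r; first exact: adiag_ge0.
  rewrite ler_pdivrMr ?exprn_gt0// mulrAC ler_pdivlMr ?exprn_gt0//; nra.
rewrite gsum_unroll mulrDr.
have b1 : w * (\sum_(j < n) ((1 + j%:R * w) ^+ 3)^-1) <= 2.
  rewrite mulr_sumr; apply: le_trans (_ : \sum_(j < n) w / (1 + j%:R * w) ^+ 2 <= _).
    apply: ler_sum => j _; apply: ler_wpM2l; first exact: ltW.
    have s1 : 1 <= 1 + j%:R * w by rewrite lerDl mulr_ge0// ltW.
    have s0 : 0 < 1 + j%:R * w by lra.
    by rewrite lef_pV2 ?posrE ?exprn_gt0//; apply: ler_weXn2l.
  by apply: le_trans (sum_telescope_inv _ _ _) _; rewrite ?expr1n ?invr1 ?(ltW w0)//; lra.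
have b2 : w * (\sum_(j < n) gsum (n.-1 - j) (1 + j.+1%:R * w) (1 + j%:R * w) 1)
    <= (144 * (w / 7 ^+ 2 + 7^-1)) * adiag n.
  apply: le_trans (_ : \sum_(j < n) 144 * (w / (7 + j%:R * w) ^+ 2) * adiag n <= _).
    rewrite mulr_sumr; apply: ler_sum => j _.
    apply: le_trans (ler_wpM2l (ltW w0) (term j)) _.
    by rewrite le_eqVlt; apply/orP; left; apply/eqP; ring.
  rewrite -mulr_suml -mulr_sumr; apply: ler_wpM2r; first exact: adiag_ge0.
  by apply: ler_wpM2l => //; apply: sum_telescope_inv => //; exact: ltW.
apply: le_trans (lerD b1 b2) _.
have : 144 * (w / 7 ^+ 2 + 7^-1) <= 30 :> R by lra.
move=> /(ler_wpM2r (adiag_ge0 n)); lra.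
Qed.

Lemma gsum_lower_cusp N (u v : R) : 0 <= u -> u <= 1 -> 0 < v -> v <= 1 -> 1 <= N%:R * v ->
  adiag N / (16 * v) <= gsum N.*2 1 u v.
Proof.
move=> u0 u1 v0 v1 Nv.
set m := Num.truncn v^-1.
have V0 : 0 <= v^-1 by rewrite invr_ge0 ltW.
have m1 : m%:R <= v^-1 by rewrite /m truncn_le.
have m2 : v^-1 < m.+1%:R by exact: truncnS_gt.
have m0 : (0 < m)%N by rewrite /m truncn_gt0 invf_ge1.
have mN : (m <= N)%N.
  rewrite -(ler_nat R); apply: (le_trans m1).
  by rewrite -[leLHS]mul1r ler_pdivrMr.
have mv : m%:R * v <= 1 by rewrite -ler_pdivlMr// mul1r.
have mv2 : (2 * v)^-1 <= m%:R.
  rewrite invfM ler_pdivrMl//; apply: ltW; apply: (lt_le_trans m2).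
  rewrite -natrM ler_nat mul2n -addnn -addn1 leq_add2l//.
rewrite gsum_unroll; apply: le_trans (_ : m%:R * (8^-1 * adiag N) <= _).
  rewrite mulrA [X in X <= _]mulrC; apply: ler_wpM2r; first exact: adiag_ge0.
  rewrite (_ : (16 * v)^-1 = (2 * v)^-1 / 8); first by apply: ler_wpM2r.
  by field; lra.
have ge0 (j : nat) : 0 <= gsum (N.*2.-1 - j) (1 + j.+1%:R * v) (1 + j%:R * v) u.
  have vp (k : nat) : 0 <= k%:R * v by rewrite mulr_ge0// ltW.
  by apply: gsum_ge0 => //; [rewrite ltr_pwDl|rewrite addr_ge0].
apply: ler_wpDl.
  apply: sumr_ge0 => j _; by rewrite invr_ge0 exprn_ge0// addr_ge0// mulr_ge0// ltW.
rewrite -(big_mkord xpredT (fun j => gsum (N.*2.-1 - j) (1 + j.+1%:R * v) (1 + j%:R * v) u)).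
rewrite (@big_cat_nat _ _ _ m 0 N.*2)//=; last by rewrite (leq_trans mN)// -addnn leq_addr.
apply: ler_wpDr; first by apply: sumr_ge0 => j _.
have -> : m%:R * (8^-1 * adiag N) = \sum_(0 <= j < m) (8^-1 * adiag N).
  by rewrite big_const_nat subn0 iter_addr_0 mulr_natl.
apply: ler_sum_nat => j /andP[_ jm].
have jv : j.+1%:R * v <= 1 by apply: le_trans mv; rewrite ler_wpM2r ?(ltW v0)// ler_nat.
have jv' : j%:R * v <= 1 by apply: le_trans jv; rewrite ler_wpM2r ?(ltW v0)// ler_nat.
have jN : (N <= N.*2.-1 - j)%N by clear -jm mN; lia.
have jp : 0 <= j.+1%:R * v by rewrite mulr_ge0// ltW.
have jp' : 0 <= j%:R * v by rewrite mulr_ge0// ltW.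
apply: le_trans (_ : 8^-1 * adiag (N.*2.-1 - j) <= _).
  by rewrite ler_wpM2l// adiag_homo.
have -> : 8^-1 * adiag (N.*2.-1 - j) = gsum (N.*2.-1 - j) (2 * 1) (2 * 1) (2 * 1).
  by rewrite gsumZ; congr (_^-1 * _); ring.
by apply: gsum_anti; lra.
Qed.

Lemma gdens_measurable k (f g h : plane R -> R) : measurable_fun [set: plane R] f ->
  measurable_fun [set: plane R] g -> measurable_fun [set: plane R] h ->
  measurable_fun [set: plane R] (fun p => gdens k (f p) (g p) (h p)).
Proof.
elim: k f g h => [|k IH] f g h mf mg mh /=.
  rewrite (_ : (fun _ => _) = (fun p => ((f p)^-1) ^+ 3)); last by apply/funext => p; rewrite exprVn.
  by apply: measurable_funX; exact: (measurableT_comp (@measurable_invr R)).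
by apply: measurable_funD; apply: IH => //; exact: measurable_funD.
Qed.

Definition qdens k (p : plane R) : R := gdens k 1 p.1 p.2.
Definition qsum n (p : plane R) : R := gsum n 1 p.1 p.2.

Lemma measurable_qdens k : measurable_fun [set: plane R] (qdens k).
Proof. by apply: gdens_measurable. Qed.

Lemma measurable_qsum k : measurable_fun [set: plane R] (qsum k).
Proof. by apply: measurable_sum => i; exact: measurable_qdens. Qed.

Lemma tri_bar_ge0 (p : plane R) : tri_bar p -> 0 <= p.1 /\ 0 <= p.2.
Proof. by move=> [? [? ?]]; lra. Qed.

Lemma qdens_ge0 k p : tri_bar p -> 0 <= qdens k p.
Proof. by move=> /tri_bar_ge0[? ?]; exact: gdens_ge0. Qed.

Lemma qsum_ge0 k p : tri_bar p -> 0 <= qsum k p.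
Proof. by move=> /tri_bar_ge0[? ?]; exact: gsum_ge0. Qed.

Lemma qdensS k p : tri_bar p -> qdens k.+1 p = transferP (qdens k) p.
Proof.
move=> [p1 [p12 p2]]; have V : 0 < 1 + p.2 by lra.
rewrite /transferP /qdens /= mulrC mulrDr -!gdensZ /branch0 /branch1 /= mulr1.
have e x : (1 + p.2) * (x / (1 + p.2)) = x by field; lra.
by rewrite !e divff// gt_eqF.
Qed.

Lemma qsum_le_Gamma0 n (p : plane R) : Gamma0 p -> qsum n p <= 288 * adiag n / p.2.
Proof.
move=> [p1 [p12 p2]]; have y0 : 0 < p.2 by lra.
have y1 : p.2 <= 1 by lra.
have := @gsum_harnack n 2^-1 p.1 p.2 1 p.2; rewrite /qsum => /(_ _ _ _ _ _ _)/le_trans -> //; try lra.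
rewrite ler_pdivlMr// [leLHS]mulrC mulrCA.
have := gsum_cusp n y0 y1.
set X := p.2 * _; lra.
Qed.

Lemma adiag_le_qsum n p : tri_bar p -> adiag n <= qsum n p.
Proof. by move=> [? [? ?]]; apply: gsum_anti => //; lra. Qed.

Lemma qsum_le_adiag n (p : plane R) : tri p -> qsum n p <= (p.2 ^+ 3)^-1 * adiag n.
Proof. by move=> [? [? ?]]; apply: gsum_harnack => //; lra. Qed.

Lemma qsumS n p : qsum n.+1 p = qsum n p + qdens n p.
Proof. by rewrite /qsum /gsum big_ord_recr. Qed.

Lemma qsumE n p : qsum n p = \sum_(k < n) qdens k p.
Proof. by []. Qed.

Local Open Scope ereal_scope.

Lemma integral_iter_Smap k (g : plane R -> \bar R) :
  measurable_fun setT g -> (forall p, tri_bar p -> 0 <= g p) ->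
  \int[lebesgue2 R]_(p in @tri_bar R) g (iter k (@Smap R) p) =
  \int[lebesgue2 R]_(p in @tri_bar R) (g p * (qdens k p)%:E).
Proof.
move=> mg g0; elim: k g mg g0 => [|k IH] g mg g0.
  by apply: eq_integral => p _; rewrite /qdens/= expr1n invr1 mule1.
transitivity (\int[lebesgue2 R]_(p in @tri_bar R) (g \o @Smap R) (iter k (@Smap R) p)).
  by apply: eq_integral => p _; rewrite iterS.
rewrite IH; last 2 first.
- by apply: measurableT_comp => //; exact: measurable_Smap.
- by move=> p Dp; apply: g0; exact: Smap_tri_bar.
rewrite integral_transferP//; last 2 first.
- exact: measurable_qdens.
- by move=> p; exact: qdens_ge0.
by apply: eq_integral => p; rewrite inE => Dp; rewrite qdensS.
Qed.

End densities.

Section excursions.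
Context (R : realType).
Local Notation leb2 := (lebesgue2 R).
Local Notation lam := (@lebesgue_measure R).
Local Notation D := (@tri_bar R).
Local Notation G0 := (@Gamma0 R).
Local Notation S := (@Smap R).

(* Explicit form of: in [Gamma0], with the next [i] iterates outside [Gamma0]. *)
Definition occ (i : nat) : set (plane R) :=
  [set p | G0 p /\ p.2 + i%:R * (1 - p.1) <= p.1].

Lemma measurable_occ i : measurable (occ i).
Proof.
apply: measurableI; first exact: measurable_Gamma0.
apply: measurable_set_ler => //; apply: measurable_funD => //; apply: measurable_funM => //.
exact: measurable_funB.
Qed.

Lemma avoid_Gamma0P i q : D q ->
  (forall j, (j < i)%N -> ~ G0 (iter j S q)) <-> q.1 + i%:R * q.2 <= 1.
Proof.
elim: i q => [|i IH] q Dq; have [q1 [q12 q2]] := Dq; first by rewrite mul0r addr0 q1.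
have split_ : (forall j, (j < i.+1)%N -> ~ G0 (iter j S q)) <->
    ~ G0 q /\ (forall j, (j < i)%N -> ~ G0 (iter j S (S q))).
  split=> [H|[H0 H]].
    by split; [exact: (H 0%N)|move=> j ji; rewrite -iterSr; exact: H].
  by case=> [//|j] ji; rewrite iterSr; exact: H.
rewrite split_ IH; last exact: Smap_tri_bar.
have iq : 0 <= i%:R * q.2 by rewrite mulr_ge0.
rewrite -natr1 mulrDl mul1r; split=> [[H0]|H].
  have h : q.1 + q.2 <= 1.
    by rewrite leNgt; apply/negP => h; apply: H0; split => //; split => //; lra.
  have [h1|h1] := eqVneq q.2 1; first by lra.
  have h2 : 0 < 1 - q.2 by rewrite subr_gt0 lt_neqAle h1; lra.
  rewrite Smap_Gamma1//= mulrA -mulrDl ler_pdivrMr// mul1r; lra.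
have H0 : ~ G0 q by move=> [_ [_]]; lra.
split => //.
have h2 : 0 < 1 - q.2.
  by rewrite subr_gt0 ltNge; apply/negP => h; lra.
by rewrite Smap_Gamma1//= mulrA -mulrDl ler_pdivrMr// mul1r; lra.
Qed.

Lemma occP i p : occ i p <-> G0 p /\ forall j, (j < i)%N -> ~ G0 (iter j.+1 S p).
Proof.
rewrite /occ /=; split=> -[G0p]; have x0 : 0 < p.1 by case: G0p => ? []; lra.
  move=> h; split => // j ji; rewrite -iterS iterSr.
  move: j ji; apply/avoid_Gamma0P; first exact/Smap_tri_bar/Gamma0_tri_bar.
  by rewrite Smap_Gamma0//= mulrA -mulrDl ler_pdivrMr// mul1r.
move=> h; split => //.
have /(avoid_Gamma0P i) : D (S p) by exact/Smap_tri_bar/Gamma0_tri_bar.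
rewrite Smap_Gamma0//= mulrA -mulrDl ler_pdivrMr// mul1r -Smap_Gamma0// => <- j ji.
by rewrite -iterSr; exact: h.
Qed.

(* An orbit segment that meets [Gamma0] has exactly one last visit to it. *)
Lemma last_visit n p : \sum_(k < n.+1) (\1_(occ (n - k)) (iter k S p) : R) =
  (`[< exists2 k, (k <= n)%N & G0 (iter k S p) >])%:R.
Proof.
elim: n p => [|n IH] p.
  rewrite big_ord1 /= indicE; congr (_%:R); congr nat_of_bool; apply/idP/asboolP.
    by rewrite inE => -[? _]; exists 0%N.
  by move=> [[|//] _ h]; rewrite inE; apply/occP.
rewrite big_ord_recl subn0 /=.
rewrite (eq_bigr (fun k : 'I_n.+1 => \1_(occ (n - k)) (iter k S (S p)) : R)); last first.
  by move=> k _; rewrite -iterSr.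
rewrite IH; case: asboolP => [[k kn Gk]|nk].
  rewrite indicE memNset ?add0r; last first.
    by move=> /occP[_ /(_ k)]; rewrite ltnS kn => /(_ isT); rewrite iterSr.
  rewrite (_ : `[< _ >] = true)//; apply/asboolP; exists k.+1 => //; by rewrite iterSr.
rewrite addr0 indicE; congr (_%:R); congr nat_of_bool; apply/idP/asboolP.
  by rewrite inE => /occP[? _]; exists 0%N.
move=> [[|k] kn Gk].
  rewrite inE; apply/occP; split => // j jn Gj; apply: nk; exists j => //.
  by rewrite -iterSr.
by exfalso; apply: nk; exists k => //; rewrite -iterSr.
Qed.

Lemma sum_triangle N (c q : nat -> R) :
  \sum_(n < N) \sum_(k < n.+1) c (n - k)%N * q k =
  \sum_(k < N) (\sum_(i < N - k) c i) * q k.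
Proof.
elim: N => [|N IH]; first by rewrite !big_ord0.
rewrite big_ord_recr/= IH [RHS]big_ord_recr/= [X in _ + X = _]big_ord_recr/= addrA.
congr (_ + _); last by rewrite subSnn big_ord1 subnn.
rewrite -big_split/=; apply: eq_bigr => k _.
by rewrite subSn ?(ltnW (ltn_ord _))// big_ord_recr/= mulrDl.
Qed.

Lemma sum_triangle_le N (c q : nat -> R) : (forall i, 0 <= c i) -> (forall i, 0 <= q i) ->
  \sum_(n < N) \sum_(k < n.+1) c (n - k)%N * q k <= (\sum_(i < N) c i) * (\sum_(k < N) q k).
Proof.
move=> c0 q0; rewrite sum_triangle mulr_sumr; apply: ler_sum => k _.
apply: ler_wpM2r => //; rewrite -(big_mkord xpredT c) -[leRHS](big_mkord xpredT c).
by rewrite [leRHS](@big_cat_nat _ _ _ (N - k)%N)//= ?leq_subr// lerDl sumr_ge0.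
Qed.

Lemma sum_triangle_ge N (c q : nat -> R) : (forall i, 0 <= c i) -> (forall i, 0 <= q i) ->
  (\sum_(i < N) c i) * (\sum_(k < N) q k) <= \sum_(n < N.*2) \sum_(k < n.+1) c (n - k)%N * q k.
Proof.
move=> c0 q0; rewrite sum_triangle mulr_sumr.
have NN : (N <= N.*2)%N by rewrite -addnn leq_addr.
rewrite -(big_mkord xpredT (fun k => (\sum_(i < N) c i) * q k)).
rewrite -(big_mkord xpredT (fun k => (\sum_(i < N.*2 - k) c i) * q k)).
rewrite [leRHS](@big_cat_nat _ _ _ N)//=; apply: ler_wpDr.
  by apply: sumr_ge0 => k _; rewrite mulr_ge0// sumr_ge0.
apply: ler_sum_nat => k /andP[_ kN]; apply: ler_wpM2r => //.
rewrite -(big_mkord xpredT c) -[leRHS](big_mkord xpredT c).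
rewrite [leRHS](@big_cat_nat _ _ _ N)//= ?lerDl ?sumr_ge0//.
by clear -kN; lia.
Qed.

Definition exc (N : nat) (p : plane R) : R := \sum_(i < N) \1_(occ i) p.

Lemma exc_ge0 N p : 0 <= exc N p.
Proof. by apply: sumr_ge0. Qed.

Lemma measurable_exc N : measurable_fun [set: plane R] (exc N).
Proof. by apply: measurable_sum => i; apply: measurable_indic; exact: measurable_occ. Qed.

Local Open Scope ereal_scope.

Lemma measurable_iter_Smap k : measurable_fun [set: plane R] (iter k S).
Proof.
elim: k => [|k IH]; first exact: measurable_id.
exact: (measurableT_comp (@measurable_Smap R) IH).
Qed.

Lemma last_visit_integral n :
  leb2 G0 <= \int[leb2]_(p in D) (\sum_(k < n.+1) \1_(occ (n - k)) p * qdens k p)%:E <= leb2 D.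
Proof.
have mD := @measurable_tri_bar R.
have m1 k i : measurable_fun [set: plane R] (fun p => \1_(occ i) (iter k S p) : R).
  apply: (measurableT_comp _ (measurable_iter_Smap k)).
  by apply: measurable_indic; exact: measurable_occ.
have -> : \int[leb2]_(p in D) (\sum_(k < n.+1) \1_(occ (n - k)) p * qdens k p)%:E =
   \int[leb2]_(p in D) (\sum_(k < n.+1) \1_(occ (n - k)) (iter k S p) : R)%:E.
  under eq_integral do rewrite -sumEFin.
  under [RHS]eq_integral do rewrite -sumEFin.
  rewrite ge0_integral_sum//; last 2 first.
  - move=> k; apply/measurable_EFinP; apply: measurable_funTS; apply: measurable_funM.
      by apply: measurable_indic; exact: measurable_occ.
    exact: measurable_qdens.
  - by move=> k p Dp; rewrite lee_fin mulr_ge0// qdens_ge0.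
  rewrite ge0_integral_sum//; last first.
    by move=> k; apply/measurable_EFinP; apply: measurable_funTS.
  apply: eq_bigr => k _.
  rewrite (integral_iter_Smap k (g := fun p => (\1_(occ (n - k)) p)%:E))//.
  by apply/measurable_EFinP; apply: measurable_indic; exact: measurable_occ.
have mh : measurable_fun D (fun p => (\sum_(k < n.+1) \1_(occ (n - k)) (iter k S p) : R)%:E).
  by apply/measurable_EFinP; apply: measurable_funTS; apply: measurable_sum => k.
apply/andP; split.
  rewrite -(setIidl (@Gamma0_tri_bar R)) -integral_indic//; last exact: measurable_Gamma0.
  apply: ge0_le_integral => //.
  - by apply/measurable_EFinP; apply: measurable_funTS; apply: measurable_indic; exact: measurable_Gamma0.
  - move=> p Dp; rewrite lee_fin last_visit indicE; case: (boolP (p \in G0)) => // h.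
    by rewrite (_ : `[< _ >] = true)//; apply/asboolP; exists 0%N => //; rewrite inE in h.
rewrite -[leRHS]mul1e -integral_cst//.
apply: ge0_le_integral => //.
- by move=> p Dp; rewrite lee_fin sumr_ge0.
- by move=> p Dp; rewrite lee_fin last_visit; case: asboolP.
Qed.

Lemma lebesgue2_tri_bar_le1 : leb2 D <= 1.
Proof.
apply: (@le_trans _ _ (leb2 (`[(0 : R)%R, (1 : R)%R]%classic `*` `[(0 : R)%R, (1 : R)%R]%classic))).
  apply: le_measure; rewrite ?inE.
  - exact: measurable_tri_bar.
  - by apply: measurableX; exact: measurable_itv.
  - by move=> p [p1 [p12 p2]]; split; rewrite /= in_itv/=; lra.
rewrite product_measure1E; try exact: measurable_itv.
by rewrite /= !lebesgue_measure_itv/= lte_fin ltr01 -EFinB subr0 mule1.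
Qed.

Lemma lebesgue2_Gamma0_ge : ((16 : R)^-1)%:E <= leb2 G0.
Proof.
apply: (@le_trans _ _ (leb2 (`[(3 / 4 : R)%R, (1 : R)%R]%classic `*` `[(2^-1 : R)%R, (3/4 : R)%R]%classic))).
  rewrite product_measure1E; try exact: measurable_itv.
  rewrite /= !lebesgue_measure_itv/= !lte_fin !ifT; [|lra..].
  rewrite -!EFinB -EFinM lee_fin; lra.
apply: le_measure; rewrite ?inE.
- by apply: measurableX; exact: measurable_itv.
- exact: measurable_Gamma0.
- move=> p [/=]; rewrite !in_itv/= => /andP[? ?] /andP[? ?]; split; first lra.
  by split; lra.
Qed.

Lemma exc_qsum_ge N : (N%:R / 16)%:E <= \int[leb2]_(p in D) (exc N p * qsum N p)%:E.
Proof.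
have mD := @measurable_tri_bar R.
have mo i : measurable_fun [set: plane R] (\1_(occ i) : plane R -> R).
  by apply: measurable_indic; exact: measurable_occ.
have mt n : measurable_fun [set: plane R] (fun p => \sum_(k < n.+1) \1_(occ (n - k)) p * qdens k p)%R.
  by apply: measurable_sum => k; apply: measurable_funM => //; exact: measurable_qdens.
have t0 n p : D p -> (0 <= \sum_(k < n.+1) \1_(occ (n - k)) p * qdens k p)%R.
  by move=> Dp; apply: sumr_ge0 => k _; rewrite mulr_ge0// qdens_ge0.
apply: (@le_trans _ _ (\sum_(n < N) \int[leb2]_(p in D) (\sum_(k < n.+1) \1_(occ (n - k)) p * qdens k p)%:E)).
  rewrite (_ : (N%:R / 16)%:E = \sum_(n < N) ((16 : R)^-1)%:E).
    apply: lee_sum => n _; apply: (le_trans lebesgue2_Gamma0_ge).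
    by have /andP[] := last_visit_integral n.
  by rewrite sumEFin big_const_ord iter_addr_0 mulr_natl.
rewrite -ge0_integral_sum//; last 2 first.
- by move=> n; apply/measurable_EFinP; exact: measurable_funTS.
- by move=> n p Dp; rewrite lee_fin t0.
apply: ge0_le_integral => //.
- by move=> p Dp; apply: sume_ge0 => n _; rewrite lee_fin t0.
- by apply: emeasurable_sum => n; apply/measurable_EFinP; exact: measurable_funTS.
- apply/measurable_EFinP; apply: measurable_funTS; apply: measurable_funM.
    exact: measurable_exc.
  exact: measurable_qsum.
- move=> p Dp; rewrite sumEFin lee_fin /exc qsumE.
  by apply: (@sum_triangle_le N (fun i => \1_(occ i) p) (fun k => qdens k p)) => // k; exact: qdens_ge0.
Qed.

Lemma exc_qsum_le N : \int[leb2]_(p in D) (exc N p * qsum N p)%:E <= (N.*2%:R)%:E.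
Proof.
have mD := @measurable_tri_bar R.
have mo i : measurable_fun [set: plane R] (\1_(occ i) : plane R -> R).
  by apply: measurable_indic; exact: measurable_occ.
have mt n : measurable_fun [set: plane R] (fun p => \sum_(k < n.+1) \1_(occ (n - k)) p * qdens k p)%R.
  by apply: measurable_sum => k; apply: measurable_funM => //; exact: measurable_qdens.
have t0 n p : D p -> (0 <= \sum_(k < n.+1) \1_(occ (n - k)) p * qdens k p)%R.
  by move=> Dp; apply: sumr_ge0 => k _; rewrite mulr_ge0// qdens_ge0.
apply: (@le_trans _ _ (\sum_(n < N.*2) \int[leb2]_(p in D) (\sum_(k < n.+1) \1_(occ (n - k)) p * qdens k p)%:E)); last first.
  rewrite (_ : (N.*2%:R)%:E = \sum_(n < N.*2) (1 : R)%:E); last first.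
    by rewrite sumEFin big_const_ord iter_addr_0.
  apply: lee_sum => n _; apply: le_trans lebesgue2_tri_bar_le1.
  by have /andP[] := last_visit_integral n.
rewrite -ge0_integral_sum//; last 2 first.
- by move=> n; apply/measurable_EFinP; exact: measurable_funTS.
- by move=> n p Dp; rewrite lee_fin t0.
apply: ge0_le_integral => //.
- by move=> p Dp; rewrite lee_fin mulr_ge0// ?exc_ge0// qsum_ge0.
- apply/measurable_EFinP; apply: measurable_funTS; apply: measurable_funM.
    exact: measurable_exc.
  exact: measurable_qsum.
- by apply: emeasurable_sum => n; apply/measurable_EFinP; exact: measurable_funTS.
- move=> p Dp; rewrite sumEFin lee_fin /exc qsumE.
  by apply: (@sum_triangle_ge N (fun i => \1_(occ i) p) (fun k => qdens k p)) => // k; exact: qdens_ge0.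
Qed.

End excursions.

Section log_estimates.
Context (R : realType).

Lemma ln_step_ge (n : nat) : (0 < n)%N -> (n.+1%:R^-1 : R) <= ln (n.+1%:R) - ln n%:R.
Proof.
move=> n0; have n0' : (0 : R) < n%:R by rewrite ltr0n.
have n1 : (0 : R) < n.+1%:R by rewrite ltr0n.
have := @le_ln1Dx R (n%:R / n.+1%:R - 1).
rewrite (_ : 1 + (n%:R / n.+1%:R - 1) = n%:R / n.+1%:R); last ring.
have h : n%:R / n.+1%:R - 1 = - (n.+1%:R^-1 : R).
  by rewrite -natr1; field; rewrite natr1 gt_eqF.
have h1 : 0 < n%:R / n.+1%:R :> R by rewrite divr_gt0.
rewrite ln_div ?posrE// => H.
have /H : -1 < n%:R / n.+1%:R - 1 :> R by rewrite ltrBrDr addNr.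
by rewrite h lerNr opprB.
Qed.

Lemma ln_step_le (n : nat) : (0 < n)%N -> ln (n.+1%:R) - ln n%:R <= (n%:R^-1 : R).
Proof.
move=> n0; have n0' : (0 : R) < n%:R by rewrite ltr0n.
have n1 : (0 : R) < n.+1%:R by rewrite ltr0n.
have h : 0 < n%:R^-1 :> R by rewrite invr_gt0.
have := @le_ln1Dx R (n%:R^-1).
rewrite (_ : 1 + n%:R^-1 = n.+1%:R / n%:R); last by rewrite -natr1; field; rewrite gt_eqF.
by rewrite ln_div ?posrE//; apply; lra.
Qed.

Lemma harmonic_le N : (0 < N)%N -> \sum_(i < N) (i.+1%:R^-1 : R) <= 1 + ln N%:R.
Proof.
elim: N => // -[|N] IH _; first by rewrite big_ord1 ln1 invr1 addr0.
rewrite big_ord_recr/=; apply: le_trans (lerD (IH isT) (lexx _)) _.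
have aux (x y z : R) : x <= y - z -> 1 + z + x <= 1 + y by move=> ?; lra.
by apply: aux; exact: ln_step_ge.
Qed.

Lemma sum_ln_le N : (0 < N)%N ->
  \sum_(i < N) ((1 + ln i.+1%:R) / i.+1%:R : R) <= (1 + ln N%:R) ^+ 2.
Proof.
move=> N0; have l0 (n : nat) : 0 <= ln (n.+1%:R : R) by rewrite ln_ge0// ler1n.
apply: le_trans (_ : \sum_(i < N) (1 + ln N%:R) * (i.+1%:R^-1 : R) <= _).
  apply: ler_sum => i _; apply: ler_wpM2r; first by rewrite invr_ge0.
  by rewrite lerD2l ler_ln ?posrE ?ltr0n// ler_nat.
rewrite -mulr_sumr expr2; apply: ler_wpM2l; last exact: harmonic_le.
by case: N N0 => // N _; rewrite addr_ge0.
Qed.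

Lemma sum_ln_ge N : ln (N.+1%:R : R) ^+ 2 - ln 2 ^+ 2 <= 3 * \sum_(i < N) (ln i.+1%:R / i.+1%:R : R).
Proof.
have l0 (n : nat) : 0 <= ln (n.+1%:R : R) by rewrite ln_ge0// ler1n.
elim: N => [|N IH]; first by rewrite big_ord0 ln1 expr0n/= mulr0 sub0r oppr_le0 sqr_ge0.
rewrite big_ord_recr/= mulrDr; case: N IH => [|N] IH.
  by rewrite big_ord0 ln1 mul0r !mulr0 addr0 subrr.
apply: le_trans (_ : ln (N.+3%:R : R) ^+ 2 - ln N.+2%:R ^+ 2 + (ln N.+2%:R ^+ 2 - ln 2 ^+ 2) <= _).
  by rewrite addrA subrK.
rewrite [leRHS]addrC; apply: lerD => //.
have h1 := @ln_step_le N.+2 isT.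
have h2 : ln (N.+3%:R : R) <= 2 * ln N.+2%:R.
  rewrite mulr_natl -lnXn ?ltr0n// ler_ln ?posrE ?exprn_gt0 ?ltr0n// -natrX ler_nat.
  by rewrite expnS expn1; clear; nia.
rewrite subr_sqr [leRHS]mulrA [leRHS]mulrC.
apply: ler_pM => //.
- by rewrite subr_ge0 ler_ln ?posrE ?ltr0n// ler_nat.
- by rewrite addr_ge0.
- have aux (x y : R) : x <= 2 * y -> x + y <= 3 * y by move=> ?; lra.
  exact: aux.
Qed.

Lemma integral_invr (a b : R) : 0 < a -> a <= b ->
  (\int[@lebesgue_measure R]_(y in `[a, b]) (y^-1)%:E = (ln b - ln a)%:E)%E.
Proof.
move=> a0; rewrite le_eqVlt => /predU1P[->|ab].
  by rewrite set_itv1 integral_set1 subrr.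
have P x : a <= x -> 0 < x by move=> ?; lra.
have C x : a <= x -> {for x, continuous (@ln R)}.
  by move=> ax; apply: differentiable_continuous; apply/derivable1_diffP; case: (is_derive1_ln (P _ ax)).
rewrite (@continuous_FTC2 _ _ (@ln R))//.
- apply: continuous_in_subspaceT => x; rewrite inE/= in_itv/= => /andP[cx _].
  by apply: cvgV; [rewrite gt_eqF// P|exact: cvg_id].
- split.
  + by move=> x; rewrite in_itv/= => /andP[/ltW cx _]; case: (is_derive1_ln (P _ cx)).
  + by apply: cvg_at_right_filter; apply: C.
  + by apply: cvg_at_left_filter; apply: C; exact: ltW.
- move=> x; rewrite in_itv/= => /andP[/ltW cx _]; rewrite derive1E.
  by case: (is_derive1_ln (P _ cx)) => _ ->.
Qed.

End log_estimates.

Section adiag_growth.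
Context (R : realType).
Local Notation leb2 := (lebesgue2 R).
Local Notation lam := (@lebesgue_measure R).
Local Notation D := (@tri_bar R).
Local Open Scope ereal_scope.

Lemma measurable_invr_snd : measurable_fun [set: plane R] (fun p : plane R => (p.2^-1)%:E).
Proof. by apply/measurable_EFinP; exact: (measurableT_comp (@measurable_invr R)). Qed.

Lemma occ_snd_gt0 i (p : plane R) : occ i p -> (0 < p.2)%R.
Proof. by move=> [[? [? ?]] _]; lra. Qed.

Lemma gdens_le_inv k (a b c : R) : (0 < c -> c <= b -> b <= a -> gdens k a b c <= (a * b * c)^-1)%R.
Proof.
elim: k a b c => [|k IH] a b c c0 cb ba /=.
  have b0 : (0 < b)%R by lra.
  have a0 : (0 < a)%R by lra.
  rewrite lef_pV2 ?posrE ?mulr_gt0 ?exprn_gt0// exprS expr2 mulrA.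
  by apply: ler_pM => //; [rewrite mulr_ge0 ?ltW|exact: ltW|rewrite ler_pM2l|lra].
apply: le_trans (lerD (IH _ _ _ _ _ _) (IH _ _ _ _ _ _)) _; try lra.
by rewrite le_eqVlt; apply/orP; left; apply/eqP; field; lra.
Qed.

Lemma adiag_le N : (adiag R N <= N%:R)%R.
Proof.
rewrite /adiag /gsum; apply: le_trans (_ : \sum_(k < N) 1 <= _)%R; last first.
  by rewrite big_const_ord iter_addr_0.
by apply: ler_sum => k _; apply: le_trans (gdens_le_inv _ _ _ _) _; rewrite ?mulr1 ?invr1.
Qed.

Lemma integral_occ_le i :
  \int[leb2]_(p in occ i) (p.2^-1)%:E <= ((1 + ln (i.+1%:R : R)) / i.+1%:R)%:E.
Proof.
set s : R := (i.+1%:R^-1)%R.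
have s0 : (0 < s)%R by rewrite invr_gt0 ltr0n.
have s1 : (s <= 1)%R by rewrite invf_le1 ?ltr0n// ler1n.
pose g (y : R) : R := (\1_(`[(0 : R)%R, s]%classic) y + s * (\1_(`[s, (1 : R)%R]%classic) y * y^-1))%R.
have mg : measurable_fun [set: measurableTypeR R] (fun y : R => (g y)%:E).
  apply/measurable_EFinP; apply: measurable_funD => //.
  apply: measurable_funM => //; apply: measurable_funM => //; exact: measurable_invr.
have i0 y : (0 <= \1_(`[s, (1 : R)%R]%classic) y * y^-1)%R.
  rewrite indicE; have [yI|] := boolP (y \in `[s, (1 : R)%R]%classic); last by rewrite mul0r.
  by rewrite mul1r invr_ge0; move: yI; rewrite inE/= in_itv/= => /andP[? _]; lra.
have mF : measurable_fun [set: plane R] ((fun p : plane R => (p.2^-1)%:E) \_ (occ i)).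
  apply/(measurable_restrictT _ _).1; first exact: measurable_occ.
  by apply: measurable_funTS; exact: measurable_invr_snd.
have g0 y : (0 <= g y)%R.
  by rewrite addr_ge0// mulr_ge0 ?(ltW s0).
rewrite integral_mkcond fubini_tonelli2; last 2 first.
- apply/(measurable_restrictT _ _).1; first exact: measurable_occ.
  by apply: measurable_funTS; exact: measurable_invr_snd.
- move=> p; rewrite patchE; case: ifPn => //; rewrite inE => -[[? [? ?]] _].
  by rewrite lee_fin invr_ge0; lra.
apply: (@le_trans _ _ (\int[lam]_y (g y)%:E)).
  apply: ge0_le_integral => //.
  - move=> y _; apply: integral_ge0 => x _; rewrite patchE; case: ifPn => //; rewrite inE => /occ_snd_gt0/= y0.
    by rewrite lee_fin invr_ge0 ltW.
  - apply: measurable_fun_fubini_tonelli_G => //.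
    move=> p; rewrite patchE; case: ifPn => //; rewrite inE => /occ_snd_gt0 y0.
    by rewrite lee_fin invr_ge0 ltW.
  move=> y _; rewrite /fubini_G.
  have [y0|y0] := leP y 0%R.
    rewrite integral0_eq ?lee_fin// => x _; rewrite patchE memNset//.
    by move=> /occ_snd_gt0/=; lra.
  have [y1|y1] := ltP 1%R y.
    rewrite integral0_eq ?lee_fin// => x _; rewrite patchE memNset//.
    by move=> [[/= ? [/= ? /= ?]] _]; lra.
  pose t := Num.min y s.
  have t0 : (0 < t)%R by rewrite lt_min y0.
  apply: (@le_trans _ _ (\int[lam]_(x in `[(1 - t)%R, (1 : R)%R]%classic) (y^-1)%:E)).
    rewrite [leRHS]integral_mkcond; apply: ge0_le_integral => //.
    + move=> x _; rewrite patchE; case: ifPn => //; rewrite inE => /occ_snd_gt0/= _.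
      by rewrite lee_fin invr_ge0 ltW.
    + exact: (measurableT_comp mF).
    + by apply/(measurable_restrictT _ _).1 => //.
    + move=> x _; rewrite !patchE; case: ifPn => [|_]; last first.
        by case: ifPn => // _; rewrite lee_fin invr_ge0 ltW.
      rewrite inE => -[[/= x1 [/= yx /= xy]] /= h]; rewrite mem_set//= in_itv/= x1 andbT lerBlDr -lerBlDl.
      rewrite /t le_min (ltW _)/=; last lra.
      rewrite /s -[leRHS]mul1r ler_pdivlMr ?ltr0n// -natr1 mulrDr mulr1 mulrC; lra.
  rewrite integral_cst// /= lebesgue_measure_itv/= lte_fin ifT; last lra.
  rewrite -EFinB -EFinM lee_fin opprB addrC subrK /g /t.
  have [ys|sy] := leP y s.
    rewrite mulVf ?gt_eqF// indicE mem_set ?lerDl /=; last by rewrite in_itv/= ys ltW.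
    by rewrite mulr_ge0 ?(ltW s0)// mulr_ge0// invr_ge0 ltW.
  rewrite [\1_(`[s, _]%classic) y]indicE [y \in _]mem_set /=; last by rewrite in_itv/= y1 ltW.
  by rewrite mul1r mulrC lerDr.
have -> : \int[lam]_y (g y)%:E = \int[lam]_y ((\1_(`[(0 : R)%R, s]%classic) y)%:E +
    s%:E * (\1_(`[s, (1 : R)%R]%classic) y * y^-1)%:E).
  by apply: eq_integral => y _; rewrite /g EFinD EFinM.
have mi : measurable_fun [set: measurableTypeR R] (fun y : R => (\1_(`[s, (1 : R)%R]%classic) y * y^-1)%:E).
  by apply/measurable_EFinP; apply: measurable_funM => //; exact: measurable_invr.
rewrite ge0_integralD//; last 2 first.
- by move=> y _; rewrite mule_ge0 ?lee_fin ?(ltW s0).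
- exact: emeasurable_funM.
rewrite ge0_integralZl//; last by rewrite lee_fin ltW.
rewrite integral_indic// setIT.
rewrite (_ : \int[lam]_y (\1_(`[s, (1 : R)%R]%classic) y * y^-1)%:E = \int[lam]_(y in `[s, (1 : R)%R]%classic) (y^-1)%:E); last first.
  rewrite [RHS]integral_mkcond; apply: eq_integral => y _.
  by rewrite patchE indicE; case: ifPn => _; rewrite ?mul1r ?mul0r.
rewrite integral_invr// ln1 sub0r /= lebesgue_measure_itv/= lte_fin s0 -EFinB subr0 -EFinM -EFinD lee_fin.
- by rewrite {2}/s lnV ?posrE ?ltr0n// opprK mulrDl mul1r [(s * _)%R]mulrC.
- by move=> y _; rewrite lee_fin.
- exact/measurable_EFinP.
Qed.

Lemma integral_box_invr (i : nat) :
  \int[leb2]_(p in `](1 - (2 * i.+1%:R)^-1)%R, (1 : R)%R]%classic `*` `[((2 * i.+1%:R)^-1)%R, (2^-1 : R)%R]%classic) (p.2^-1)%:E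
    = (ln (i.+1%:R : R) / (2 * i.+1%:R))%:E.
Proof.
set h : R := ((2 * i.+1%:R)^-1)%R.
have h0 : (0 < h)%R by rewrite invr_gt0 mulr_gt0// ltr0n.
have h1 : (h <= 2^-1)%R by rewrite lef_pV2 ?posrE ?mulr_gt0 ?ltr0n// ler_pMr// ler1n.
set X := `](1 - h)%R, _]%classic; set Y := `[h, _]%classic.
have mX : measurable (X : set (measurableTypeR R)) by exact: measurable_itv.
have mY : measurable (Y : set (measurableTypeR R)) by exact: measurable_itv.
rewrite integral_mkcond fubini_tonelli1; last 2 first.
- apply/(measurable_restrictT _ _).1; first exact: measurableX.
  by apply: measurable_funTS; exact: measurable_invr_snd.
- move=> p; rewrite patchE; case: ifPn => //; rewrite inE => -[_]; rewrite /Y /= in_itv/= => /andP[? ?].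
  by rewrite lee_fin invr_ge0; lra.
transitivity (\int[lam]_(x in X) (ln 2^-1 - ln h)%:E).
  rewrite [RHS]integral_mkcond; apply: eq_integral => x _; rewrite /fubini_F patchE.
  case: ifPn => xX; last first.
    by rewrite integral0_eq// => y _; rewrite patchE in_setX (negbTE xX).
  rewrite -integral_invr// [RHS]integral_mkcond; apply: eq_integral => y _.
  by rewrite !patchE in_setX xX.
rewrite integral_cst// /= lebesgue_measure_itv/= lte_fin ifT; last lra.
rewrite (_ : (1 + (- (1 - h))%:E) = h%:E); last by rewrite -EFinD; congr (_%:E); ring.
rewrite -EFinM /h !lnV ?posrE ?mulr_gt0 ?ltr0n//.
by congr (_%:E); rewrite lnM ?posrE ?ltr0n// opprK addKr.
Qed.

Lemma adiag_lower N : (0 < N)%N -> (N%:R <= 4608 * (adiag R N * (1 + ln (N%:R : R)) ^+ 2))%R.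
Proof.
move=> N0; have mD := @measurable_tri_bar R.
have mo i : measurable_fun [set: plane R] (\1_(occ i) : plane R -> R).
  by apply: measurable_indic; exact: measurable_occ.
have [K [K0 KE]] : exists K : R, (0 <= K /\ K = 288 * adiag R N)%R.
  by eexists; split; last reflexivity; exact: (mulr_ge0 (ler0n R 288) (adiag_ge0 R N)).
have io0 (i : nat) p : D p -> (0 <= \1_(occ i) p * p.2^-1 :> R)%R.
  by move=> /tri_bar_ge0[_ ?]; rewrite mulr_ge0// invr_ge0.
have mio (i : nat) : measurable_fun D (fun p : plane R => (\1_(occ i) p * p.2^-1)%:E).
  apply/measurable_EFinP; apply: measurable_funTS; apply: measurable_funM => //.
  exact: (measurableT_comp (@measurable_invr R)).
have /le_trans : (N%:R / 16)%:E <= (K * \sum_(i < N) ((1 + ln (i.+1%:R : R)) / i.+1%:R))%:E.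
  apply: (le_trans (exc_qsum_ge R N)).
  apply: (@le_trans _ _ (\sum_(i < N) \int[leb2]_(p in D) (K%:E * (\1_(occ i) p * p.2^-1)%:E))).
    rewrite -ge0_integral_sum//; last 2 first.
    - by move=> i; apply: emeasurable_funM.
    - by move=> i p Dp; rewrite mule_ge0 ?lee_fin ?io0.
    apply: ge0_le_integral => //.
    - by move=> p Dp; rewrite lee_fin mulr_ge0// ?exc_ge0// qsum_ge0.
    - apply/measurable_EFinP; apply: measurable_funTS; apply: measurable_funM.
        exact: measurable_exc.
      exact: measurable_qsum.
    - by apply: emeasurable_sum => i; apply: emeasurable_funM.
    - move=> p Dp; under eq_bigr do rewrite -EFinM.
      rewrite sumEFin lee_fin /exc mulr_suml; apply: ler_sum => i _.
      rewrite indicE; have [|_] := boolP (p \in occ i); last by rewrite !mul0r mulr0.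
      by rewrite inE => -[Gp _]; rewrite !mul1r KE; exact: qsum_le_Gamma0.
  rewrite mulr_sumr -sumEFin; apply: lee_sum => i _.
  rewrite ge0_integralZl//; last by move=> p Dp; rewrite lee_fin io0.
  rewrite EFinM; apply: lee_wpmul2l; first by rewrite lee_fin.
  apply: le_trans (integral_occ_le i); rewrite le_eqVlt; apply/orP; left; apply/eqP.
  rewrite [LHS]integral_mkcond [RHS]integral_mkcond; apply: eq_integral => p _.
  rewrite !patchE indicE; have [po|_] := boolP (p \in occ i).
    rewrite mem_set ?mul1r//; move: po; rewrite inE => -[Gp _]; exact: Gamma0_tri_bar.
  by case: ifP => _; rewrite ?mul0r.
move=> /(_ (K * (1 + ln (N%:R : R)) ^+ 2)%:E).
rewrite !lee_fin ler_wpM2l ?sum_ln_le// => /(_ isT).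
rewrite KE -mulrA; set X := (adiag R N * _)%R; clear; lra.
Qed.

Lemma adiag_upper_sum N :
  (adiag R N * \sum_(i < N./2) (ln (i.+1%:R : R) / i.+1%:R) <= 128 * N%:R)%R.
Proof.
have mD := @measurable_tri_bar R.
have mo i : measurable_fun [set: plane R] (\1_(occ i) : plane R -> R).
  by apply: measurable_indic; exact: measurable_occ.
have [K [K0 KE]] : exists K : R, (0 <= K /\ K = adiag R N / 16)%R.
  eexists; split; last reflexivity; apply: divr_ge0; first exact: adiag_ge0.
  exact: ler0n.
suff : (K * \sum_(i < N./2) (ln (i.+1%:R : R) / (2 * i.+1%:R)))%:E <= (N.*2.*2%:R)%:E.
  rewrite lee_fin -!addnn !natrD KE.
  rewrite (eq_bigr (fun i : 'I_(N./2) => 2^-1 * (ln (i.+1%:R : R) / i.+1%:R))%R); last first.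
    by move=> i _; rewrite invfM; ring.
  rewrite -mulr_sumr; set X := (\sum_(i < _) _)%R.
  rewrite (_ : adiag R N / 16 * (2^-1 * X) = adiag R N * X / 32)%R; last by field.
  by set Y := (adiag R N * X)%R; clear; lra.
apply: le_trans (exc_qsum_le R N.*2).
pose B (i : nat) : set (plane R) := `](1 - (2 * i.+1%:R)^-1)%R, (1 : R)%R]%classic `*` `[((2 * i.+1%:R)^-1)%R, (2^-1 : R)%R]%classic.
have mB i : measurable (B i) by apply: measurableX; exact: measurable_itv.
have BP (i : nat) p : B i p -> occ i p /\ ((2 * i.+1%:R)^-1 <= p.2 :> R)%R.
  move=> [/=]; rewrite !in_itv/= => /andP[x1 x2] /andP[y1 y2].
  have I0 : (0 < i.+1%:R :> R)%R by rewrite ltr0n.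
  have h0 : (0 < (2 * i.+1%:R)^-1 :> R)%R by rewrite invr_gt0 mulr_gt0.
  have h1 : ((2 * i.+1%:R)^-1 <= 2^-1 :> R)%R by rewrite lef_pV2 ?posrE ?mulr_gt0// ler_pMr// ler1n.
  have x3 : ((1 - p.1) * (2 * i.+1%:R) <= 1)%R.
    by rewrite -ler_pdivlMr ?mulr_gt0// mul1r; apply: ltW; rewrite ltrBlDr -ltrBlDl.
  move: h0 h1 x1 y1; set h : R := ((2 * i.+1%:R)^-1)%R => h0 h1 x1 y1.
  split=> //; split.
    have aux (x y k : R) : (0 < k -> k <= 2^-1 -> 1 - k < x -> x <= 1 -> k <= y -> y <= 2^-1 ->
      x <= 1 /\ y <= x /\ y > 1 - x)%R by move=> *; lra.
    exact: (aux _ _ h).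
  have aux (x y k : R) : ((1 - x) * (2 * (k + 1)) <= 1 -> y <= 2^-1 -> y + k * (1 - x) <= x)%R by move=> *; lra.
  by apply: aux => //; rewrite natr1.
have mBi i : measurable_fun D (fun p : plane R => (\1_(B i) p * p.2^-1)%:E).
  apply/measurable_EFinP; apply: measurable_funTS; apply: measurable_funM => //.
  exact: (measurableT_comp (@measurable_invr R)).
have B0 i p : D p -> (0 <= \1_(B i) p * p.2^-1 :> R)%R.
  by move=> /tri_bar_ge0[_ ?]; rewrite mulr_ge0// invr_ge0.
apply: (@le_trans _ _ (\sum_(i < N./2) \int[leb2]_(p in D) (K%:E * (\1_(B i) p * p.2^-1)%:E))).
  rewrite mulr_sumr -sumEFin; apply: lee_sum => i _.
  rewrite ge0_integralZl//; last by move=> p Dp; rewrite lee_fin B0.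
  rewrite EFinM; apply: lee_wpmul2l; first by rewrite lee_fin.
  rewrite -integral_box_invr le_eqVlt; apply/orP; left; apply/eqP.
  rewrite -/(B i) [LHS]integral_mkcond [RHS]integral_mkcond; apply: eq_integral => p _.
  rewrite !patchE indicE; have [po|_] := boolP (p \in B i).
    by rewrite mem_set ?mul1r//; move: po; rewrite inE => /BP[[Gp _] _]; exact: Gamma0_tri_bar.
  by case: ifP => _; rewrite ?mul0r.
rewrite -ge0_integral_sum//; last 2 first.
- by move=> i; apply: emeasurable_funM.
- by move=> i p Dp; rewrite mule_ge0 ?lee_fin ?B0.
apply: ge0_le_integral => //.
- by move=> p Dp; apply: sume_ge0 => i _; rewrite mule_ge0 ?lee_fin ?B0.
- by apply: emeasurable_sum => i; apply: emeasurable_funM.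
- apply/measurable_EFinP; apply: measurable_funTS; apply: measurable_funM.
    exact: measurable_exc.
  exact: measurable_qsum.
move=> p Dp; under eq_bigr do rewrite -EFinM.
rewrite sumEFin lee_fin /exc mulr_suml.
have q0 := qsum_ge0 N.*2 Dp.
have NN : (N./2 <= N.*2)%N by clear; lia.
rewrite -(big_mkord xpredT (fun i => (K * (\1_(B i) p / p.2))%R)).
rewrite -(big_mkord xpredT (fun i => (\1_(occ i) p * qsum N.*2 p)%R)).
rewrite [leRHS](@big_cat_nat _ _ _ N./2)//=; apply: ler_wpDr.
  by apply: sumr_ge0 => i _; rewrite mulr_ge0.
apply: ler_sum_nat => i /andP[_ iN].
rewrite indicE; have [|_] := boolP (p \in B i); last by rewrite mul0r mulr0 mulr_ge0.
rewrite inE => /BP[op yp]; rewrite mul1r indicE mem_set// mul1r.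
have [p1 [p12 p2]] := Dp.
have I0 : (0 < i.+1%:R :> R)%R by rewrite ltr0n.
have h0 : (0 < (2 * i.+1%:R)^-1 :> R)%R by rewrite invr_gt0 mulr_gt0.
have y0 : (0 < p.2)%R := lt_le_trans h0 yp.
rewrite KE -mulrA -invfM; apply: gsum_lower_cusp => //; try lra.
have : (1 <= p.2 * (2 * i.+1%:R))%R by rewrite -ler_pdivrMr ?mulr_gt0// mul1r.
move=> /le_trans; apply; rewrite mulrC; apply: ler_wpM2r; first exact: ltW.
by rewrite -natrM ler_nat; clear -iN; lia.
Qed.

Lemma adiag_upper N : (0 < N)%N -> (adiag R N * (1 + ln (N%:R : R)) ^+ 2 <= 2400 * N%:R)%R.
Proof.
move=> N0; have A0 := adiag_ge0 R N.
have AN := adiag_le N.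
have := adiag_upper_sum N; have := @sum_ln_ge R N./2.
set X := (\sum_(i < N./2) _)%R => h1 h2.
have N0' : (0 < N%:R :> R)%R by rewrite ltr0n.
have l2 : (0 < ln (2 : R) <= 1)%R.
  by rewrite ln_gt0 ?ltr1n//=; have := @ln_step_le R 1 isT; rewrite ln1 subr0 invr1.
set L := ln (N%:R : R).
have L0 : (0 <= L)%R by rewrite ln_ge0// ler1n.
have L1 : (L - ln 2 <= ln ((N./2).+1%:R : R))%R.
  rewrite -ln_div ?posrE// ler_ln ?posrE ?divr_gt0 ?ltr0n//.
  by rewrite ler_pdivrMr// -natrM ler_nat; clear; lia.
set M := ln ((N./2).+1%:R : R) in L1 h1.
have M0 : (0 <= M)%R by rewrite ln_ge0// ler1n.
have X0 : (0 <= X)%R.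
  by apply: sumr_ge0 => i _; rewrite mulr_ge0 ?ln_ge0 ?ler1n// invr_ge0.
have H : ((1 + L) ^+ 2 <= 6 * X + 10)%R.
  move: h1 l2 L1; set l := ln 2 => h1 /andP[l0 l1] L1.
  have l3 : (l ^+ 2 <= 1)%R by rewrite expr_le1// ltW.
  have h : ((1 + L) ^+ 2 <= (M + 2) ^+ 2)%R by apply: lerXn2r; rewrite ?nnegrE; lra.
  have sq := sqr_ge0 (M - 2)%R.
  clear -h sq l3 h1; apply: (le_trans h); lra.
apply: (le_trans (ler_wpM2l A0 H)); rewrite mulrDr mulrCA.
have aux (Y A n : R) : (0 <= A -> Y <= 128 * n -> A <= n -> 6 * Y + A * 10 <= 2400 * n)%R by move=> *; lra.
exact: aux.
Qed.

End adiag_growth.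

Section visits.
Context (R : realType).
Local Notation leb2 := (lebesgue2 R).
Local Notation D := (@tri_bar R).
Local Notation G0 := (@Gamma0 R).
Local Notation S := (@Smap R).
Local Notation T := (@Tmap R).

Definition visits (n : nat) (p : plane R) : nat := \sum_(j < n) (iter j S p \in G0).

Lemma visits0 p : visits 0 p = 0%N.
Proof. by rewrite /visits big_ord0. Qed.

Lemma visitsS n p : visits n.+1 p = (visits n p + (iter n S p \in G0))%N.
Proof. by rewrite /visits big_ord_recr. Qed.

Lemma visitsD m n p : visits (m + n) p = (visits m p + visits n (iter m S p))%N.
Proof.
elim: n => [|n IH]; first by rewrite addn0 visits0 addn0.
by rewrite addnS !visitsS IH -iterD [(n + m)%N]addnC addnA.
Qed.

Lemma visits_homo m n p : (m <= n)%N -> (visits m p <= visits n p)%N.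
Proof. by move=> /subnKC <-; rewrite visitsD leq_addr. Qed.

Lemma visits_eq0 n p : (forall j, (j < n)%N -> ~ G0 (iter j S p)) -> visits n p = 0%N.
Proof.
by move=> H; rewrite /visits big1// => j _; rewrite memNset//; exact: H.
Qed.

Lemma tri_tri_bar (p : plane R) : tri p -> D p.
Proof. by move=> [? [? ?]]; split => //; split => //; exact: ltW. Qed.

Lemma tri_indexP (p : plane R) : tri p -> tri_k (tri_index p) p.
Proof.
move=> tp; have [p1 [p12 p2]] := tp.
rewrite /tri_index; case: xgetP => [k -> //|/(_ (Num.truncn ((1 - p.1) / p.2)))]; case.
have q0 : 0 <= (1 - p.1) / p.2 by rewrite divr_ge0 ?(ltW p2)// subr_ge0.
have /andP[h1 h2] := truncn_itv q0.
split => //; split.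
  by rewrite subr_ge0 -ler_pdivlMr.
by rewrite subr_lt0 -ltr_pdivrMr.
Qed.

Lemma iter_Smap_Gamma1 k (p : plane R) : D p -> 0 < p.2 -> p.1 + k%:R * p.2 <= 1 ->
  iter k S p = (p.1 / (1 - k%:R * p.2), p.2 / (1 - k%:R * p.2)).
Proof.
move=> Dp y0; have [p1 [p12 p2]] := Dp.
elim: k => [|k IH] h; first by rewrite /= mul0r subr0 !divr1; case: (p).
have hk : p.1 + k%:R * p.2 <= 1 by move: h; rewrite -natr1 mulrDl mul1r; lra.
have ng : ~ G0 (iter k S p) by apply: ((avoid_Gamma0P k.+1 Dp).2 h k).
rewrite iterS Smap_Gamma1; last by split => //; exact: iter_Smap_tri_bar.
rewrite IH//=; move: h; rewrite -natr1 mulrDl mul1r; set c := k%:R * p.2 => h.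
have n1 : 1 - c != 0 by rewrite gt_eqF//; lra.
have n2 : 1 - (c + p.2) != 0 by rewrite gt_eqF//; lra.
have e : 1 - p.2 / (1 - c) = (1 - (c + p.2)) / (1 - c) by field.
by rewrite e; congr (_, _); field; rewrite n1 -opprD -addrA n2 || rewrite n1 n2.
Qed.

Lemma tri_index_visits (p : plane R) : tri p ->
  visits (tri_index p) p = 0%N /\ G0 (iter (tri_index p) S p) /\
  iter (tri_index p).+1 S p = T p.
Proof.
move=> tp; have Dp := tri_tri_bar tp; have [_ [h1 h2]] := tri_indexP tp.
have [p1 [p12 p2]] := tp; rewrite /= in p1 p12 p2.
set k := tri_index p in h1 h2 *.
have hk : p.1 + k%:R * p.2 <= 1 by lra.
have no := (avoid_Gamma0P k Dp).2 hk.
have G : G0 (iter k S p).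
  apply: contrapT => ng.
  have : p.1 + k.+1%:R * p.2 <= 1.
    apply/(avoid_Gamma0P _ Dp) => j; rewrite ltnS leq_eqVlt => /predU1P[->//|]; exact: no.
  by lra.
split; first exact: visits_eq0.
split => //; rewrite iterS Smap_Gamma0// iter_Smap_Gamma1//= /Tmap mem_set//.
rewrite -/k; set c := k%:R * p.2 in hk h1 *.
have n1 : 1 - c != 0 by rewrite gt_eqF//; lra.
have n2 : p.1 != 0 by rewrite gt_eqF//; lra.
by congr (_, _); field; rewrite n1 n2.
Qed.

Definition generic (p : plane R) := D p /\ forall k, 0 < (iter k S p).2.

Lemma generic_tri k p : generic p -> tri (iter k S p).
Proof. by move=> [Dp h]; have [? [? ?]] := iter_Smap_tri_bar k Dp; split. Qed.

(* One step of [Tmap] is [digit + 1] steps of [Smap], of which only the last one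
   starts in [Gamma0]. *)
Definition hit_time n p := (\sum_(1 <= k < n.+1) (@digit R k p) + n)%N.

Lemma hit_timeS n p : hit_time n.+1 p = (hit_time n p + (digit n.+1 p).+1)%N.
Proof. by rewrite /hit_time big_nat_recr//= !addnS addnAC. Qed.

Lemma iter_Tmap n p : generic p ->
  iter n T p = iter (hit_time n p) S p /\ visits (hit_time n p) p = n.
Proof.
move=> gp; elim: n => [|n [IH1 IH2]]; first by rewrite /hit_time big_nil visits0.
have tn : tri (iter n T p) by rewrite IH1; exact: generic_tri.
have [v0 [g1 e1]] := tri_index_visits tn.
have dE : digit n.+1 p = tri_index (iter n T p) by [].
rewrite hit_timeS dE iterS -e1 addnC iterD -IH1; split => //.
by rewrite addnC visitsD IH2 -IH1 visitsS v0 mem_set// add0n addn1.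
Qed.

Lemma visits_lt n p m : generic p -> (m < hit_time n.+1 p)%N -> (visits m p <= n)%N.
Proof.
move=> gp mh; have [IH1 IH2] := iter_Tmap n gp.
have tn : tri (iter n T p) by rewrite IH1; exact: generic_tri.
have [v0 _] := tri_index_visits tn.
move: mh; rewrite hit_timeS (_ : digit n.+1 p = tri_index (iter n T p))// addnS ltnS.
by move=> /(visits_homo p) /leq_trans; apply; rewrite visitsD IH2 -IH1 v0 addn0.
Qed.

Lemma visits_ge n p m : generic p -> (n <= visits m p)%N = (hit_time n p <= m)%N.
Proof.
move=> gp; apply/idP/idP => [|h]; last first.
  by rewrite -{1}(iter_Tmap n gp).2 visits_homo.
case: n => [|n]; first by rewrite /hit_time big_nil.
by move=> h; rewrite leqNgt; apply/negP => /(visits_lt gp); rewrite leqNgt h.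
Qed.

Local Open Scope ereal_scope.

Lemma ae_generic : {ae leb2, forall p, D p -> generic p}.
Proof.
have mD := @measurable_tri_bar R.
pose Z k := D `&` [set p | ((iter k S p).2 <= (fun=> 0%R) p)%R].
have mS k := @measurable_iter_Smap R k.
have mZ0 : measurable [set p : plane R | (p.2 <= (fun=> 0%R) p)%R] by exact: measurable_set_ler.
have mZ k : measurable (Z k).
  by apply: measurableI => //; apply: measurable_set_ler => //; exact: (measurableT_comp (@measurable_snd_plane R) (mS k)).
have Z0 k : leb2 (Z k) = 0.
  rewrite /Z setIC -integral_indic//; last first.
    by apply: measurable_set_ler => //; exact: (measurableT_comp (@measurable_snd_plane R) (mS k)).
  transitivity (\int[leb2]_(p in D) (fun q => (\1_[set p : plane R | (p.2 <= (fun=> 0%R) p)%R] q)%:E) (iter k S p)).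
    by apply: eq_integral => p _; rewrite !indicE; congr (_%:R%:E).
  rewrite (integral_iter_Smap k (g := fun q => (\1_[set p : plane R | (p.2 <= (fun=> 0%R) p)%R] q)%:E))//; last first.
    by apply/measurable_EFinP; exact: measurable_indic.
  rewrite (_ : \int[leb2]_(p in D) _ = \int[leb2]_(p in D) ((qdens k p)%:E * (\1_[set p : plane R | p.2 = (fun=> 0%R) p.1] p)%:E)); last first.
    apply: eq_integral => p; rewrite inE => -[_ [_ p2]]; rewrite muleC !indicE.
    congr (_ * (nat_of_bool _)%:R%:E); apply/idP/idP; rewrite !inE/= => h; last by rewrite h.
    by apply/eqP; rewrite eq_le h p2.
  have mL : measurable [set p : plane R | p.2 = (fun=> 0%R) p.1].
    rewrite (_ : [set _ | _] = [set p : plane R | (p.2 <= (fun=> 0) p)%R] `&` [set p : plane R | ((fun=> 0) p <= p.2)%R]).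
      by apply: measurableI; exact: measurable_set_ler.
    apply/seteqP; split => p /=; first by move=> ->.
    by move=> [? ?]; apply/eqP; rewrite eq_le; apply/andP.
  rewrite (ge0_negligible_integral mL)//.
  - by rewrite integral0_eq// => p [_ /= np]; rewrite indicE memNset ?mule0.
  - apply: emeasurable_funM; apply/measurable_EFinP; apply: measurable_funTS => //.
    exact: measurable_qdens.
  - by move=> p Dp; rewrite -EFinM lee_fin mulr_ge0// qdens_ge0.
  - exact: (@lebesgue2_graph R (fun=> 0%R)).
exists (\bigcup_k Z k); split.
- exact: bigcup_measurable.
- apply/negligibleP; first exact: bigcup_measurable.
  by apply: negligible_bigcup => k; apply/(negligibleP _ (mZ k)); exact: Z0.
- move=> p /= /not_implyP[Dp ng].
  have : ~ forall k, (0 < (iter k S p).2)%R by move=> h; apply: ng; split.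
  move=> /existsNP[k /negP]; rewrite -leNgt => hk.
  by exists k.
Qed.

Lemma integral_visits n :
  \int[leb2]_(p in D) ((visits n p)%:R : R)%:E = \int[leb2]_(p in G0) (qsum n p)%:E.
Proof.
have mD := @measurable_tri_bar R.
have mG := @measurable_Gamma0 R.
have mI : measurable_fun [set: plane R] (fun p => (\1_G0 p : R)%:E).
  by apply/measurable_EFinP; exact: measurable_indic.
transitivity (\sum_(k < n) \int[leb2]_(p in D) (\1_G0 (iter k S p) : R)%:E).
  rewrite -ge0_integral_sum//.
  - by apply: eq_integral => p _; rewrite sumEFin /visits natr_sum.
  - move=> k; apply: measurable_funTS.
    exact: (measurableT_comp mI (@measurable_iter_Smap R k)).
transitivity (\sum_(k < n) \int[leb2]_(p in D) ((\1_G0 p : R)%:E * (qdens k p)%:E)).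
  by apply: eq_bigr => k _; rewrite (integral_iter_Smap k (g := fun p => (\1_G0 p)%:E)).
rewrite -ge0_integral_sum//; last 2 first.
- move=> k; apply: emeasurable_funM; apply: measurable_funTS => //.
  by apply/measurable_EFinP; exact: measurable_qdens.
- by move=> k p Dp; rewrite -EFinM lee_fin mulr_ge0// qdens_ge0.
rewrite [LHS]integral_mkcond [RHS]integral_mkcond; apply: eq_integral => p _; rewrite !patchE.
have [Gp|nGp] := boolP (p \in G0).
  rewrite mem_set; last by move: Gp; rewrite inE => /Gamma0_tri_bar.
  under eq_bigr do rewrite -EFinM; rewrite sumEFin qsumE; congr (_%:E).
  by apply: eq_bigr => k _; rewrite indicE Gp mul1r.
case: ifPn => // _; rewrite big1// => k _.
by rewrite indicE (negbTE nGp) mul0e.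
Qed.

Lemma Gamma0_occ0 : G0 = occ 0.
Proof.
apply/seteqP; split => p; last by case.
by move=> Gp; split => //=; rewrite mul0r addr0; case: Gp => _ [].
Qed.

Lemma integral_visits_le n : \int[leb2]_(p in D) ((visits n p)%:R : R)%:E <= (288 * adiag R n)%:E.
Proof.
have mG := @measurable_Gamma0 R.
rewrite integral_visits.
have [K [K0 KE]] : exists K : R, (0 <= K /\ K = 288 * adiag R n)%R.
  by eexists; split; last reflexivity; exact: (mulr_ge0 (ler0n R 288) (adiag_ge0 R n)).
rewrite -KE; apply: (@le_trans _ _ (\int[leb2]_(p in G0) (K%:E * (p.2^-1)%:E))).
  apply: ge0_le_integral => //.
  - by move=> p Gp; rewrite lee_fin qsum_ge0//; exact: Gamma0_tri_bar.
  - by apply/measurable_EFinP; apply: measurable_funTS; exact: measurable_qsum.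
  - by apply: emeasurable_funM => //; apply: measurable_funTS; exact: measurable_invr_snd.
  - by move=> p Gp; rewrite -EFinM lee_fin KE; exact: qsum_le_Gamma0.
rewrite ge0_integralZl//; last 2 first.
- by apply: measurable_funTS; exact: measurable_invr_snd.
- by move=> p Gp; rewrite lee_fin invr_ge0; case: Gp => ? [? ?]; lra.
rewrite -[leRHS]mule1; apply: lee_wpmul2l; first by rewrite lee_fin.
by rewrite Gamma0_occ0; apply: le_trans (integral_occ_le R 0) _; rewrite ln1 addr0 divr1.
Qed.

Lemma measurable_visits n : measurable_fun [set: plane R] (fun p => (visits n p)%:R : R).
Proof.
rewrite (_ : (fun _ => _) = (fun p => \sum_(k < n) \1_G0 (iter k S p) : R)%R); last first.
  by apply/funext => p; rewrite /visits natr_sum.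
apply: measurable_sum => k; apply: (measurableT_comp _ (@measurable_iter_Smap R k)).
by apply: measurable_indic; exact: measurable_Gamma0.
Qed.

Lemma integral_visits_dyadic j :
  \int[leb2]_(p in D) (((visits (2 ^ j) p)%:R / 2 ^+ j : R)%:E) <=
  ((288 * 2400 / ln 2) * (ln 2 / (1 + j%:R * ln 2) ^+ 2))%:E.
Proof.
have mD := @measurable_tri_bar R.
have p0 : (0 < 2 ^+ j :> R)%R by rewrite exprn_gt0.
have mv := measurable_visits.
under eq_integral do rewrite EFinM muleC.
rewrite ge0_integralZl//; last first.
  by apply/measurable_EFinP; apply: measurable_funTS.
apply: (le_trans (lee_wpmul2l _ (integral_visits_le (2 ^ j)))).
  by rewrite lee_fin invr_ge0 ltW.
rewrite -EFinM lee_fin.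
have n0 : (0 < 2 ^ j)%N by rewrite expn_gt0.
have := adiag_upper R n0.
have l2 : (0 < ln (2 : R))%R by rewrite ln_gt0// ltr1n.
rewrite natrX lnXn// -[(ln 2 *+ j)%R]mulr_natl.
set A := adiag R _; set c := (1 + j%:R * ln 2)%R => h.
have c0 : (0 < c)%R by rewrite /c ltr_pwDl// mulr_ge0// ltW.
rewrite (_ : (288 * 2400 / ln 2 * (ln 2 / c ^+ 2)) = 288 * (2400 / c ^+ 2))%R; last first.
  by field; rewrite !gt_eqF.
rewrite ler_pdivrMl// mulrCA; apply: ler_wpM2l; first exact: ler0n.
by rewrite mulrA ler_pdivlMr ?exprn_gt0// [(2 ^+ j * _)%R]mulrC.
Qed.

Lemma ae_visits_dyadic :
  {ae leb2, forall p, D p -> ((visits (2 ^ j) p)%:R / 2 ^+ j : R)%R @[j --> \oo] --> (0 : R)%R}.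
Proof.
have mD := @measurable_tri_bar R.
pose f (j : nat) (p : plane R) : \bar R := ((visits (2 ^ j) p)%:R / 2 ^+ j : R)%:E.
have f0 j p : 0 <= f j p by rewrite lee_fin divr_ge0// exprn_ge0.
have mf j : measurable_fun D (f j).
  apply/measurable_EFinP; apply: measurable_funTS; apply: measurable_funM => //.
  exact: measurable_visits.
have l2 : (0 < ln (2 : R))%R by rewrite ln_gt0// ltr1n.
have fin : \int[leb2]_(p in D) (\sum_(j <oo) f j p) < +oo.
  rewrite integral_nneseries//.
  apply: (@le_lt_trans _ _ ((288 * 2400 / ln 2 * (ln 2 + 1) : R)%R%:E)); last exact: ltry.
  apply: lime_le.
    by apply: is_cvg_nneseries => n _ _; exact: integral_ge0.
  apply: nearW => n; rewrite big_mkord.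
  apply: (@le_trans _ _ (\sum_(j < n) ((288 * 2400 / ln 2) * (ln 2 / (1 + j%:R * ln 2) ^+ 2) : R)%:E)).
    by apply: lee_sum => j _; exact: integral_visits_dyadic.
  rewrite sumEFin lee_fin -mulr_sumr; apply: ler_wpM2l.
    by apply: divr_ge0; [apply: mulr_ge0; exact: ler0n|exact: ltW].
  apply: (le_trans (sum_telescope_inv n ltr01 (ltW l2))).
  by rewrite expr1n divr1 invr1.
have intf : leb2.-integrable D (fun p => \sum_(j <oo) f j p).
  apply/integrableP; split.
    by apply: ge0_emeasurable_sum.
  rewrite (eq_integral (fun p => \sum_(j <oo) f j p))// => p _.
  by rewrite gee0_abs//; apply: nneseries_ge0.
apply: filterS (integrable_ae mD intf) => p + Dp => /(_ Dp) fp.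
have [K fK] : exists K : R, \sum_(j <oo) f j p = K%:E.
  by exists (fine (\sum_(j <oo) f j p)); rewrite fineK.
apply: (@cvg_series_cvg_0 _ R^o); apply: nondecreasing_is_cvgn.
  apply/nondecreasing_seqP => n; rewrite /series/= big_nat_recr//= lerDl.
  by rewrite divr_ge0// exprn_ge0.
exists K => _ [n _ <-]; rewrite -lee_fin -fK /series/= -sumEFin.
exact: (@nneseries_lim_ge _ (f ^~ p) xpredT 0 n).
Qed.

Lemma ae_visits :
  {ae leb2, forall p, D p -> ((visits n p)%:R / n%:R : R)%R @[n --> \oo] --> (0 : R)%R}.
Proof.
apply: filterS ae_visits_dyadic => p + Dp => /(_ Dp) /cvgr0Pnorm_lt h.
apply/cvgr0Pnorm_lt => e e0.
have [J _ HJ] := h _ (divr_gt0 e0 (ltr0n R 2)).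
exists (2 ^ J)%N => // n /= Jn.
have n0 : (0 < n)%N by apply: leq_trans Jn; rewrite expn_gt0.
have /andP[h1 h2] := trunc_log_bounds (isT : (1 < 2)%N) n0.
set j := trunc_log 2 n in h1 h2.
have Jj : (J <= j.+1)%N.
  by apply: ltnW; rewrite -(ltn_exp2l _ _ (isT : (1 < 2)%N)); exact: leq_ltn_trans Jn h2.
have := HJ j.+1 Jj.
rewrite !ger0_norm ?divr_ge0 ?exprn_ge0//.
have P0 : (0 < 2 ^+ j.+1 :> R)%R by rewrite exprn_gt0.
have N0 : (0 < n%:R :> R)%R by rewrite ltr0n.
rewrite ltr_pdivrMr// ltr_pdivrMr//.
have V : ((visits n p)%:R <= (visits (2 ^ j.+1) p)%:R :> R)%R by rewrite ler_nat visits_homo// ltnW.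
move=> h3; apply: (le_lt_trans V); apply: (lt_le_trans h3).
rewrite -mulrA; apply: ler_wpM2l; first exact: ltW.
rewrite exprS mulrA mulVf ?mul1r; last by rewrite pnatr_eq0.
by rewrite -natrX ler_nat.
Qed.

Lemma ae_digits_average :
  {ae leb2, forall p, D p ->
     ((n%:R)^-1 * (\sum_(1 <= k < n.+1) digit k p)%:R : R)%R @[n --> \oo] --> +oo%R}.
Proof.
apply: filterS2 ae_generic ae_visits => p gp vp Dp.
have {}gp := gp Dp; have /cvgr0Pnorm_lt {}vp := vp Dp.
apply/cvgryPge => A.
pose B := (Num.max A 0 + 1)%R.
have B0 : (0 < B)%R by rewrite /B ltr_wpDl// le_max lexx orbT.
have B'0 : (0 < B^-1)%R by rewrite invr_gt0.
have [M _ HM] := vp _ B'0.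
exists M.+1 => // n /= Mn.
have n0 : (0 < n%:R :> R)%R by rewrite ltr0n (leq_trans _ Mn).
have hn : (n <= hit_time n p)%N by rewrite /hit_time leq_addl.
have m0 : (0 < (hit_time n p)%:R :> R)%R by rewrite ltr0n (leq_trans _ hn)// (leq_trans _ Mn).
have := HM _ (leq_trans (ltnW Mn) hn).
rewrite ger0_norm ?divr_ge0// (iter_Tmap n gp).2 ltr_pdivrMr// -ltr_pdivrMl ?invr_gt0// invrK.
rewrite /hit_time natrD => h.
apply: (@le_trans _ _ (Num.max A 0)%R); first by rewrite le_max lexx.
rewrite ler_pdivlMl//; move: h; rewrite /B mulrDl mul1r ltrD2r => /ltW.
by rewrite mulrC.
Qed.

End visits.

Section mu_integrals.
Context (R : realType).
Local Notation leb2 := (lebesgue2 R).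
Local Notation mu := (@mu R).
Local Notation D := (@tri_bar R).
Local Notation G0 := (@Gamma0 R).
Local Notation S := (@Smap R).
Local Open Scope ereal_scope.

Definition area (p : plane R) : R := (\1_D p * (p.1 * p.2))%R.

Lemma measurable_area : measurable_fun [set: plane R] area.
Proof.
apply: measurable_funM; first by apply: measurable_indic; exact: measurable_tri_bar.
exact: measurable_funM.
Qed.

Lemma area_ge0 p : (0 <= area p)%R.
Proof.
rewrite /area indicE; have [|_] := boolP (p \in D); last by rewrite mul0r.
by rewrite inE => /tri_bar_ge0[? ?]; rewrite mul1r mulr_ge0.
Qed.

Lemma area_le1 p : (area p <= 1)%R.
Proof.
rewrite /area indicE; have [|_] := boolP (p \in D); last by rewrite mul0r.
by rewrite inE => -[? [? ?]]; rewrite mul1r mulr_ile1//; lra.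
Qed.

Lemma area_gt0 p : tri p -> (0 < area p)%R.
Proof.
move=> tp; have [p1 [p12 p2]] := tp; rewrite /area indicE mem_set; last exact: tri_tri_bar.
by rewrite mul1r mulr_gt0//; lra.
Qed.

Lemma areaE p : D p -> area p = (p.1 * p.2)%R.
Proof. by move=> Dp; rewrite /area indicE mem_set// mul1r. Qed.

Lemma measurable_inv_prod : measurable_fun [set: plane R] (fun p : plane R => ((p.1 * p.2)^-1)%R).
Proof. by apply: (measurableT_comp (@measurable_invr R)); exact: measurable_funM. Qed.

Lemma integral_mu (f : plane R -> \bar R) : measurable_fun setT f -> (forall p, 0 <= f p) ->
  \int[mu]_p f p = \int[leb2]_(p in D) (f p * ((p.1 * p.2)^-1)%:E).
Proof.
move=> mf f0.
pose w p : R := (\1_D p * (p.1 * p.2)^-1)%R.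
rewrite (@ge0_integral_density _ _ _ leb2 w)//.
- rewrite [RHS]integral_mkcond; apply: eq_integral => p _; rewrite patchE /w indicE.
  by case: ifPn => _; rewrite ?mul1r// mul0r mule0.
- apply: measurable_funM; last exact: measurable_inv_prod.
  by apply: measurable_indic; exact: measurable_tri_bar.
- move=> p; rewrite /w indicE; have [|_] := boolP (p \in D); last by rewrite mul0r.
  by rewrite inE => /tri_bar_ge0[? ?]; rewrite mul1r invr_ge0 mulr_ge0.
- move=> A mA; rewrite -[LHS]/(\int[leb2]_(p in A `&` D) ((p.1 * p.2)^-1)%:E).
  rewrite [LHS]integral_mkcondr; apply: eq_integral => p _.
  by rewrite patchE /w indicE; case: ifPn => _; rewrite ?mul1r// mul0r.
Qed.

Lemma lebesgue2_axis : leb2 [set p : plane R | p.2 = (fun=> 0%R) p.1] = 0.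
Proof.
apply: (@lebesgue2_graph R (fun=> 0%R)).
rewrite (_ : [set _ | _] = [set p : plane R | (p.2 <= (fun=> 0) p)%R] `&` [set p : plane R | ((fun=> 0) p <= p.2)%R]).
  by apply: measurableI; exact: measurable_set_ler.
apply/seteqP; split => p /=; first by move=> ->.
by move=> [? ?]; apply/eqP; rewrite eq_le; apply/andP.
Qed.

Lemma measurable_axis : measurable [set p : plane R | p.2 = (fun=> 0%R) p.1].
Proof.
rewrite (_ : [set _ | _] = [set p : plane R | (p.2 <= (fun=> 0) p)%R] `&` [set p : plane R | ((fun=> 0) p <= p.2)%R]).
  by apply: measurableI; exact: measurable_set_ler.
apply/seteqP; split => p /=; first by move=> ->.
by move=> [? ?]; apply/eqP; rewrite eq_le; apply/andP.
Qed.

Lemma integral_mu_area (f : plane R -> \bar R) : measurable_fun setT f -> (forall p, D p -> 0 <= f p) ->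
  \int[mu]_p ((area p)%:E * f p) = \int[leb2]_(p in D) f p.
Proof.
move=> mf f0.
have mD := @measurable_tri_bar R.
have ma : measurable_fun [set: plane R] (fun p => (area p)%:E) by apply/measurable_EFinP; exact: measurable_area.
have mw : measurable_fun [set: plane R] (fun p : plane R => (((p.1 * p.2)^-1)%R)%:E).
  by apply/measurable_EFinP; exact: measurable_inv_prod.
have af0 p : 0 <= (area p)%:E * f p.
  have [Dp|nDp] := pselect (D p); first by rewrite mule_ge0 ?f0// lee_fin area_ge0.
  by rewrite /area indicE memNset// mul0r mul0e.
rewrite integral_mu//; last exact: emeasurable_funM.
rewrite (ge0_negligible_integral measurable_axis)//; last 3 first.
- by apply: measurable_funTS; apply: emeasurable_funM => //; exact: emeasurable_funM.
- by move=> p /tri_bar_ge0[? ?]; rewrite mule_ge0// lee_fin invr_ge0 mulr_ge0.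
- exact: lebesgue2_axis.
rewrite [RHS](ge0_negligible_integral measurable_axis)//; last 2 first.
- by apply: measurable_funTS.
- exact: lebesgue2_axis.
apply: eq_integral => p; rewrite inE => -[Dp /= p0].
have [p1 [p12 p2]] := Dp.
have y0 : (p.2 != 0)%R by apply/eqP.
have x0 : (p.1 != 0)%R by apply/eqP => x0; apply: p0; lra.
by rewrite areaE// muleAC -EFinM mulfV ?mul1e// mulf_neq0.
Qed.

Lemma mu_Gamma0_lty : mu G0 < +oo.
Proof.
apply: (@le_lt_trans _ _ 2%:E); last exact: ltry.
rewrite /Defs.mu setIidl; last exact: Gamma0_tri_bar.
apply: (@le_trans _ _ (\int[leb2]_(p in G0) (2%:E * (p.2^-1)%:E))).
  have mG := @measurable_Gamma0 R.
  apply: ge0_le_integral => //.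
  - by move=> p /Gamma0_tri_bar/tri_bar_ge0[? ?]; rewrite lee_fin invr_ge0 mulr_ge0.
  - by apply/measurable_EFinP; apply: measurable_funTS; exact: measurable_inv_prod.
  - by apply: measurable_funTS; apply: emeasurable_funM => //; exact: measurable_invr_snd.
  - move=> p Gp; rewrite -EFinM lee_fin invfM; have [p1 [p12 p2]] := Gp.
    rewrite ler_wpM2r ?invr_ge0//; first lra.
    by rewrite invf_ple ?posrE//; lra.
rewrite ge0_integralZl//; last 3 first.
- exact: measurable_Gamma0.
- by apply: measurable_funTS; exact: measurable_invr_snd.
- by move=> p /Gamma0_tri_bar/tri_bar_ge0[? ?]; rewrite lee_fin invr_ge0.
rewrite -[leRHS]mule1; apply: lee_wpmul2l; first by rewrite lee_fin.
by rewrite Gamma0_occ0; apply: le_trans (integral_occ_le R 0) _; rewrite ln1 addr0 divr1.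
Qed.

Lemma lebesgue2_le_mu (A : set (plane R)) : measurable A -> leb2 (A `&` D) <= mu A.
Proof.
move=> mA; have mD := @measurable_tri_bar R.
rewrite -integral_indic// -integral_mu_area//; last first.
  by apply/measurable_EFinP; exact: measurable_indic.
apply: (@le_trans _ _ (\int[mu]_p (\1_A p)%:E)); last by rewrite integral_indic// setIT.
have ma : measurable_fun [set: plane R] (fun p => (area p)%:E) by apply/measurable_EFinP; exact: measurable_area.
have mI : measurable_fun [set: plane R] (fun p => (\1_A p : R)%:E) by apply/measurable_EFinP; exact: measurable_indic.
apply: ge0_le_integral => //.
- by move=> p _; rewrite -EFinM lee_fin mulr_ge0// area_ge0.
- exact: emeasurable_funM.
- by move=> p _; rewrite -EFinM lee_fin ler_piMl// area_le1.
Qed.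

Lemma indic_Lfun_infty (A : set (plane R)) : measurable A -> (\1_A : plane R -> R) \in Lfun mu +oo.
Proof.
move=> mA; rewrite inE; apply/andP; split.
  by rewrite inE/=; exact: measurable_indic.
rewrite inE /= /finite_norm unlock; case: ifPn => // _.
apply: (@le_lt_trans _ _ 1%:E); last exact: ltry.
by apply/ess_sup_inf.ess_supP; apply: nearW => p /=; rewrite lee_fin indicE ger0_norm// lern1; case: (_ \in _).
Qed.

Lemma indic_Lfun1 (A : set (plane R)) : measurable A -> mu A < +oo -> (\1_A : plane R -> R) \in Lfun mu 1.
Proof.
move=> mA fA; apply/Lfun1_integrable; apply/integrableP; split.
  by apply/measurable_EFinP; exact: measurable_indic.
under eq_integral do rewrite gee0_abs ?lee_fin//.
by rewrite integral_indic// setIT.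
Qed.

Lemma area_Lfun1 : area \in Lfun mu 1.
Proof.
apply/Lfun1_integrable; apply/integrableP; split.
  by apply/measurable_EFinP; exact: measurable_area.
rewrite (eq_integral (fun p => (area p)%:E * (fun=> 1) p)); last first.
  by move=> p _; rewrite /= ger0_norm ?area_ge0// mule1.
rewrite (integral_mu_area (f := fun=> 1))// integral_cst ?mul1e; last exact: measurable_tri_bar.
by apply: le_lt_trans (lebesgue2_tri_bar_le1 R) _; exact: ltry.
Qed.

Lemma ae_le_of_integrals (f g : plane R -> R) : f \in Lfun mu 1 -> g \in Lfun mu 1 ->
  (forall F, measurable F -> \int[mu]_p (f p * \1_F p)%:E <= \int[mu]_p (g p * \1_F p)%:E) ->
  {ae mu, forall p, (f p <= g p)%R}.
Proof.
move=> /Lfun1_integrable If /Lfun1_integrable Ig H.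
have mf : measurable_fun [set: plane R] f by apply/measurable_EFinP; exact: measurable_int If.
have mg : measurable_fun [set: plane R] g by apply/measurable_EFinP; exact: measurable_int Ig.
pose F := [set p : plane R | (g p < f p)%R].
have mF : measurable F by exact: measurable_set_ltr.
have Ifg : mu.-integrable F (fun p => (f p - g p)%:E).
  apply: (integrableS measurableT) => //.
  rewrite (_ : (fun _ => _) = (EFin \o f) \- (EFin \o g)); last by apply/funext => p /=; rewrite EFinB.
  exact: integrableB.
have E0 : \int[mu]_(p in F) (f p - g p)%:E <= 0.
  rewrite (eq_integral (fun p => (f p)%:E - (g p)%:E)); last by move=> p _; rewrite EFinB.
  rewrite integralB//; [|exact: (integrableS measurableT)|exact: (integrableS measurableT)].
  rewrite sube_le0; have := H _ mF.
  rewrite [X in X <= _ -> _](_ : _ = \int[mu]_(p in F) (f p)%:E).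
    rewrite [X in _ <= X -> _](_ : _ = \int[mu]_(p in F) (g p)%:E)//.
    rewrite [RHS]integral_mkcond; apply: eq_integral => p _.
    by rewrite patchE indicE; case: ifPn => _; rewrite ?mulr1// mulr0.
  rewrite [RHS]integral_mkcond; apply: eq_integral => p _.
  by rewrite patchE indicE; case: ifPn => _; rewrite ?mulr1// mulr0.
have mfg : measurable_fun F (fun p => (f p - g p)%:E).
  by apply/measurable_EFinP; apply: measurable_funTS; exact: measurable_funB.
have E1 : \int[mu]_(p in F) `|(f p - g p)%:E| = 0.
  apply/eqP; rewrite eq_le; apply/andP; split; last exact: integral_ge0.
  rewrite (eq_integral (fun p => (f p - g p)%:E))//.
  by move=> p; rewrite inE /F /= => h; rewrite ger0_norm// subr_ge0 ltW.
have [N [mN N0 FN]] := (ae_eq_integral_abs _ mF mfg).1 E1.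
exists N; split => // p /= /negP; rewrite -ltNge => h; apply: FN => /= /(_ h) [].
by move/eqP; rewrite subr_eq0 gt_eqF.
Qed.

Section transfer_iterates.
Context (Shat : (plane R -> R) -> plane R -> R).
Context (Shat_transfer : transfer_operator mu S Shat).

Lemma iter_Shat_Lfun k u : u \in Lfun mu 1 -> iter k Shat u \in Lfun mu 1.
Proof. by move=> hu; elim: k => //= k /Shat_transfer[]. Qed.

Lemma iter_Shat_dual k u F : u \in Lfun mu 1 -> measurable F ->
  \int[mu]_p (iter k Shat u p * \1_F p)%:E = \int[mu]_p (u p * \1_F (iter k S p))%:E.
Proof.
move=> hu; elim: k F => [|k IH] F mF //=.
have [_ ->] := Shat_transfer (iter_Shat_Lfun k hu); last exact: indic_Lfun_infty.
have mSF : measurable (S @^-1` F).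
  by rewrite -[_ @^-1` _]setTI; exact: (@measurable_Smap R).
by rewrite -(IH _ mSF); apply: eq_integral.
Qed.

Definition qarea k (p : plane R) : R := (area p * qdens k p)%R.

Lemma measurable_qarea k : measurable_fun [set: plane R] (qarea k).
Proof. by apply: measurable_funM; [exact: measurable_area|exact: measurable_qdens]. Qed.

Lemma qarea_ge0 k p : (0 <= qarea k p)%R.
Proof.
have [Dp|nDp] := pselect (D p); first by rewrite mulr_ge0 ?area_ge0 ?qdens_ge0.
by rewrite /qarea /area indicE memNset// !mul0r.
Qed.

Lemma integral_qarea k F : measurable F ->
  \int[mu]_p (qarea k p * \1_F p)%:E = \int[mu]_p (area p * \1_F (iter k S p))%:E.
Proof.
move=> mF.
have mI : measurable_fun [set: plane R] (fun p => (\1_F p : R)%:E).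
  by apply/measurable_EFinP; exact: measurable_indic.
rewrite (eq_integral (fun p => (area p)%:E * ((\1_F p)%:E * (qdens k p)%:E))); last first.
  by move=> p _; rewrite -!EFinM /qarea -mulrA [(qdens k p * _)%R]mulrC.
rewrite integral_mu_area; last 2 first.
- by apply: emeasurable_funM => //; apply/measurable_EFinP; exact: measurable_qdens.
- by move=> p Dp; rewrite -EFinM lee_fin mulr_ge0// qdens_ge0.
rewrite -(integral_iter_Smap k (g := fun p => (\1_F p)%:E))//.
under [RHS]eq_integral do rewrite EFinM.
rewrite (integral_mu_area (f := fun p => (\1_F (iter k S p))%:E))//.
exact: (measurableT_comp mI (@measurable_iter_Smap R k)).
Qed.

Lemma qarea_Lfun1 k : qarea k \in Lfun mu 1.
Proof.
apply/Lfun1_integrable; apply/integrableP; split.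
  by apply/measurable_EFinP; exact: measurable_qarea.
rewrite (eq_integral (fun p => (qarea k p * \1_setT p)%:E)); last first.
  by move=> p _; rewrite /= ger0_norm ?qarea_ge0// indicT mulr1.
rewrite integral_qarea//.
rewrite (eq_integral (fun p => (area p)%:E * (fun=> 1) p)); last first.
  by move=> p _; rewrite indicT mulr1 mule1.
rewrite (integral_mu_area (f := fun=> 1))// integral_cst ?mul1e; last exact: measurable_tri_bar.
by apply: le_lt_trans (lebesgue2_tri_bar_le1 R) _; exact: ltry.
Qed.

Lemma iter_Shat_area k : {ae mu, forall p, iter k Shat area p = qarea k p}.
Proof.
have H F : measurable F -> \int[mu]_p (iter k Shat area p * \1_F p)%:E = \int[mu]_p (qarea k p * \1_F p)%:E.
  by move=> mF; rewrite integral_qarea// iter_Shat_dual//; exact: area_Lfun1.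
have L := iter_Shat_Lfun k area_Lfun1.
apply: filterS2 (ae_le_of_integrals L (qarea_Lfun1 k) _) (ae_le_of_integrals (qarea_Lfun1 k) L _).
- by move=> p h1 h2; apply/eqP; rewrite eq_le h1 h2.
- by move=> F /H ->.
- by move=> F /H ->.
Qed.

Lemma Rintegral_area : (\int[mu]_p area p)%R = fine (leb2 D).
Proof.
rewrite /Rintegral (eq_integral (fun p => (area p)%:E * (fun=> 1) p)); last first.
  by move=> p _; rewrite mule1.
rewrite (integral_mu_area (f := fun=> 1))// integral_cst ?mul1e//; exact: measurable_tri_bar.
Qed.

Lemma Rintegral_indic_mu (A : set (plane R)) : measurable A ->
  (\int[mu]_p \1_A p)%R = fine (mu A).
Proof. by move=> mA; rewrite /Rintegral integral_indic// setIT. Qed.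

Definition harea n (p : plane R) : R := (area p * qsum n p)%R.

Lemma hareaE n p : harea n p = (\sum_(k < n) qarea k p)%R.
Proof. by rewrite /harea qsumE mulr_sumr. Qed.

Lemma harea_ge0 n p : (0 <= harea n p)%R.
Proof. by rewrite hareaE; apply: sumr_ge0 => k _; exact: qarea_ge0. Qed.

Lemma measurable_harea n : measurable_fun [set: plane R] (harea n).
Proof. by apply: measurable_funM; [exact: measurable_area|exact: measurable_qsum]. Qed.

Context (a : nat -> R).
Context (a_return : return_sequence mu Shat a).

Lemma harea_cvg : {ae mu, forall p,
  ((a n)^-1 * harea n p)%R @[n --> \oo] --> fine (leb2 D)}.
Proof.
have [_ /(_ _ area_Lfun1)] := a_return; rewrite Rintegral_area => H.
have A : {ae mu, forall p, forall k, iter k Shat area p = qarea k p}.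
  by apply/ae_foralln => k; exact: iter_Shat_area.
apply: filterS2 A H => p e; apply: cvg_trans; apply: near_eq_cvg.
by apply: nearW => n /=; rewrite hareaE big_mkord; congr (_ * _)%R; apply: eq_bigr => k _.
Qed.

End transfer_iterates.

End mu_integrals.

Section log_root.
Context (R : realType).
Lemma ln_le_sqrt (n : nat) : (0 < n)%N -> (1 + ln (n%:R : R)) ^+ 2 <= 25 * Num.sqrt n%:R.
Proof.
move=> n0; have N1 : 1 <= n%:R :> R by rewrite ler1n.
have N0 : 0 < n%:R :> R by rewrite ltr0n.
set s := Num.sqrt (Num.sqrt (n%:R : R)).
have s0 : 0 < s by rewrite !sqrtr_gt0.
have s2 : s ^+ 2 = Num.sqrt n%:R by rewrite sqr_sqrtr// sqrtr_ge0.
have s4 : s ^+ 4 = n%:R by rewrite (exprM s 2 2) s2 sqr_sqrtr// ltW.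
have s1 : 1 <= s.
  rewrite leNgt; apply/negP => h; move: N1; rewrite -s4 leNgt => /negP; apply.
  by apply: exprn_ilt1 => //; exact: ltW.
have l : ln (n%:R : R) <= 4 * s.
  by rewrite -s4 lnXn// -[ln s *+ 4]mulr_natl ler_wpM2l// ltW// ln_sublinear.
have l0 : 0 <= ln (n%:R : R) by rewrite ln_ge0.
rewrite -s2; apply: le_trans (_ : (5 * s) ^+ 2 <= _).
  by apply: lerXn2r; rewrite ?nnegrE; lra.
by rewrite exprMn -natrX.
Qed.

Lemma adiag_ge_sqrt : exists2 K : R, 0 < K & forall n, Num.sqrt (n%:R : R) <= K * adiag R n.
Proof.
have [K K0 KE] : exists2 K : R, 0 < K & forall n : nat, (0 < n)%N -> n%:R <= K * (adiag R n * (1 + ln (n%:R : R)) ^+ 2).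
  by exists 4608; [exact: ltr0n|exact: adiag_lower].
exists (K * 25); first by apply: mulr_gt0 => //; exact: ltr0n.
move=> n; have A0 := adiag_ge0 R n.
have [->|n0] := posnP n; first by rewrite sqrtr0 !mulr_ge0 ?(ltW K0)// adiag_ge0.
have N0 : 0 < n%:R :> R by rewrite ltr0n.
have s0 : 0 < Num.sqrt (n%:R : R) by rewrite sqrtr_gt0.
have h1 := ln_le_sqrt n0; have h2 := KE _ n0.
rewrite -(ler_pM2r s0) -expr2 sqr_sqrtr ?(ltW N0)//; apply: (le_trans h2).
rewrite -!mulrA; apply: ler_wpM2l; first exact: ltW.
by rewrite (mulrCA 25); exact: (ler_wpM2l A0 h1).
Qed.
End log_root.

Section dual_ergodic.
Context (R : realType).
Local Notation leb2 := (lebesgue2 R).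
Local Notation mu := (@mu R).
Local Notation D := (@tri_bar R).
Local Notation G0 := (@Gamma0 R).
Local Notation S := (@Smap R).

Context (Shat : (plane R -> R) -> plane R -> R).
Context (Shat_transfer : transfer_operator mu S Shat).
Context (a : nat -> R).
Context (a_return : return_sequence mu Shat a).

Let a_gt0 n : 0 < a n. Proof. by case: a_return. Qed.

Definition kappa : R := fine (leb2 D).

Lemma kappaE : leb2 D = kappa%:E.
Proof.
rewrite fineK// ge0_fin_numE//; apply: le_lt_trans (lebesgue2_tri_bar_le1 R) _; exact: ltry.
Qed.

Lemma kappa_gt0 : 0 < kappa.
Proof.
rewrite -lte_fin -kappaE; apply: (@lt_le_trans _ _ (16^-1)%:E); first by rewrite lte_fin.
apply: (le_trans (lebesgue2_Gamma0_ge R)); apply: le_measure; rewrite ?inE.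
- exact: measurable_Gamma0.
- exact: measurable_tri_bar.
- exact: Gamma0_tri_bar.
Qed.

Lemma mu_Gamma0_gt0 : (0 < mu G0)%E.
Proof.
apply: (@lt_le_trans _ _ (16^-1)%:E); first by rewrite lte_fin.
apply: (le_trans (lebesgue2_Gamma0_ge R)); rewrite -[X in leb2 X](setIidl (@Gamma0_tri_bar R)).
by apply: lebesgue2_le_mu; exact: measurable_Gamma0.
Qed.

Lemma Gamma0_tri (p : plane R) : G0 p -> tri p.
Proof. by move=> [? [? ?]]; split => //; split => //; lra. Qed.

Lemma convergence_point : exists2 p : plane R, tri p &
  ((a n)^-1 * harea n p)%R @[n --> \oo] --> kappa.
Proof.
have [N [mN N0 HN]] := harea_cvg Shat_transfer a_return.
apply: contrapT => h; have := mu_Gamma0_gt0; rewrite lt_neqAle => /andP[/eqP + _]; apply.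
apply/esym/eqP; rewrite -measure_le0 -N0; apply: le_measure; rewrite ?inE//.
  exact: measurable_Gamma0.
by move=> p Gp; apply: HN => /= hp; apply: h; exists p => //; exact: Gamma0_tri.
Qed.

Lemma reference_sequence : exists r : nat -> R, exists rho C : R,
  [/\ 0 < rho, 0 < C, r 0%N = 0 &
    [/\ {homo r : m n / (m <= n)%N >-> m <= n}, forall n, r n.+1 <= r n + C,
     r n / a n @[n --> \oo] --> rho,
     forall n, adiag R n <= r n & forall n, r n <= C * adiag R n]].
Proof.
have [p tp cp] := convergence_point.
have Dp := tri_tri_bar tp; have a0 := area_gt0 tp.
have [p1 [p12 p2]] := tp; have [x0 y0] := tri_bar_ge0 Dp.
exists (fun n => qsum n p), (kappa / area p), ((area p)^-1 + (p.2 ^+ 3)^-1); split.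
- by rewrite divr_gt0// kappa_gt0.
- by rewrite addr_gt0// invr_gt0// exprn_gt0.
- by rewrite qsumE big_ord0.
split.
- by move=> m n mn; exact: gsum_homo.
- move=> n; rewrite qsumS lerD2l ler_wpDr ?invr_ge0 ?exprn_ge0//.
  rewrite areaE//; have := gdens_le_inv n (p2 : 0 < p.2) p12 p1; rewrite mul1r; exact.
- rewrite (_ : (fun _ => _) = (fun n => ((a n)^-1 * harea n p) * (area p)^-1)).
    exact: cvgMr_tmp.
  by apply/funext => n; rewrite /harea; field; rewrite !gt_eqF.
- by move=> n; exact: adiag_le_qsum.
- move=> n; apply: (le_trans (qsum_le_adiag n tp)); apply: ler_wpM2r; first exact: adiag_ge0.
  by rewrite lerDr invr_ge0 ltW.
Qed.

Lemma adiag_bound : exists2 C : R, 0 < C & forall n, adiag R n <= C * a n.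
Proof.
have [r [rho [C [rho0 C0 _ [_ _ cr Ar _]]]]] := reference_sequence.
have [M [_ HM]] := cvg_seq_bounded (cvgP _ cr).
exists (`|M| + 1); first by rewrite ltr_wpDl.
move=> n; apply: (le_trans (Ar n)); rewrite -ler_pdivrMr//.
apply: le_trans (ler_norm _) _; apply: HM => //.
by rewrite (le_lt_trans (ler_norm M))// ltrDl.
Qed.

Lemma harea_Gamma0_bound : exists2 C : R, 0 < C & forall n p, G0 p -> harea n p <= C * a n.
Proof.
have [C C0 HC] := adiag_bound.
have [K K0 KE] : exists2 K : R, 0 < K & forall n (p : plane R), G0 p -> qsum n p <= K * adiag R n / p.2.
  by exists 288; [exact: ltr0n|move=> n p; exact: qsum_le_Gamma0].
exists (K * C); first exact: mulr_gt0.
move=> n p Gp; have [p1 [p12 p2]] := Gp.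
have y0 : 0 < p.2 by lra.
have A0 := adiag_ge0 R n.
rewrite /harea areaE; last exact: Gamma0_tri_bar.
apply: le_trans (_ : p.1 * p.2 * (K * adiag R n / p.2) <= _).
  by apply: ler_wpM2l; [rewrite mulr_ge0//; lra|exact: KE].
rewrite (_ : p.1 * p.2 * _ = p.1 * (K * adiag R n)); last by field; rewrite gt_eqF.
apply: le_trans (_ : 1 * (K * adiag R n) <= _).
  by apply: ler_wpM2r => //; rewrite mulr_ge0// ltW.
by rewrite mul1r -mulrA; apply: ler_wpM2l; [exact: ltW|exact: HC].
Qed.

Lemma a_cvgy : a n @[n --> \oo] --> +oo.
Proof.
have [C C0 HC] := adiag_bound; have [K K0 HK] := adiag_ge_sqrt R.
apply/cvgryPge => A.
set B := (K * C * `|A|) ^+ 2.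
have KC0 : 0 < K * C by rewrite mulr_gt0.
exists (Num.truncn B).+1 => // n /= Bn.
have h : K * C * `|A| <= Num.sqrt n%:R.
  rewrite -[leLHS]ger0_norm; last by rewrite mulr_ge0// ltW.
  rewrite -sqrtr_sqr ler_wsqrtr//; apply: ltW; apply: lt_le_trans (truncnS_gt B) _.
  by rewrite ler_nat.
have := le_trans h (HK n).
have h2 : K * adiag R n <= K * C * a n.
  by rewrite -mulrA; apply: ler_wpM2l => //; exact: ltW.
move=> /le_trans/(_ h2); rewrite ler_pM2l// => /(le_trans (ler_norm A)); exact.
Qed.

Lemma iter_Shat_indic_ge0 (E : set (plane R)) k : measurable E -> (mu E < +oo)%E ->
  {ae mu, forall p, 0 <= iter k Shat (\1_E) p}.
Proof.
move=> mE fE.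
have h0 : (\1_set0 : plane R -> R) \in Lfun mu 1 by apply: indic_Lfun1; rewrite ?measure0 ?ltry.
have hE := indic_Lfun1 mE fE.
apply: filterS (ae_le_of_integrals h0 (iter_Shat_Lfun Shat_transfer k hE) _).
  by move=> p; rewrite indic0.
move=> F mF; rewrite (iter_Shat_dual Shat_transfer)// integral0_eq; last first.
  by move=> p _; rewrite indic0 mul0r.
by apply: integral_ge0 => p _; rewrite lee_fin.
Qed.

Lemma iter_Shat_indic_le (E : set (plane R)) (c : R) k : measurable E -> (mu E < +oo)%E -> 0 <= c ->
  (forall p, \1_E p <= c * area p) ->
  {ae mu, forall p, iter k Shat (\1_E) p <= c * qarea k p}.
Proof.
move=> mE fE c0 Ec; have hE := indic_Lfun1 mE fE.
have hq : (fun p => c * qarea k p) \in Lfun mu 1.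
  rewrite (_ : (fun _ => _) = c \o* qarea k); last by apply/funext => p; rewrite /= mulrC.
  by apply: Lfun_scale => //; exact: qarea_Lfun1.
apply: (ae_le_of_integrals (iter_Shat_Lfun Shat_transfer k hE) hq).
move=> F mF; rewrite (iter_Shat_dual Shat_transfer)//.
have mI : measurable_fun [set: plane R] (fun p => \1_F (iter k S p) : R).
  by apply: (measurableT_comp _ (@measurable_iter_Smap R k)); exact: measurable_indic.
rewrite [X in (_ <= X)%E](eq_integral (fun p => c%:E * (qarea k p * \1_F p)%:E)%E); last first.
  by move=> p _; rewrite -EFinM [in RHS]mulrA.
rewrite ge0_integralZl//; last 2 first.
- by apply/measurable_EFinP; apply: measurable_funM; [exact: measurable_qarea|exact: measurable_indic].
- by move=> p _; rewrite lee_fin mulr_ge0// qarea_ge0.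
rewrite integral_qarea// -ge0_integralZl//; last 2 first.
- by apply/measurable_EFinP; apply: measurable_funM => //; exact: measurable_area.
- by move=> p _; rewrite lee_fin mulr_ge0// area_ge0.
apply: ge0_le_integral => //.
- by apply/measurable_EFinP; apply: measurable_funM => //; exact: measurable_indic.
- apply: emeasurable_funM => //; apply/measurable_EFinP; apply: measurable_funM => //.
  exact: measurable_area.
- by move=> p _; rewrite -EFinM lee_fin mulrA; apply: ler_wpM2r.
Qed.

Definition corr (E : set (plane R)) k : R := fine (mu (E `&` (iter k S @^-1` E))).

Lemma corr_ge0 E k : 0 <= corr E k.
Proof. by rewrite /corr fine_ge0. Qed.

Lemma corrE E k : measurable E -> (mu E < +oo)%E -> 
  (\int[mu]_p (\1_E p * \1_E (iter k S p))%:E = (corr E k)%:E)%E.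
Proof.
move=> mE fE.
have mk : measurable (iter k S @^-1` E).
  by rewrite -[_ @^-1` _]setTI; exact: (@measurable_iter_Smap R k).
rewrite /corr fineK; last first.
  rewrite ge0_fin_numE//; apply: le_lt_trans fE; apply: le_measure; rewrite ?inE//.
  exact: measurableI.
transitivity (\int[mu]_p (\1_(E `&` (iter k S @^-1` E)) p)%:E)%E.
  by apply: eq_integral => p _; rewrite indicI.
by rewrite integral_indic ?setIT//; exact: measurableI.
Qed.

Lemma corr_sum_cvg (E : set (plane R)) (d : R) : measurable E -> E `<=` G0 -> 0 < d ->
  (forall p, E p -> d <= p.2) ->
  (\sum_(k < n) corr E k) / a n @[n --> \oo] --> fine (mu E) ^+ 2.
Proof.
move=> mE EG d0 Ed.
have fE : (mu E < +oo)%E.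
  by apply: le_lt_trans (mu_Gamma0_lty R); apply: le_measure; rewrite ?inE//; exact: measurable_Gamma0.
have hE := indic_Lfun1 mE fE.
have c0 : 0 <= 2 / d by rewrite divr_ge0// ltW.
have Ec p : \1_E p <= 2 / d * area p.
  rewrite indicE; have [|_] := boolP (p \in E); last by rewrite mulr_ge0// area_ge0.
  rewrite inE => Ep; have Gp := EG _ Ep; have [p1 [p12 p2]] := Gp; have dp := Ed _ Ep.
  rewrite areaE; last exact: Gamma0_tri_bar.
  rewrite mulrAC ler_pdivlMr// mul1r mulrA -[leLHS]mul1r; apply: ler_pM => //; first exact: ltW.
  lra.
have [C C0 HC] := harea_Gamma0_bound.
pose f n p : \bar R := (((a n)^-1 * \sum_(0 <= k < n) iter k Shat (\1_E) p) * \1_E p)%:E.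
pose g p : \bar R := ((2 / d * C) * \1_E p)%:E.
have mit k : measurable_fun [set: plane R] (iter k Shat (\1_E)).
  have /Lfun1_integrable/measurable_int := iter_Shat_Lfun Shat_transfer k hE.
  by move/measurable_EFinP.
have mI : measurable_fun [set: plane R] (\1_E : plane R -> R) by exact: measurable_indic.
have mf n : measurable_fun setT (f n).
  apply/measurable_EFinP; apply: measurable_funM => //; apply: measurable_funM => //.
  exact: measurable_sum.
have intE n : (\int[mu]_p f n p = ((\sum_(k < n) corr E k) / a n)%:E)%E.
  rewrite (eq_integral (fun p => ((a n)^-1)%:E * \sum_(k < n) (iter k Shat \1_E p * \1_E p)%:E)%E); last first.
    by move=> p _; rewrite sumEFin -EFinM /f -mulrA mulr_suml big_mkord.
  have ik (k : 'I_n) : mu.-integrable setT (fun p => (iter k Shat \1_E p * \1_E p)%:E).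
    have /Lfun1_integrable hi := iter_Shat_Lfun Shat_transfer k hE.
    apply: (le_integrable measurableT _ _ hi).
      by apply/measurable_EFinP; exact: measurable_funM.
    by move=> p _ /=; rewrite lee_fin normrM [(`|\1_E p|)%R]ger0_norm// ler_piMr.
  rewrite integralZl//; last exact: integrable_sum.
  rewrite integral_sum//.
  rewrite (eq_bigr (fun k : 'I_n => (corr E k)%:E)); last first.
    by move=> k _; rewrite (iter_Shat_dual Shat_transfer)// corrE.
  by rewrite sumEFin -EFinM mulrC.
have ig : mu.-integrable setT g.
  rewrite (_ : g = fun p => ((2 / d * C)%:E * (\1_E p)%:E)%E); last by apply/funext => p; rewrite /g EFinM.
  by apply: integrableZl => //; apply/Lfun1_integrable.
have [] := @dominated_convergence _ _ _ mu setT measurableT f (fun p => (fine (mu E) * \1_E p)%:E) g mf _ _ ig _.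
- by apply/measurable_EFinP; exact: measurable_funM.
- have [_ /(_ _ hE)] := a_return; rewrite Rintegral_indic_mu// => H.
  apply: filterS H => p cp _; apply: cvg_EFin; first by apply: nearW.
  exact: cvgMr_tmp.
- have A1 : {ae mu, forall p, forall k, 0 <= iter k Shat \1_E p}.
    by apply/ae_foralln => k; exact: iter_Shat_indic_ge0.
  have A2 : {ae mu, forall p, forall k, iter k Shat \1_E p <= 2 / d * qarea k p}.
    by apply/ae_foralln => k; exact: iter_Shat_indic_le.
  apply: filterS2 A1 A2 => p h1 h2 n _.
  rewrite /f /g gee0_abs lee_fin; last by rewrite mulr_ge0// mulr_ge0 ?invr_ge0 ?(ltW (a_gt0 n))// sumr_ge0.
  rewrite indicE; have [|_] := boolP (p \in E); last by rewrite !mulr0.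
  rewrite inE => /EG Gp; rewrite !mulr1 ler_pdivrMl//.
  apply: le_trans (_ : 2 / d * harea n p <= _).
    rewrite hareaE mulr_sumr big_mkord; apply: ler_sum => k _; exact: h2.
  rewrite [leRHS]mulrC -[leRHS]mulrA; apply: ler_wpM2l => //; exact: HC.
move=> _ _; rewrite (_ : \int[mu]_p _ = (fine (mu E) ^+ 2)%:E)%E; last first.
  rewrite (eq_integral (fun p => (fine (mu E))%:E * (\1_E p)%:E)%E); last by move=> p _; rewrite EFinM.
  rewrite ge0_integralZl//; last 2 first.
  - by apply/measurable_EFinP.
  - by rewrite lee_fin fine_ge0.
  have fEn : mu E \is a fin_num by rewrite ge0_fin_numE.
  by rewrite integral_indic// setIT expr2 EFinM fineK.
move=> /fine_cvg; apply: cvg_trans; apply: near_eq_cvg; apply: nearW => n /=.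
by rewrite intE.
Qed.

Lemma egorov_set (e : R) : 0 < e -> exists E : set (plane R), exists d : R,
  [/\ measurable E, E `<=` G0, 0 < d /\ (forall p, E p -> d <= p.2), (mu (G0 `\` E) < e%:E)%E &
   forall eps, 0 < eps -> exists K, forall n p, (K <= n)%N -> E p -> `|(a n)^-1 * harea n p - kappa| < eps].
Proof.
move=> e0; have e2 : 0 < e / 2 by rewrite divr_gt0.
have mG := @measurable_Gamma0 R.
have [B [mB Be unif]] : exists B, [/\ measurable B, (mu B < (e / 2)%:E)%E &
    {uniform G0 `\` B, (fun n p => (a n)^-1 * harea n p) @ \oo --> (fun=> kappa)}].
  apply: ae_pointwise_almost_uniform => //.
  - move=> n; apply: measurable_funTS; apply: measurable_funM => //.
    exact: measurable_harea.
  - exact: mu_Gamma0_lty.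
  - by apply: filterS (harea_cvg Shat_transfer a_return) => p + _; apply.
pose F (n : nat) := G0 `&` [set p : plane R | p.2 < (fun=> n.+1%:R^-1) p].
have mF n : measurable (F n).
  by apply: measurableI => //; exact: measurable_set_ltr.
have F0 : \bigcap_n F n = set0.
  rewrite -subset0 => p Fp; have [[p1 [p12 p2]] _] := Fp 0%N I.
  have y0 : 0 < p.2 by lra.
  have [_ /=] := Fp (Num.truncn p.2^-1) I.
  rewrite ltNge => /negP; apply.
  by rewrite -[leRHS]invrK lef_pV2 ?posrE ?invr_gt0 ?ltr0n// ltW// truncnS_gt.
have cF : mu (F n) @[n --> \oo] --> 0%E.
  have := @nonincreasing_cvg_mu _ _ _ mu F; rewrite F0 measure0; apply => //.
  - apply: le_lt_trans (mu_Gamma0_lty R); apply: le_measure; rewrite ?inE//; exact: subIsetl.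
  - move=> m n mn; apply/subsetPset => p [Gp /= h]; split => //=; apply: (lt_le_trans h).
    by rewrite lef_pV2 ?posrE ?ltr0n// ler_nat.
have [n Fn] : exists n, (mu (F n) < (e / 2)%:E)%E.
  have /fine_cvgP[_ /cvgr0Pnorm_lt /(_ _ e2) [N _ HN]] := cF.
  exists N; have := HN N (leqnn N); rewrite /= ger0_norm ?fine_ge0// -lte_fin fineK//.
  rewrite ge0_fin_numE//; apply: le_lt_trans (mu_Gamma0_lty R); apply: le_measure; rewrite ?inE//; exact: subIsetl.
exists ((G0 `\` B) `\` F n), (n.+1%:R^-1); split.
- by apply: measurableD => //; exact: measurableD.
- by move=> p [[]].
- split; first by rewrite invr_gt0 ltr0n.
  by move=> p [[Gp _] nF]; rewrite leNgt; apply/negP => h; apply: nF; split.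
- apply: (@le_lt_trans _ _ (mu (B `|` F n))).
    apply: le_measure; rewrite ?inE.
    + by apply: measurableD => //; apply: measurableD => //; exact: measurableD.
    + exact: measurableU.
    + move=> p [Gp h]; have [?|nB] := pselect (B p); first by left.
      by right; apply: contrapT => nF; apply: h; split.
  apply: le_lt_trans (measureU2 _ _ _) _ => //.
  by rewrite [e]splitr EFinD lteD.
- move=> eps eps0.
  have U : nbhs ((fun=> kappa) : {uniform` G0 `\` B -> R^o})
      [set h : plane R -> R | forall y, (G0 `\` B) y -> ball kappa eps (h y)].
    apply/uniform_nbhs; exists [set xy : R^o * R^o | ball xy.1 eps xy.2]; split => //.
    exact: (entourage_ball R^o (PosNum eps0)).
  have [K _ HK] := unif _ U.
  exists K => m p Km [Ep _]; rewrite distrC; exact: (HK m Km p Ep).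
Qed.

End dual_ergodic.

Section blocks.
Context (R : realType).

Lemma sqr_sum_le (n : nat) (b : nat -> R) : (forall i, 0 <= b i) ->
  (\sum_(j < n) b j) ^+ 2 <= 2 * \sum_(m < n) \sum_(k < m.+1) b k * b m.
Proof.
move=> b0; elim: n => [|n IH]; first by rewrite !big_ord0 expr0n mulr0.
rewrite big_ord_recr [X in _ <= 2 * X]big_ord_recr/= sqrrD mulrDr -addrA; apply: lerD => //.
rewrite big_ord_recr/= -mulr_suml.
set s := \sum_(j < n) b j; set c := b n.
have : 0 <= c ^+ 2 by rewrite sqr_ge0.
rewrite -mulr_natr expr2; lra.
Qed.

Lemma sum_triangle_sym N (c q : nat -> R) :
  \sum_(n < N) \sum_(k < n.+1) c (n - k)%N * q k =
  \sum_(i < N) c i * \sum_(k < N - i) q k.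
Proof.
under [RHS]eq_bigr do rewrite mulrC.
rewrite -sum_triangle; apply: eq_bigr => n _.
rewrite (reindex_inj rev_ord_inj)/=; apply: eq_bigr => k _.
by rewrite subSS mulrC; congr (_ * c _); rewrite subKn// -ltnS.
Qed.

Lemma cvg_block (k L : nat) : (0 < k)%N -> (0 < L)%N ->
  (fun n => (k * n) %/ L)%N @ \oo --> \oo.
Proof.
move=> k0 L0 P [N _ NP]; exists (N * L)%N => // n /= Nn; apply: NP => /=.
by rewrite leq_divRL// (leq_trans Nn)// leq_pmull.
Qed.

Lemma block_ratio (a : nat -> R) (k L : nat) : (0 < k)%N -> (0 < L)%N ->
  regularly_varying 1 a ->
  a ((k * n) %/ L)%N / a n @[n --> \oo] --> (k%:R / L%:R : R).
Proof.
move=> k0 L0 rv.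
have c0 : 0 < k%:R / L%:R :> R by rewrite divr_gt0 ?ltr0n.
have := rv _ c0; rewrite powRr1; last exact: ltW.
apply: cvg_trans; apply: near_eq_cvg; apply: nearW => n.
congr (a _ / _); apply: truncn_def.
have L0' : 0 < L%:R :> R by rewrite ltr0n.
rewrite mulrAC ler_pdivlMr// ltr_pdivrMr// -!natrM ler_nat ltr_nat.
by rewrite leq_divM/= ltn_ceil.
Qed.

Lemma block_seq (a s : nat -> R) (sigma : R) (k L : nat) : (0 < k)%N -> (0 < L)%N ->
  (forall n, 0 < a n) -> regularly_varying 1 a -> s n / a n @[n --> \oo] --> sigma ->
  s ((k * n) %/ L)%N / a n @[n --> \oo] --> (sigma * (k%:R / L%:R) : R).
Proof.
move=> k0 L0 a0 rv cs.
rewrite (_ : (fun n => _) = (fun n => (s ((k * n) %/ L)%N / a ((k * n) %/ L)%N) *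
   (a ((k * n) %/ L)%N / a n))); last first.
  by apply/funext => n; rewrite mulrA divfK// gt_eqF.
apply: cvgM; last exact: block_ratio.
exact: (cvg_comp _ (fun m => s m / a m) (cvg_block k0 L0) cs).
Qed.

Lemma sum_block_le (r f : nat -> R) (n L : nat) : (0 < L)%N -> (L <= n)%N ->
  (forall i, 0 <= f i) -> {homo r : m n / (m <= n)%N >-> m <= n} ->
  \sum_(i < n) r (n - i)%N * f i <= \sum_(l < L) r (((L - l).+1 * n) %/ L)%N *
    (\sum_(i < (l.+1 * n) %/ L) f i - \sum_(i < (l * n) %/ L) f i).
Proof.
move=> L0 Ln f0 rh.
suff H l : (l <= L)%N -> \sum_(i < (l * n) %/ L) r (n - i)%N * f i <=
    \sum_(l < l) r (((L - l).+1 * n) %/ L)%N *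
    (\sum_(i < (l.+1 * n) %/ L) f i - \sum_(i < (l * n) %/ L) f i).
  by have := H L (leqnn L); rewrite mulKn.
elim: l => [|l IH] lL; first by rewrite mul0n div0n !big_ord0.
rewrite big_ord_recr/=; apply: le_trans (lerD (IH (ltnW lL)) (lexx _)).
have le1 : ((l * n) %/ L <= (l.+1 * n) %/ L)%N by rewrite leq_div2r// leq_mul2r leqnSn orbT.
rewrite -(big_mkord xpredT f) -(big_mkord xpredT f).
rewrite -(big_mkord xpredT (fun i => r (n - i)%N * f i)) -(big_mkord xpredT (fun i => r (n - i)%N * f i)).
rewrite (@big_cat_nat _ _ _ ((l * n) %/ L)%N)//= lerD2l.
rewrite [X in _ <= _ * (X - _)](@big_cat_nat _ _ _ ((l * n) %/ L)%N)//= addrAC subrr add0r mulr_sumr.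
apply: ler_sum_nat => i /andP[h1 h2]; apply: ler_wpM2r => //; apply: rh.
apply: (@leq_trans (n - (l * n) %/ L)); first by rewrite leq_sub2l.
rewrite leq_divRL// mulnBl.
have e := divn_eq (l * n) L; have m := ltn_pmod (l * n) L0.
have h3 : ((L - l) * n = L * n - l * n)%N by rewrite mulnBl.
have h4 : (l * n <= L * n)%N by rewrite leq_mul2r (ltnW lL) orbT.
rewrite mulSn h3 [(n * L)%N]mulnC.
clear -e m h4 Ln; lia.
Qed.

Lemma sum_block_weights (L : nat) : (0 < L)%N ->
  \sum_(l < L) ((L - l).+1%:R / L%:R) * (l.+1%:R / L%:R - l%:R / L%:R) = 2^-1 + 3 / (2 * L%:R) :> R.
Proof.
move=> L0; have L0' : L%:R != 0 :> R by rewrite pnatr_eq0 -lt0n.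
have H : \sum_(l < L) ((L - l).+1%:R : R) = L%:R * (L%:R + 3) / 2.
  rewrite (reindex_inj rev_ord_inj)/=.
  rewrite (eq_bigr (fun l : 'I_L => (l.+2)%:R)); last first.
    by move=> l _; rewrite subKn.
  clear; elim: L => [|L IH]; first by rewrite big_ord0 mul0r mul0r.
  by rewrite big_ord_recr/= IH -!natr1; field.
rewrite (eq_bigr (fun l : 'I_L => (L - l).+1%:R * (L%:R ^+ 2)^-1)).
  by rewrite -mulr_suml H; field.
by move=> l _; rewrite -[l.+1%:R]natr1; field.
Qed.

(* Regular variation of index 1 makes [r] and the partial sums of [f] linear at
   scale [n], so the convolution is a Riemann sum of [rho beta (1 - t)]. *)
Lemma block_bound (a r f : nat -> R) (rho beta e : R) :
  (forall n, 0 < a n) -> regularly_varying 1 a ->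
  (forall i, 0 <= f i) -> {homo r : m n / (m <= n)%N >-> m <= n} ->
  r n / a n @[n --> \oo] --> rho -> (\sum_(i < n) f i) / a n @[n --> \oo] --> beta ->
  0 < e -> \forall n \near \oo, \sum_(i < n) r (n - i)%N * f i <= (rho * beta / 2 + e) * a n ^+ 2.
Proof.
move=> a0 rv f0 rh cr ce e0.
set L := (Num.truncn (3 * `|rho * beta| / e)).+1.
have L0 : (0 < L)%N by [].
have L0' : 0 < L%:R :> R by rewrite ltr0n.
have HL : rho * beta * (2^-1 + 3 / (2 * L%:R)) <= rho * beta / 2 + e / 2.
  rewrite mulrDr lerD2l.
  have : 3 * `|rho * beta| / e < L%:R by exact: truncnS_gt.
  rewrite ltr_pdivrMr// => h.
  have x1 := ler_norm (rho * beta).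
  rewrite (_ : _ * _ = 3 * (rho * beta) / L%:R / 2); last by field; rewrite gt_eqF.
  rewrite ler_pM2r// ler_pdivrMr// [e * _]mulrC; apply: le_trans (ltW h).
  by apply: ler_wpM2l.
have cb (l : nat) : (\sum_(i < (l * n) %/ L) f i) / a n @[n --> \oo] --> beta * (l%:R / L%:R).
  case: l => [|l]; last exact: (@block_seq a (fun n => \sum_(i < n) f i)).
  rewrite mul0r mulr0; apply: cvg_near_cst; apply: nearW => n.
  by rewrite mul0n div0n big_ord0 mul0r.
have cS : \sum_(l < L) (r (((L - l).+1 * n) %/ L)%N / a n) *
    ((\sum_(i < (l.+1 * n) %/ L) f i) / a n - (\sum_(i < (l * n) %/ L) f i) / a n) @[n --> \oo] -->
    \sum_(l < L) (rho * ((L - l).+1%:R / L%:R)) * (beta * (l.+1%:R / L%:R) - beta * (l%:R / L%:R)).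
  apply: cvg_big => [|l _]; first exact: add_continuous.
  by apply: cvgM; [exact: block_seq|apply: cvgB; exact: cb].
rewrite (_ : \sum_(l < L) _ = rho * beta * (2^-1 + 3 / (2 * L%:R))) in cS; last first.
  rewrite -sum_block_weights// mulr_sumr; apply: eq_bigr => l _; ring.
near=> n.
apply: le_trans (sum_block_le L0 _ f0 rh) _; first by near: n; exists L.
rewrite -ler_pdivrMr ?exprn_gt0//.
rewrite (_ : _ / _ = \sum_(l < L) (r (((L - l).+1 * n) %/ L)%N / a n) *
    ((\sum_(i < (l.+1 * n) %/ L) f i) / a n - (\sum_(i < (l * n) %/ L) f i) / a n)); last first.
  by rewrite mulr_suml; apply: eq_bigr => l _; field; rewrite gt_eqF.
apply: ltW; near: n.
have : rho * beta * (2^-1 + 3 / (2 * L%:R)) < rho * beta / 2 + e.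
  by apply: (le_lt_trans HL); rewrite ltrD2l ltr_pdivrMr// ltr_pMr// ltr1n.
by move=> /(cvgr_lt _ cS).
Unshelve. all: by end_near. Qed.

End blocks.

Section occupation.
Context (R : realType).
Local Notation leb2 := (lebesgue2 R).
Local Notation mu := (@mu R).
Local Notation D := (@tri_bar R).
Local Notation G0 := (@Gamma0 R).
Local Notation S := (@Smap R).
Local Open Scope ereal_scope.

Lemma integral_iter_Smap_mu k (g : plane R -> R) : measurable_fun setT g ->
  (forall p, (0 <= g p)%R) ->
  \int[leb2]_(p in D) (g (iter k S p))%:E = \int[mu]_p (g p * qarea k p)%:E.
Proof.
move=> mg g0.
rewrite (@integral_iter_Smap R k (fun p => (g p)%:E)); last 2 first.
- exact/measurable_EFinP.
- by move=> p _; rewrite lee_fin.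
rewrite -integral_mu_area; last 2 first.
- apply: emeasurable_funM; apply/measurable_EFinP => //; exact: measurable_qdens.
- by move=> p Dp; rewrite mule_ge0// lee_fin// qdens_ge0.
by apply: eq_integral => p _; rewrite -!EFinM; congr (_%:E); rewrite /qarea mulrCA.
Qed.

Definition hits (E : set (plane R)) n (p : plane R) : R := (\sum_(j < n) \1_E (iter j S p))%R.

Lemma hits_ge0 E n p : (0 <= hits E n p)%R.
Proof. by apply: sumr_ge0 => j _; rewrite indicE. Qed.

Lemma measurable_indic_iter E k : measurable E ->
  measurable_fun [set: plane R] (fun p => \1_E (iter k S p) : R).
Proof.
move=> mE; apply: (measurableT_comp _ (@measurable_iter_Smap R k)); exact: measurable_indic.
Qed.

Lemma measurable_hits E n : measurable E -> measurable_fun [set: plane R] (hits E n).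
Proof. by move=> mE; apply: measurable_sum => j; exact: measurable_indic_iter. Qed.

Lemma hits_visits n p : hits G0 n p = (visits n p)%:R%R.
Proof. by rewrite /hits /visits natr_sum; apply: eq_bigr => j _; rewrite indicE. Qed.

Lemma hitsD (A B : set (plane R)) n p : [disjoint A & B] -> hits (A `|` B) n p = (hits A n p + hits B n p)%R.
Proof.
move=> AB; rewrite /hits -big_split/=; apply: eq_bigr => j _.
rewrite !indicE in_setU; have [|_] := boolP (_ \in A); last by rewrite add0r.
rewrite inE => Ap; have [|_] := boolP (_ \in B); last by rewrite addr0.
by rewrite inE => Bp; move/disj_set2P : AB => /seteqP[/(_ _ (conj Ap Bp))].
Qed.

Lemma integral_hits E n : measurable E ->
  \int[leb2]_(p in D) (hits E n p)%:E = \int[mu]_p (\1_E p * harea n p)%:E.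
Proof.
move=> mE.
rewrite (eq_integral (fun p => \sum_(j < n) (\1_E (iter j S p))%:E)); last first.
  by move=> p _; rewrite sumEFin.
rewrite ge0_integral_sum//=; last 2 first.
- exact: measurable_tri_bar.
- by move=> j; apply/measurable_EFinP/measurable_funTS; exact: measurable_indic_iter.
rewrite (eq_bigr (fun j : 'I_n => \int[mu]_p (\1_E p * qarea j p)%:E)); last first.
  by move=> j _; rewrite integral_iter_Smap_mu//; exact: measurable_indic.
rewrite -ge0_integral_sum//=; last 2 first.
- by move=> j; apply/measurable_EFinP; apply: measurable_funM; [exact: measurable_indic|exact: measurable_qarea].
- by move=> j p _; rewrite lee_fin mulr_ge0// qarea_ge0.
by apply: eq_integral => p _; rewrite sumEFin -mulr_sumr hareaE.
Qed.

Lemma integral_hits_sqr E n : measurable E ->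
  \int[leb2]_(p in D) (hits E n p ^+ 2)%:E <=
  2%:E * \sum_(i < n) \int[mu]_p (\1_E p * \1_E (iter i S p) * harea (n - i) p)%:E.
Proof.
move=> mE.
pose g i (p : plane R) : R := (\1_E p * \1_E (iter i S p))%R.
have mg i : measurable_fun setT (g i).
  by apply: measurable_funM; [exact: measurable_indic|exact: measurable_indic_iter].
have g0 i p : (0 <= g i p)%R by rewrite mulr_ge0.
have mgi i k : measurable_fun [set: plane R] (fun p => g i (iter k S p)).
  exact: (measurableT_comp (mg i) (@measurable_iter_Smap R k)).
have mD := @measurable_tri_bar R.
apply: (@le_trans _ _ (\int[leb2]_(p in D) (2%:E * \sum_(m < n) \sum_(k < m.+1) (g (m - k)%N (iter k S p))%:E))).
  apply: ge0_le_integral => //.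
  - by move=> p _; rewrite lee_fin sqr_ge0.
  - by apply/measurable_EFinP/measurable_funTS/measurable_funX; exact: measurable_hits.
  - apply: emeasurable_funM => //; apply: emeasurable_sum => m; apply: emeasurable_sum => k.
    exact/measurable_EFinP/measurable_funTS.
  - move=> p _; rewrite (eq_bigr (fun m : 'I_n => (\sum_(k < m.+1) g (m - k)%N (iter k S p))%:E)); last first.
      by move=> m _; rewrite sumEFin.
    rewrite sumEFin -EFinM lee_fin; apply: le_trans (sqr_sum_le n (b := fun j => \1_E (iter j S p)) _) _.
      by move=> j; rewrite indicE.
    rewrite ler_wpM2l//; apply: ler_sum => m _; apply: ler_sum => k _.
    by rewrite /g -iterD subnK// -ltnS.
rewrite ge0_integralZl//; last 2 first.
- apply: emeasurable_sum => m; apply: emeasurable_sum => k.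
  exact/measurable_EFinP/measurable_funTS.
- by move=> p _; apply: sume_ge0 => m _; apply: sume_ge0 => k _; rewrite lee_fin.
rewrite lee_pmul2l//.
rewrite ge0_integral_sum//; last 2 first.
- move=> m; apply: emeasurable_sum => k; exact/measurable_EFinP/measurable_funTS.
- by move=> m p _; apply: sume_ge0 => k _; rewrite lee_fin.
rewrite (eq_bigr (fun m : 'I_n => \int[mu]_p (\sum_(k < m.+1) g (m - k)%N p * qarea k p)%:E)); last first.
  move=> m _; rewrite ge0_integral_sum//; last 2 first.
  - by move=> k; exact/measurable_EFinP/measurable_funTS.
  - by move=> k p _; rewrite lee_fin.
  under eq_bigr do rewrite integral_iter_Smap_mu//.
  rewrite -ge0_integral_sum//; last 2 first.
  - by move=> k; apply/measurable_EFinP; apply: measurable_funM => //; exact: measurable_qarea.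
  - by move=> k p _; rewrite lee_fin mulr_ge0// qarea_ge0.
  by apply: eq_integral => p _; rewrite sumEFin.
rewrite -!ge0_integral_sum//; last 4 first.
- move=> i; apply/measurable_EFinP; apply: measurable_funM; first exact: (mg i).
  exact: measurable_harea.
- by move=> i p _; rewrite lee_fin; apply: mulr_ge0; [exact: (g0 i)|exact: harea_ge0].
- move=> m; apply/measurable_EFinP; apply: measurable_sum => k.
  by apply: measurable_funM => //; exact: measurable_qarea.
- by move=> m p _; rewrite lee_fin sumr_ge0// => k _; rewrite mulr_ge0// qarea_ge0.
rewrite le_eqVlt; apply/orP; left; apply/eqP; apply: eq_integral => p _.
rewrite !sumEFin; congr (_%:E); rewrite (sum_triangle_sym n (fun i => g i p) (fun k => qarea k p)).
by apply: eq_bigr => i _; rewrite hareaE.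
Qed.

Lemma markov_tri_bar (f : plane R -> R) (t : R) : measurable_fun setT f -> (forall p, (0 <= f p)%R) ->
  (0 < t)%R -> leb2 (D `&` [set p | (t <= f p)%R]) <= (t^-1)%:E * \int[leb2]_(p in D) (f p)%:E.
Proof.
move=> mf f0 t0; have mD := @measurable_tri_bar R.
have mA : measurable [set p | (t <= f p)%R].
  by have := measurable_set_ler (measurable_cst t) mf.
rewrite -lee_pdivrMl ?invr_gt0// invrK -[D `&` _]setIC -integral_indic// -ge0_integralZl//; last 2 first.
- by apply/measurable_EFinP/measurable_funTS; exact: measurable_indic.
- by rewrite lee_fin ltW.
apply: ge0_le_integral => //.
- by move=> p _; rewrite mule_ge0// lee_fin// ltW.
- apply: emeasurable_funM => //; apply/measurable_EFinP/measurable_funTS; exact: measurable_indic.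
- exact/measurable_EFinP/measurable_funTS.
- move=> p _; rewrite -EFinM lee_fin indicE; have [|_] := boolP (_ \in _); last by rewrite mulr0.
  by rewrite inE/= mulr1.
Qed.

End occupation.

Section weak_law.
Context (R : realType).
Local Notation leb2 := (lebesgue2 R).
Local Notation mu := (@mu R).
Local Notation D := (@tri_bar R).
Local Notation G0 := (@Gamma0 R).
Local Notation S := (@Smap R).
Local Notation kappa := (kappa R).

Context (Shat : (plane R -> R) -> plane R -> R).
Context (Shat_transfer : transfer_operator mu S Shat).
Context (a : nat -> R).
Context (a_return : return_sequence mu Shat a).
Context (a_rv : regularly_varying 1 a).

Let a_gt0 n : 0 < a n. Proof. by case: a_return. Qed.

Definition uniform_on (E : set (plane R)) := forall eps, 0 < eps ->
  exists K, forall n p, (K <= n)%N -> E p -> `|(a n)^-1 * harea n p - kappa| < eps.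

Lemma invr_a_cvg0 : (a n)^-1 @[n --> \oo] --> (0 : R).
Proof.
apply/gtr0_cvgV0; first by apply: nearW => n; exact: a_gt0.
exact: (a_cvgy Shat_transfer a_return).
Qed.

Lemma harea_majorant (E : set (plane R)) (e : R) : E `<=` G0 -> uniform_on E -> 0 < e ->
  exists r : nat -> R, [/\ {homo r : m n / (m <= n)%N >-> m <= n},
    r n / a n @[n --> \oo] --> kappa + e, forall n, 0 <= r n &
    forall n p, E p -> harea n p <= r n].
Proof.
move=> EG Eu e0; have k0 := kappa_gt0 R.
have [r [rho [_ [rho0 _ _ [rh _ cr Ar _]]]]] := reference_sequence Shat_transfer a_return.
have [C C0 HC] := harea_Gamma0_bound Shat_transfer a_return.
have e2 : 0 < e / 2 by rewrite divr_gt0.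
have [K1 HK1] := Eu _ e2.
have ke : 0 < kappa + e by rewrite addr_gt0.
have r0 n : 0 <= r n by exact: le_trans (adiag_ge0 R n) (Ar n).
have [K2 _ HK2] : \forall n \near \oo, rho * (kappa + e / 2) / (kappa + e) < r n / a n.
  have h : rho * (kappa + e / 2) / (kappa + e) < rho.
    by rewrite ltr_pdivrMr// ltr_pM2l// ltrD2l ltr_pdivrMr// ltr_pMr// ltr1n.
  exact: (cvgr_gt _ cr).
set K := maxn K1 K2.
exists (fun n => (kappa + e) / rho * r n + C * a K); split.
- by move=> m n mn; rewrite lerD2r; apply: ler_wpM2l; [rewrite divr_ge0// ltW|exact: rh].
- rewrite (_ : (fun _ => _) = (fun n => (kappa + e) / rho * (r n / a n) + C * a K * (a n)^-1)); last first.
    by apply/funext => n; rewrite mulrDl mulrA.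
  rewrite [X in _ --> X](_ : _ = (kappa + e) / rho * rho + C * a K * 0); last first.
    by rewrite mulr0 addr0 divfK// gt_eqF.
  apply: cvgD; first exact: cvgMl_tmp.
  apply: cvgMl_tmp; exact: invr_a_cvg0.
- by move=> n; rewrite addr_ge0// mulr_ge0// ?divr_ge0// ltW.
- move=> n p Ep; have Gp := EG _ Ep; have Dp := Gamma0_tri_bar Gp.
  have [nK|Kn] := ltnP n K.
    apply: ler_wpDl.
      by rewrite mulr_ge0// ?divr_ge0// ltW.
    apply: le_trans (HC K p Gp); rewrite /harea; apply: ler_wpM2l; first exact: area_ge0.
    have [x0 y0] := tri_bar_ge0 Dp; apply: gsum_homo => //; exact: ltnW.
  apply: ler_wpDr; first by rewrite mulr_ge0// ltW.
  apply: le_trans (_ : (kappa + e / 2) * a n <= _).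
    have := HK1 n p (leq_trans (leq_maxl _ _) Kn) Ep.
    rewrite ltr_distl => /andP[_ h].
    by rewrite -ler_pdivrMr// mulrC ltW.
  have := HK2 n (leq_trans (leq_maxr _ _) Kn) => /=.
  rewrite ltr_pdivlMr// mulrAC ltr_pdivrMr// => h.
  rewrite mulrAC ler_pdivlMr//; apply: ltW.
  by rewrite mulrC [ltRHS]mulrC mulrA.
Qed.

Section egorov.
Context (E : set (plane R)) (d : R).
Context (mE : measurable E) (EG : E `<=` G0) (d0 : 0 < d) (Ed : forall p, E p -> d <= p.2).
Context (Eu : uniform_on E).

Let muE_lty : (mu E < +oo)%E.
Proof.
by apply: le_lt_trans (mu_Gamma0_lty R); apply: le_measure; rewrite ?inE//; exact: measurable_Gamma0.
Qed.

Lemma hits_second_moment (e : R) : 0 < e -> \forall n \near \oo,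
  (\int[leb2]_(p in D) (hits E n p ^+ 2)%:E <=
    ((kappa * fine (mu E) ^+ 2 + e) * a n ^+ 2)%:E)%E.
Proof.
move=> e0; set b := fine (mu E) ^+ 2.
have b0 : 0 <= b by rewrite sqr_ge0.
set e1 := e / (2 * (b + 1)).
have b1 : 0 < b + 1 by rewrite ltr_wpDl.
have e10 : 0 < e1 by rewrite divr_gt0// mulr_gt0.
have [r [rh cr r0 Hr]] := harea_majorant EG Eu e10.
have e4 : 0 < e / 4 by rewrite divr_gt0.
have := block_bound a_gt0 a_rv (corr_ge0 E) rh cr (corr_sum_cvg Shat_transfer a_return mE EG d0 Ed) e4.
rewrite -/b; apply: filterS => n Hn.
apply: le_trans (integral_hits_sqr n mE) _.
apply: (@le_trans _ _ (2%:E * \sum_(i < n) (r (n - i)%N * corr E i)%:E)%E).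
  rewrite lee_pmul2l//; apply: lee_sum => i _.
  have mg : measurable_fun [set: plane R] (fun p => (\1_E p * \1_E (iter i S p))%:E : \bar R).
    apply/measurable_EFinP; apply: measurable_funM; first exact: measurable_indic.
    exact: measurable_indic_iter.
  rewrite EFinM -corrE// -ge0_integralZl//; last by rewrite lee_fin.
  apply: ge0_le_integral => //.
  - by move=> p _; rewrite lee_fin; apply: mulr_ge0; [exact: mulr_ge0|exact: harea_ge0].
  - apply/measurable_EFinP; apply: measurable_funM; last exact: measurable_harea.
    by move/measurable_EFinP : mg.
  - exact: emeasurable_funM.
  - move=> p _; rewrite -EFinM lee_fin !indicE.
    have [|_] := boolP (p \in E); last by rewrite !mul0r mulr0.
    by rewrite inE mul1r mulrC => Ep; apply: ler_wpM2r => //; exact: Hr.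
rewrite sumEFin -EFinM lee_fin.
apply: le_trans (_ : 2 * (((kappa + e1) * b / 2 + e / 4) * a n ^+ 2) <= _).
  by apply: ler_wpM2l.
rewrite mulrA; apply: ler_wpM2r; first by rewrite sqr_ge0.
have : e1 * (2 * (b + 1)) = e by rewrite /e1 divfK// gt_eqF// mulr_gt0.
nra.
Qed.

Lemma hits_first_moment (e : R) : 0 < e -> \forall n \near \oo,
  (((kappa - e) * fine (mu E) * a n)%:E <= \int[leb2]_(p in D) (hits E n p)%:E)%E.
Proof.
move=> e0; have [K HK] := Eu e0; exists K => // n /= Kn.
rewrite integral_hits//.
have fE : mu E \is a fin_num by rewrite ge0_fin_numE.
rewrite mulrAC EFinM fineK//.
have <- : (\int[mu]_p (\1_E p)%:E = mu E)%E by rewrite integral_indic// setIT.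
have mI : measurable_fun [set: plane R] (fun p => (\1_E p)%:E : \bar R).
  by apply/measurable_EFinP; exact: measurable_indic.
have mh : measurable_fun [set: plane R] (fun p => (\1_E p * harea n p)%:E : \bar R).
  apply/measurable_EFinP; apply: measurable_funM; [exact: measurable_indic|exact: measurable_harea].
have h0 p : (0 <= (\1_E p * harea n p)%:E :> \bar R)%E by rewrite lee_fin mulr_ge0// harea_ge0.
have [k1|k1] := leP ((kappa - e) * a n) 0.
  apply: (@le_trans _ _ 0%E); last exact: integral_ge0.
  by rewrite mule_le0_ge0// ?lee_fin//; apply: integral_ge0 => p _; rewrite lee_fin.
rewrite -ge0_integralZl//; last by rewrite lee_fin ltW.
apply: ge0_le_integral => //.
- by move=> p _; rewrite mule_ge0// lee_fin// ltW.
- exact: emeasurable_funM.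
move=> p _; rewrite -EFinM lee_fin indicE; have [|_] := boolP (p \in E); last by rewrite mulr0 mul0r.
rewrite inE mulr1 mul1r => Ep; have := HK n p Kn Ep.
rewrite ltr_distl => /andP[h _].
by rewrite -ler_pdivlMr// mulrC ltW.
Qed.

Lemma hits_variance (e : R) : 0 < e -> \forall n \near \oo,
  (\int[leb2]_(p in D) ((hits E n p - a n * fine (mu E)) ^+ 2)%:E <= (e * a n ^+ 2)%:E)%E.
Proof.
move=> e0; set M := fine (mu E).
have M0 : 0 <= M by rewrite fine_ge0.
have e2 : 0 < e / 2 by rewrite divr_gt0.
set e1 := e / (4 * (M ^+ 2 + 1)).
have M1 : 0 < M ^+ 2 + 1 by rewrite ltr_wpDl// sqr_ge0.
have e10 : 0 < e1 by rewrite divr_gt0// mulr_gt0.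
have e1E : e1 * (4 * (M ^+ 2 + 1)) = e by rewrite /e1 divfK// gt_eqF// mulr_gt0.
have [mD mh] := (@measurable_tri_bar R, fun n => measurable_hits n mE).
have [H2 H1] := (hits_second_moment e2, hits_first_moment e10).
apply: filterS2 H2 H1 => n.
rewrite -/M; set c := a n * M => h2 h1.
have c0 : 0 <= c by rewrite mulr_ge0// ltW.
pose V := (\int[leb2]_(p in D) ((hits E n p - c) ^+ 2)%:E)%E.
pose I1 := (\int[leb2]_(p in D) (hits E n p)%:E)%E.
pose I2 := (\int[leb2]_(p in D) (hits E n p ^+ 2)%:E)%E.
have I10 : (0 <= I1)%E by apply: integral_ge0 => p _; rewrite lee_fin hits_ge0.
have V0 : (0 <= V)%E by apply: integral_ge0 => p _; rewrite lee_fin sqr_ge0.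
have VE : (V + (2 * c)%:E * I1 = I2 + (c ^+ 2 * kappa)%:E)%E.
  have mc : measurable_fun D (fun _ : plane R => (c ^+ 2)%:E) by exact: measurable_cst.
  have mhD : measurable_fun D (fun p => (hits E n p)%:E) by exact/measurable_EFinP/measurable_funTS.
  rewrite [(c ^+ 2 * kappa)%:E]EFinM -kappaE -integral_cst// -[in LHS]ge0_integralZl//; last 2 first.
  - by move=> p _; rewrite lee_fin hits_ge0.
  - by rewrite lee_fin mulr_ge0.
  rewrite -!ge0_integralD//.
  - apply: eq_integral => p _; rewrite -EFinM -!EFinD; congr (_%:E); ring.
  - by move=> p _; rewrite lee_fin sqr_ge0.
  - by apply/measurable_EFinP/measurable_funTS; exact: measurable_funX.
  - by move=> p _; rewrite lee_fin sqr_ge0.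
  - by move=> p _; rewrite lee_fin sqr_ge0.
  - apply/measurable_EFinP/measurable_funTS; apply: measurable_funX; exact: measurable_funB.
  - by move=> p _; rewrite mule_ge0// lee_fin ?hits_ge0// mulr_ge0.
  - exact: emeasurable_funM.
have : (V + (2 * c)%:E * I1 <= ((kappa * M ^+ 2 + e / 2) * a n ^+ 2 + c ^+ 2 * kappa)%:E)%E.
  by rewrite VE EFinD leeD2r.
have h1' : ((2 * c * ((kappa - e1) * M * a n))%:E <= (2 * c)%:E * I1)%E.
  by rewrite EFinM; apply: lee_wpmul2l => //; rewrite lee_fin mulr_ge0.
have := leeD2l V h1'.
move=> /le_trans h /h; rewrite -leeBrDr// -EFinB => /le_trans; apply.
rewrite lee_fin /c -e1E.
have := sqr_ge0 (a n); have := sqr_ge0 M; have := ltW e10.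
set A := a n; move=> hh1 hh2 hh3; rewrite -subr_ge0.
rewrite [X in 0 <= X](_ : _ = 2 * e1 * A ^+ 2); last by field.
by apply: mulr_ge0 => //; apply: mulr_ge0.
Qed.
End egorov.

Lemma weak_law (eta eta' : R) : 0 < eta -> 0 < eta' -> \forall n \near \oo,
  (leb2 (D `&` [set p | eta * a n <= `|(visits n p)%:R - a n * fine (mu G0)|]%R) <= eta'%:E)%E.
Proof.
move=> eta0 eta'0; set M := fine (mu G0).
have [C C0 HC] := harea_Gamma0_bound Shat_transfer a_return.
set e := Num.min (eta / 3) (eta * eta' / (6 * C)).
have e0 : 0 < e by rewrite lt_min !divr_gt0// mulr_gt0.
have eE : e <= eta / 3 by rewrite ge_min lexx.
have eC : 3 * C * e <= eta * eta' / 2.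
  apply: le_trans (_ : 3 * C * (eta * eta' / (6 * C)) <= _).
    by apply: ler_wpM2l; [rewrite mulr_ge0// ltW|rewrite ge_min lexx orbT].
  by rewrite le_eqVlt; apply/orP; left; apply/eqP; field; rewrite gt_eqF.
have [E [d [mE EG [d0 Ed] FE Eu]]] := egorov_set Shat_transfer a_return e0.
set F := G0 `\` E in FE.
have mG := @measurable_Gamma0 R.
have mF : measurable F by exact: measurableD.
have fG := mu_Gamma0_lty R.
have fE : (mu E < +oo)%E by apply: le_lt_trans fG; apply: le_measure; rewrite ?inE.
have fF : (mu F < +oo)%E by apply: lt_trans FE _; exact: ltry.
have EF : [disjoint E & F] by apply/disj_set2P; rewrite /F setIC setDKI.
have GE : G0 = E `|` F by rewrite /F setDE setUIr setUv setIT; apply/esym/setUidPr.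
have ME : M = fine (mu E) + fine (mu F).
  rewrite /M GE measureU//; last by apply/disj_set2P.
  by rewrite fineD// ge0_fin_numE.
have Fe : fine (mu F) <= e by rewrite -lee_fin fineK ?ge0_fin_numE// ltW.
set e2 := eta ^+ 2 * eta' / 18.
have e20 : 0 < e2 by rewrite divr_gt0// mulr_gt0// exprn_gt0.
have := hits_variance mE EG d0 Ed Eu e20; apply: filterS => n Hn.
have an := a_gt0 n.
set A1 := [set p | eta * a n / 3 <= hits F n p].
set A2 := [set p | (eta * a n / 3) ^+ 2 <= (hits E n p - a n * fine (mu E)) ^+ 2].
have t0 : 0 < eta * a n / 3 by rewrite divr_gt0// mulr_gt0.
have t20 : 0 < (eta * a n / 3) ^+ 2 by rewrite exprn_gt0.
have mh1 := measurable_hits n mF.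
have mh2 : measurable_fun [set: plane R] (fun p => (hits E n p - a n * fine (mu E)) ^+ 2).
  by apply: measurable_funX; apply: measurable_funB => //; exact: measurable_hits.
have B1 := markov_tri_bar mh1 (hits_ge0 F n) t0.
have B2 := markov_tri_bar mh2 (fun p => sqr_ge0 _) t20.
have mD := @measurable_tri_bar R.
have mA1 : measurable A1 by have := measurable_set_ler (measurable_cst _) mh1; apply.
have mA2 : measurable A2 by have := measurable_set_ler (measurable_cst _) mh2; apply.
have mV : measurable [set p : plane R | eta * a n <= `|(visits n p)%:R - a n * M|].
  apply: measurable_set_ler; first exact: measurable_cst.
  by apply: measurableT_comp => //; apply: measurable_funB => //; exact: measurable_visits.
apply: (@le_trans _ _ (leb2 ((D `&` A1) `|` (D `&` A2)))).
  apply: le_measure; rewrite ?inE.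
  - exact: measurableI.
  - by apply: measurableU; exact: measurableI.
  move=> p [Dp /= hp]; have [h1|h1] := leP (eta * a n / 3) (hits F n p); first by left.
  right; split => //; rewrite /A2/= leNgt; apply/negP => h2.
  move: hp; rewrite leNgt => /negP; apply.
  have h3 : `|hits E n p - a n * fine (mu E)| < eta * a n / 3.
    by rewrite -(ltr_pXn2r (n := 2)) ?nnegrE ?(ltW t0)// real_normK ?num_real.
  rewrite -hits_visits GE hitsD// ME.
  have h4 : a n * fine (mu F) <= eta * a n / 3.
    by rewrite mulrC mulrAC ler_wpM2r ?(ltW an)// (le_trans Fe).
  have h5 := hits_ge0 F n p.
  have h6 : 0 <= a n * fine (mu F) by rewrite mulr_ge0 ?fine_ge0// ltW.
  have h7 : `|hits F n p - a n * fine (mu F)| <= hits F n p + a n * fine (mu F).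
    by rewrite ler_norml; apply/andP; split; lra.
  rewrite (_ : _ - _ = (hits E n p - a n * fine (mu E)) + (hits F n p - a n * fine (mu F))); last by ring.
  apply: le_lt_trans (ler_normD _ _) _; lra.
apply: le_trans (measureU2 _ _ _) _; [exact: measurableI|exact: measurableI|].
rewrite (splitr eta') EFinD; apply: leeD.
- apply: (le_trans B1); rewrite integral_hits//.
  apply: (@le_trans _ _ (((eta * a n / 3)^-1)%:E * ((C * a n)%:E * mu F)))%E.
    apply: lee_wpmul2l; first by rewrite lee_fin invr_ge0 ltW.
    have <- : (\int[mu]_p (\1_F p)%:E = mu F)%E by rewrite integral_indic// setIT.
    rewrite -ge0_integralZl//; last 2 first.
    - by apply/measurable_EFinP; exact: measurable_indic.
    - by rewrite lee_fin mulr_ge0// ltW.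
    apply: ge0_le_integral => //.
    - by move=> p _; rewrite lee_fin mulr_ge0// harea_ge0.
    - apply/measurable_EFinP; apply: measurable_funM; [exact: measurable_indic|exact: measurable_harea].
    - by apply: emeasurable_funM => //; apply/measurable_EFinP; exact: measurable_indic.
    - move=> p _; rewrite -EFinM lee_fin indicE; have [|_] := boolP (p \in F); last by rewrite mulr0 mul0r.
      by rewrite inE mulr1 mul1r => -[Gp _]; exact: HC.
  rewrite -(@fineK _ (mu F)) ?ge0_fin_numE// -!EFinM lee_fin.
  rewrite [leLHS](_ : _ = 3 * C * fine (mu F) / eta); last by field; rewrite !gt_eqF.
  rewrite ler_pdivrMr//; apply: le_trans (_ : 3 * C * e <= _).
    by apply: ler_wpM2l => //; rewrite mulr_ge0// ltW.
  by rewrite [leRHS]mulrC mulrA.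
- apply: (le_trans B2).
  apply: (@le_trans _ _ ((((eta * a n / 3) ^+ 2)^-1)%:E * (e2 * a n ^+ 2)%:E))%E.
    by apply: lee_wpmul2l => //; rewrite lee_fin invr_ge0 ltW.
  rewrite -EFinM lee_fin /e2 le_eqVlt; apply/orP; left; apply/eqP.
  by field; rewrite !gt_eqF.
Qed.

End weak_law.

Section inversion.
Context (R : realType).

Lemma ln_nat_cvgy : ln (n%:R : R) @[n --> \oo] --> +oo.
Proof.
apply/cvgryPge => A; exists (Num.truncn (expR A)).+1 => // n /= An.
rewrite -[A]expRK ler_ln ?posrE ?expR_gt0//; last by rewrite ltr0n (leq_trans _ An).
by apply: ltW; apply: lt_le_trans (truncnS_gt _) _; rewrite ler_nat.
Qed.

Lemma adiag_divn_cvg0 : adiag R n / n%:R @[n --> \oo] --> (0 : R).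
Proof.
have [K K0 KE] : exists2 K : R, 0 < K & forall n : nat, (0 < n)%N ->
    adiag R n * (1 + ln (n%:R : R)) ^+ 2 <= K * n%:R.
  by exists 2400; [exact: ltr0n|exact: adiag_upper].
apply/cvgr0Pnorm_le => e e0.
have [N1 _ HN1] : \forall n \near \oo, K / e <= ln (n%:R : R) by have /cvgryPge := ln_nat_cvgy; apply.
exists (maxn N1 1) => // n /=; rewrite geq_max => /andP[n1 n0].
have N0 : 0 < n%:R :> R by rewrite ltr0n.
have A0 := adiag_ge0 R n.
rewrite ger0_norm ?divr_ge0// ler_pdivrMr//.
have := HN1 n n1; have := KE n n0 => /=; set l := ln n%:R => h1 h2.
have Ke : 0 < K / e by rewrite divr_gt0.
have h3 : K / e <= (1 + l) ^+ 2 by nra.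
rewrite -(ler_pM2l Ke) (_ : K / e * (e * n%:R) = K * n%:R); last by field; rewrite gt_eqF.
by apply: le_trans h1; rewrite mulrC; apply: ler_wpM2l.
Qed.

Lemma inverse_sequence (r : nat -> R) (C : R) : 0 <= C -> r 0%N = 0 ->
  {homo r : m n / (m <= n)%N >-> m <= n} -> (forall n, r n.+1 <= r n + C) ->
  r n @[n --> \oo] --> +oo ->
  exists b : nat -> nat, (forall n, n%:R <= r (b n) <= n%:R + C) /\ b n @[n --> \oo] --> \oo.
Proof.
move=> C0 r0 rh rS cr.
have ex n : exists k, n%:R <= r k.
  have /cvgryPge/(_ n%:R) [k _ Hk] := cr; exists k; exact: Hk (leqnn k).
exists (fun n => ex_minn (ex n)); split.
  move=> n; case: ex_minnP => k nk kmin; rewrite nk/=.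
  case: k nk kmin => [|k] nk kmin; first by rewrite r0 addr_ge0.
  apply: (le_trans (rS k)); rewrite lerD2r leNgt; apply/negP => /ltW/kmin.
  by rewrite ltnn.
move=> P [N _ NP]; exists (Num.truncn (r N)).+1 => // n /= Nn; apply: NP => /=.
case: ex_minnP => k nk _; rewrite leqNgt; apply/negP => kN.
have := le_trans nk (rh _ _ (ltnW kN)); rewrite leNgt => /negP; apply.
by apply: lt_le_trans (truncnS_gt _) _; rewrite ler_nat.
Qed.

Lemma asymp_inverse (r : nat -> R) (c C : R) (b : nat -> nat) : 0 < c -> 0 < C -> r 0%N = 0 ->
  (forall n, c * adiag R n <= r n) -> (forall n, r n <= C * adiag R n) ->
  (forall n, n%:R <= r (b n) <= n%:R + C) ->
  asymp (fun n => (b n)%:R : R) (fun n => n%:R * ln (n%:R) ^+ 2).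
Proof.
move=> c0 C0 r0 rl ru rb.
have bgt0 n : (0 < n)%N -> (0 < b n)%N.
  move=> n0; rewrite lt0n; apply/eqP => bn; have /andP[h _] := rb n.
  by move: h; rewrite bn r0 lern0 => /eqP n0'; rewrite n0' in n0.
have lnN : \forall n \near \oo, 1 <= ln (n%:R : R) by have /cvgryPge := ln_nat_cvgy; apply.
split; apply/eqO_exP.
- have [K1 K10 K1E] : exists2 K : R, 0 < K & forall n : nat, (0 < n)%N ->
      n%:R <= K * (adiag R n * (1 + ln (n%:R : R)) ^+ 2).
    by exists 4608; [exact: ltr0n|exact: adiag_lower].
  have [K2 K20 K2E] := adiag_ge_sqrt R.
  set s := (1 + C) / c; have s0 : 0 < s by rewrite divr_gt0// addr_gt0.
  set L := 3 + 2 * `|ln (K2 * s)|.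
  have L0 : 0 < L by apply: ltr_wpDr => //; exact: mulr_ge0.
  have Ab n : (0 < n)%N -> adiag R (b n) <= s * n%:R.
    move=> n0; have /andP[_ h] := rb n; have h2 := rl (b n).
    have h3 : 1 <= n%:R :> R by rewrite ler1n.
    rewrite /s mulrAC ler_pdivlMr// mulrC; apply: (le_trans h2); apply: (le_trans h).
    by rewrite mulrDl mul1r lerD2l ler_peMr// ltW.
  clearbody s.
  have L20 : 0 < L ^+ 2 by rewrite exprn_gt0.
  exists (K1 * (s * L ^+ 2)); first exact: mulr_gt0 K10 (mulr_gt0 s0 L20).
  apply: filterS lnN => n ln1.
  have n0 : (0 < n)%N by case: n ln1 => // ; rewrite ln0//; lra.
  have N0 : 0 < n%:R :> R by rewrite ltr0n.
  have bn0 := bgt0 _ n0; have B0 : 0 < (b n)%:R :> R by rewrite ltr0n.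
  have lnn0 : 0 <= ln (n%:R : R) by rewrite (le_trans _ ln1).
  rewrite !ger0_norm ?mulr_ge0 ?sqr_ge0//.
  apply: (le_trans (K1E _ bn0)).
  rewrite -[leRHS]mulrA; apply: ler_wpM2l; first exact: ltW.
  have hl : 1 + ln ((b n)%:R : R) <= L * ln (n%:R : R).
    have h1 : Num.sqrt ((b n)%:R : R) <= K2 * s * n%:R.
      by apply: (le_trans (K2E _)); rewrite -mulrA; apply: ler_wpM2l; [exact: ltW|exact: Ab].
    have Ks : 0 < K2 * s by exact: mulr_gt0.
    have KN : 0 < K2 * s * n%:R by exact: mulr_gt0.
    have h2 : (b n)%:R <= (K2 * s * n%:R) ^+ 2.
      by rewrite -[leLHS]sqr_sqrtr// lerXn2r ?nnegrE ?sqrtr_ge0// ltW.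
    have h3 : ln ((b n)%:R : R) <= 2 * (ln (K2 * s) + ln n%:R).
      rewrite -lnM ?posrE// mulr_natl -lnXn ?mulr_gt0//.
      by rewrite ler_ln ?posrE ?exprn_gt0// mulr_gt0.
    have h4 := ler_norm (ln (K2 * s)).
    have h5 : 0 <= `|ln (K2 * s)| by [].
    apply: (@le_trans _ _ (1 + 2 * (`|ln (K2 * s)| + ln n%:R))); first by lra.
    by rewrite /L; nra.
  rewrite (_ : s * L ^+ 2 * _ = (s * n%:R) * (L * ln n%:R) ^+ 2); last by ring.
  apply: ler_pM; [exact: adiag_ge0|exact: sqr_ge0|exact: Ab|].
  rewrite lerXn2r ?nnegrE//; first by rewrite addr_ge0// ln_ge0// ler1n.
  by rewrite mulr_ge0// ltW// (lt_le_trans _ ln1).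
- have [K1 K10 K1E] : exists2 K : R, 0 < K & forall n : nat, (0 < n)%N ->
      adiag R n * (1 + ln (n%:R : R)) ^+ 2 <= K * n%:R.
    by exists 2400; [exact: ltr0n|exact: adiag_upper].
  set L := 1 + `|ln C|.
  have L1 : 1 <= L by rewrite lerDl.
  have L0 : 0 < L by exact: lt_le_trans L1.
  have L20 : 0 < L ^+ 2 by rewrite exprn_gt0.
  exists (L ^+ 2 * (C * K1)); first exact: mulr_gt0 L20 (mulr_gt0 C0 K10).
  apply: filterS lnN => n ln1.
  have n0 : (0 < n)%N by case: n ln1 => // ; rewrite ln0//; lra.
  have N0 : 0 < n%:R :> R by rewrite ltr0n.
  have bn0 := bgt0 _ n0; have B0 : 0 < (b n)%:R :> R by rewrite ltr0n.
  have B1 : 1 <= (b n)%:R :> R by rewrite ler1n.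
  have lb0 : 0 <= ln ((b n)%:R : R) by rewrite ln_ge0.
  have lnn0 : 0 <= ln (n%:R : R) by rewrite (le_trans _ ln1).
  rewrite !ger0_norm ?mulr_ge0 ?sqr_ge0//.
  have h1 : n%:R <= C * adiag R (b n).
    by have /andP[h _] := rb n; exact: le_trans h (ru _).
  have h2 : ln (n%:R : R) <= L * (1 + ln (b n)%:R).
    have : n%:R <= C * (b n)%:R.
      by apply: (le_trans h1); apply: ler_wpM2l; [exact: ltW|exact: adiag_le].
    move=> hC; have h : ln (n%:R : R) <= ln C + ln (b n)%:R.
      by rewrite -lnM ?posrE// ler_ln ?posrE// mulr_gt0.
    have h4 := ler_norm (ln C); have h5 : 0 <= `|ln C| by [].
    by apply: (le_trans h); rewrite /L; nra.
  have h3 : ln (n%:R : R) ^+ 2 <= L ^+ 2 * (1 + ln (b n)%:R) ^+ 2.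
    by rewrite -exprMn lerXn2r ?nnegrE// (le_trans lnn0).
  apply: (le_trans (ler_pM _ _ h1 h3)) => //; first exact: sqr_ge0.
  rewrite (_ : C * _ * _ = L ^+ 2 * (C * (adiag R (b n) * (1 + ln (b n)%:R) ^+ 2))); last by ring.
  rewrite -[leRHS]mulrA -[X in _ <= _ * X]mulrA; apply: ler_wpM2l; first exact: ltW.
  by apply: ler_wpM2l; [exact: ltW|exact: K1E].
Qed.

End inversion.

Section measurable_digits.
Context (R : realType).
Local Notation D := (@tri_bar R).

Lemma measurable_fun_nat d (X : measurableType d) (f : X -> nat) :
  (forall k, measurable (f @^-1` [set k])) -> measurable_fun setT f.
Proof.
move=> mf _ Y _; rewrite setTI (_ : _ @^-1` _ = \bigcup_(k in Y) f @^-1` [set k]).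
  by apply: bigcup_measurable => k _; exact: mf.
by apply/seteqP; split => [x Yx|x [k Yk /= fx]]; [exists (f x)|rewrite /preimage/= fx].
Qed.

Lemma measurable_tri : measurable (@tri R).
Proof.
rewrite (_ : @tri R = D `&` [set p : plane R | 0 < p.2]).
  apply: measurableI; first exact: measurable_tri_bar.
  by apply: measurable_set_ltr; [exact: measurable_cst|exact: measurable_snd_plane].
apply/seteqP; split => [p tp|p [[p1 [p12 _]] p2]].
  by split; [exact: tri_tri_bar|case: tp => _ []].
by split.
Qed.

Lemma measurable_tri_k k : measurable (@tri_k R k).
Proof.
have mx (j : nat) : measurable_fun [set: plane R] (fun p : plane R => 1 - p.1 - j%:R * p.2 : R).
  apply: measurable_funB; first by apply: measurable_funB => //; exact: measurable_fst_plane.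
  by apply: measurable_funM => //; exact: measurable_snd_plane.
rewrite (_ : @tri_k R k = @tri R `&` ([set p : plane R | 0 <= 1 - p.1 - k%:R * p.2] `&`
    [set p : plane R | 1 - p.1 - k.+1%:R * p.2 < 0])); last by apply/seteqP; split.
apply: measurableI; first exact: measurable_tri.
by apply: measurableI; [exact: measurable_set_ler|exact: measurable_set_ltr].
Qed.

Lemma tri_k_inj j k (p : plane R) : tri_k j p -> tri_k k p -> j = k.
Proof.
have H i l : tri_k i p -> tri_k l p -> (i <= l)%N.
  move=> [[_ [_ y0]] [h2 _]] [_ [_ h1]]; rewrite leqNgt; apply/negP => li.
  have : l.+1%:R * p.2 <= i%:R * p.2 by rewrite ler_pM2r// ler_nat.
  by move: h1 h2; move: (l.+1%:R * p.2) (i%:R * p.2) => A B; lra.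
by move=> h1 h2; apply/eqP; rewrite eqn_leq !H.
Qed.

Lemma measurable_tri_index : measurable_fun [set: plane R] (@tri_index R).
Proof.
have E k : (@tri_index R) @^-1` [set k.+1] = @tri_k R k.+1.
  apply/seteqP; split => [p /= h|p tp] /=.
    by move: h; rewrite /tri_index; case: xgetP => [j -> ? <-|].
  by apply: (@tri_k_inj _ _ p) => //; apply: tri_indexP; case: tp.
apply: measurable_fun_nat => -[|k]; last by rewrite E; exact: measurable_tri_k.
rewrite (_ : _ @^-1` _ = ~` (\bigcup_k @tri_k R k.+1)).
  by apply: measurableC; apply: bigcup_measurable => k _; exact: measurable_tri_k.
apply/seteqP; split => [p /= h [k _]|p /= h].
  by rewrite -E /= h.
case e : (tri_index p) => [//|k]; exfalso; apply: h; exists k => //.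
by rewrite -E.
Qed.

Lemma measurable_Tmap : measurable_fun [set: plane R] (@Tmap R).
Proof.
have mi1 : measurable_fun [set: plane R] (fun p : plane R => p.1^-1 : measurableTypeR R).
  exact: (measurableT_comp (@measurable_invr R) (@measurable_fst_plane R)).
have mn : measurable_fun [set: plane R] (fun p : plane R => (tri_index p)%:R : R).
  have mnat : measurable_fun [set: nat] (fun n : nat => n%:R : R) by [].
  exact: (measurableT_comp mnat measurable_tri_index).
have [m1 m2] := (@measurable_fst_plane R, @measurable_snd_plane R).
rewrite /Tmap; apply: measurable_fun_ifT => //; first by apply: measurable_mem; exact: measurable_tri.
apply: measurable_fun_pair; apply: measurable_funM => //.
apply: measurable_funB; first exact: measurable_funB.
exact: measurable_funM.
Qed.

Lemma measurable_digit k : measurable_fun [set: plane R] (fun p => (digit k p)%:R : R).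
Proof.
have mnat : measurable_fun [set: nat] (fun n : nat => n%:R : R) by [].
have mT j : measurable_fun [set: plane R] (iter j (@Tmap R)).
  elim: j => [|j IH]; first exact: measurable_id.
  exact: (measurableT_comp measurable_Tmap IH).
exact: (measurableT_comp mnat (measurableT_comp measurable_tri_index (mT k.-1))).
Qed.

End measurable_digits.

Section abs_continuity.

Lemma null_dominates_small d (X : measurableType d) (R : realType)
    (nu : {finite_measure set X -> \bar R}) (mu : {measure set X -> \bar R}) (e : R) :
  nu `<< mu -> 0 < e -> exists2 dlt : R, 0 < dlt &
    forall A, measurable A -> (mu A < dlt%:E)%E -> (nu A < e%:E)%E.
Proof.
move=> numu e0.
have [P [N PN]] := Hahn_decomposition (charge_of_finite_measure nu).
have [dlt [dlt0 H]] := charge_variation_continuous PN numu e0.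
exists dlt => // A mA Ad; apply: le_lt_trans (H A mA Ad).
by have := abse_charge_variation PN mA; rewrite gee0_abs//; exact: measure_ge0.
Qed.

End abs_continuity.

Section deviation.
Context (R : realType).
Local Notation leb2 := (lebesgue2 R).
Local Notation mu := (@mu R).
Local Notation D := (@tri_bar R).
Local Notation G0 := (@Gamma0 R).
Local Notation S := (@Smap R).

Context (Shat : (plane R -> R) -> plane R -> R).
Context (Shat_transfer : transfer_operator mu S Shat).
Context (a : nat -> R).
Context (a_return : return_sequence mu Shat a).
Context (a_rv : regularly_varying 1 a).

Let a_gt0 n : 0 < a n. Proof. by case: a_return. Qed.
Local Notation M := (fine (mu G0)).

Let M_gt0 : 0 < M.
Proof. by rewrite fine_gt0// mu_Gamma0_gt0 mu_Gamma0_lty. Qed.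

Lemma scaled_reference : exists r : nat -> R, exists c C : R,
  [/\ 0 < c, 0 < C, r 0%N = 0, {homo r : m n / (m <= n)%N >-> m <= n} &
    [/\ forall n, r n.+1 <= r n + C, r n / a n @[n --> \oo] --> M,
     forall n, c * adiag R n <= r n & forall n, r n <= C * adiag R n]].
Proof.
have [r [rho [C [rho0 C0 r0 [rh rS cr rl ru]]]]] := reference_sequence Shat_transfer a_return.
have s0 : 0 < M / rho by rewrite divr_gt0.
have s0' := ltW s0.
exists (fun n => M / rho * r n), (M / rho), (M / rho * C); split => //.
- exact: mulr_gt0.
- by rewrite r0 mulr0.
- by move=> m n mn; apply: ler_wpM2l => //; exact: rh.
split.
- by move=> n; rewrite -mulrDr; exact: ler_wpM2l.
- rewrite (_ : (fun _ => _) = (fun n => M / rho * (r n / a n))); last first.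
    by apply/funext => n; rewrite mulrA.
  rewrite [X in _ --> X](_ : _ = M / rho * rho); first exact: cvgMl_tmp.
  by rewrite divfK// gt_eqF.
- by move=> n; exact: ler_wpM2l.
- by move=> n; rewrite -[leRHS]mulrA; apply: ler_wpM2l.
Qed.

Lemma ratio_cvgy (r : nat -> R) : r n / a n @[n --> \oo] --> M -> r n @[n --> \oo] --> +oo.
Proof.
move=> cr; apply/cvgryPge => A.
have M2 : M / 2 < M by rewrite ltr_pdivrMr// ltr_pMr// ltr1n.
have h1 : \forall n \near \oo, M / 2 < r n / a n by exact: (cvgr_gt _ cr).
have h2 : \forall n \near \oo, A / (M / 2) <= a n.
  by have /cvgryPge := a_cvgy Shat_transfer a_return; apply.
apply: filterS2 h1 h2 => n; have M20 : 0 < M / 2 by rewrite divr_gt0.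
rewrite ltr_pdivlMr// ler_pdivrMr// => h1 h2; apply: (le_trans h2).
by rewrite mulrC ltW.
Qed.

Lemma near_subsequence (u : nat -> nat) (P : nat -> Prop) : u n @[n --> \oo] --> \oo ->
  (\forall n \near \oo, P n) -> \forall n \near \oo, P (u n).
Proof. by move=> cu; exact: cu. Qed.

Lemma truncn_cvgy (c : R) (b : nat -> nat) : 0 < c -> b n @[n --> \oo] --> \oo ->
  Num.truncn (c * (b n)%:R) @[n --> \oo] --> \oo.
Proof.
move=> c0 cb P [N _ NP].
have [K _ HK] : \forall n \near \oo, (Num.truncn (N%:R / c) < b n)%N.
  by apply: (near_subsequence (P := fun m => _ < m)%N cb); exists (Num.truncn (N%:R / c)).+1.
exists K => // n /= Kn; apply: NP => /=.
have := HK n Kn => /= h.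
rewrite truncn_ge_nat; last by rewrite mulr_ge0// ltW.
rewrite mulrC -ler_pdivrMr//; apply: ltW; apply: lt_le_trans (truncnS_gt _) _.
by rewrite ler_nat.
Qed.

Lemma rescaled_ratio (r : nat -> R) (b : nat -> nat) (c : R) : 0 < c ->
  b n @[n --> \oo] --> \oo -> r n / a n @[n --> \oo] --> M ->
  r (b n) / a (Num.truncn (c * (b n)%:R)) @[n --> \oo] --> M / c.
Proof.
move=> c0 cb cr.
rewrite (_ : (fun n => _) = (fun n => (r (b n) / a (b n)) *
   (a (Num.truncn (c * (b n)%:R)) / a (b n))^-1)); last first.
  by apply/funext => n; rewrite invf_div mulrA divfK// gt_eqF.
apply: cvgM; first exact: (cvg_comp _ (fun m => r m / a m) cb cr).
apply: cvgV; first by rewrite gt_eqF.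
have := a_rv c0; rewrite powRr1; last exact: ltW.
exact: (cvg_comp _ (fun m => a (Num.truncn (c * m%:R)) / a m) cb).
Qed.

Section inverse.
Context (r : nat -> R) (C : R) (b : nat -> nat).
Context (C0 : 0 < C) (cr : r n / a n @[n --> \oo] --> M).
Context (ru : forall n, r n <= C * adiag R n).
Context (rb : forall n, n%:R <= r (b n) <= n%:R + C) (cb : b n @[n --> \oo] --> \oo).

Let digit_sum n p := \sum_(1 <= k < n.+1) @digit R k p.

Lemma upper_deviation (eps : R) : 0 < eps -> exists2 eta : R, 0 < eta &
  \forall n \near \oo, forall p, generic p -> (1 + eps) * (b n)%:R < (digit_sum n p)%:R ->
    eta * a (Num.truncn ((1 + eps) * (b n)%:R)) <=
    `|(visits (Num.truncn ((1 + eps) * (b n)%:R)) p)%:R - a (Num.truncn ((1 + eps) * (b n)%:R)) * M|.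
Proof.
move=> eps0; have c0 : 0 < 1 + eps by rewrite addr_gt0.
have h0 : M / (1 + eps) < M by rewrite ltr_pdivrMr// ltr_pMr// ltrDl.
set eta := (M - M / (1 + eps)) / 2.
have eta0 : 0 < eta by rewrite divr_gt0// subr_gt0.
exists eta => //.
have h1 : M / (1 + eps) < M - eta by rewrite /eta; lra.
have : \forall n \near \oo, r (b n) / a (Num.truncn ((1 + eps) * (b n)%:R)) < M - eta.
  exact: (cvgr_lt _ (rescaled_ratio c0 cb cr)).
apply: filterS => n; set k := Num.truncn _; rewrite ltr_pdivrMr// => hr p gp hp.
have vn : (visits k p < n)%N.
  rewrite ltnNge visits_ge// -ltnNge -(ltr_nat R).
  apply: le_lt_trans (_ : k%:R <= (1 + eps) * (b n)%:R) _.
    by rewrite truncn_le// mulr_ge0// ltW.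
  by apply: (lt_le_trans hp); rewrite ler_nat leq_addr.
have v1 : (visits k p)%:R <= r (b n).
  by have /andP[h _] := rb n; apply: le_trans h; rewrite ler_nat ltnW.
rewrite distrC; apply: le_trans (ler_norm _).
rewrite mulrC [a k * M]mulrC; move: hr v1; rewrite mulrBl; lra.
Qed.

Lemma lower_deviation (eps : R) : 0 < eps -> eps < 1 -> exists2 eta : R, 0 < eta &
  \forall n \near \oo, forall p, generic p -> (digit_sum n p)%:R < (1 - eps) * (b n)%:R ->
    eta * a (Num.truncn ((1 - eps / 2) * (b n)%:R)) <=
    `|(visits (Num.truncn ((1 - eps / 2) * (b n)%:R)) p)%:R
       - a (Num.truncn ((1 - eps / 2) * (b n)%:R)) * M|.
Proof.
move=> eps0 eps1; have c0 : 0 < 1 - eps / 2 by lra.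
set c := 1 - eps / 2 in c0 *.
have c1 : c < 1 by rewrite /c; lra.
have h0 : M < M / c by rewrite ltr_pdivlMr// gtr_pMr.
set eta := (M / c - M) / 3.
have eta0 : 0 < eta by rewrite divr_gt0// subr_gt0.
exists eta => //.
have h1 : M + 2 * eta < M / c by rewrite /eta; lra.
have n1 : \forall n \near \oo, M + 2 * eta < r (b n) / a (Num.truncn (c * (b n)%:R)).
  exact: (cvgr_gt _ (rescaled_ratio c0 cb cr)).
have n2 : \forall n \near \oo, C / eta <= a (Num.truncn (c * (b n)%:R)).
  apply: (near_subsequence (P := fun m => _ <= a m) (truncn_cvgy c0 cb)).
  have /cvgryPge := a_cvgy Shat_transfer a_return; apply.
have n3 : \forall n \near \oo, adiag R (b n) / (b n)%:R < eps / (2 * C).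
  have e2 : 0 < eps / (2 * C) by rewrite divr_gt0// mulr_gt0.
  apply: (near_subsequence (P := fun m => adiag R m / m%:R < _) cb).
  by apply: (cvgr_lt _ (@adiag_divn_cvg0 R)); exact: e2.
have n4 : \forall n \near \oo, (0 < b n)%N by apply: (near_subsequence (P := fun m => 0 < m)%N cb); exists 1%N.
near=> n => p gp hp.
have : (0 < b n)%N by near: n.
have : adiag R (b n) / (b n)%:R < eps / (2 * C) by near: n.
have : C / eta <= a (Num.truncn (c * (b n)%:R)) by near: n.
have : M + 2 * eta < r (b n) / a (Num.truncn (c * (b n)%:R)) by near: n.
set k := Num.truncn _; rewrite ltr_pdivlMr// ler_pdivrMr// => hr ha hA bn.
have B0 : 0 < (b n)%:R :> R by rewrite ltr0n.
have nb : n%:R <= eps / 2 * (b n)%:R.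
  have /andP[h _] := rb n; apply: (le_trans h); apply: (le_trans (ru _)).
  move: hA; rewrite ltr_pdivrMr// => /ltW hA.
  apply: (le_trans (ler_wpM2l (ltW C0) hA)).
  by rewrite le_eqVlt; apply/orP; left; apply/eqP; field; rewrite gt_eqF.
have hk : (hit_time n p <= k)%N.
  rewrite truncn_ge_nat; last by rewrite mulr_ge0// ltW.
  rewrite /hit_time natrD; move: hp nb; rewrite /digit_sum /c; lra.
have vn : n%:R <= (visits k p)%:R :> R by rewrite ler_nat visits_ge.
apply: le_trans (ler_norm _).
have /andP[_ h] := rb n.
rewrite mulrC [a k * M]mulrC; move: hr ha vn h; rewrite mulrDl; lra.
Unshelve. all: by end_near. Qed.

Lemma measurable_digit_sum n : measurable_fun [set: plane R] (fun p => (digit_sum n p)%:R : R).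
Proof.
rewrite (_ : (fun _ => _) = (fun p => \sum_(1 <= k < n.+1) (digit k p)%:R)).
  by apply: measurable_sum => k; exact: measurable_digit.
by apply/funext => p; rewrite /digit_sum natr_sum.
Qed.

Lemma measurable_deviation (eps : R) n : measurable
  [set p | D p /\ `|((b n)%:R)^-1 * (digit_sum n p)%:R - 1| > eps].
Proof.
rewrite (_ : [set _ | _] = D `&` [set p | eps < `|((b n)%:R)^-1 * (digit_sum n p)%:R - 1|]); last first.
  by apply/seteqP; split.
apply: measurableI; first exact: measurable_tri_bar.
apply: measurable_set_ltr; first exact: measurable_cst.
apply: measurableT_comp => //; apply: measurable_funB => //; apply: measurable_funM => //.
exact: measurable_digit_sum.
Qed.

Lemma lebesgue2_deviation (eps dlt : R) : 0 < eps -> 0 < dlt -> \forall n \near \oo,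
  (leb2 [set p | D p /\ `|((b n)%:R)^-1 * (digit_sum n p)%:R - 1| > eps]%R < dlt%:E)%E.
Proof.
move=> eps0 dlt0.
have [N [mN N0 HN]] := ae_generic R.
set e := Num.min eps (2^-1).
have e0 : 0 < e by rewrite lt_min eps0 invr_gt0 ltr0n.
have e1 : e < 1 by rewrite gt_min invf_lt1// ltr1n orbT.
have ee : e <= eps by rewrite ge_min lexx.
have d3 : 0 < dlt / 3 by rewrite divr_gt0.
have cu0 : 0 < 1 + e by rewrite addr_gt0.
have cl0 : 0 < 1 - e / 2 by lra.
have [etau etau0 Hu] := upper_deviation e0.
have [etal etal0 Hl] := lower_deviation e0 e1.
have Wu := near_subsequence (truncn_cvgy cu0 cb) (weak_law Shat_transfer a_return a_rv etau0 d3).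
have Wl := near_subsequence (truncn_cvgy cl0 cb) (weak_law Shat_transfer a_return a_rv etal0 d3).
have n4 : \forall n \near \oo, (0 < b n)%N by apply: (near_subsequence (P := fun m => 0 < m)%N cb); exists 1%N.
have mD := @measurable_tri_bar R.
have mV (t : R) k : measurable (D `&` [set p | t <= `|(visits k p)%:R - a k * M|]).
  apply: measurableI => //; apply: measurable_set_ler; first exact: measurable_cst.
  by apply: measurableT_comp => //; apply: measurable_funB => //; exact: measurable_visits.
apply: filterS3 Hu Hl (filterI Wu (filterI Wl n4)) => n Hun Hln [/= lu [/= ll bn]].
have B0 : 0 < (b n)%:R :> R by rewrite ltr0n.
set ku := Num.truncn ((1 + e) * (b n)%:R).
set kl := Num.truncn ((1 - e / 2) * (b n)%:R).
rewrite -/ku in lu; rewrite -/kl in ll.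
set Au := D `&` [set p | etau * a ku <= `|(visits ku p)%:R - a ku * M|].
set Al := D `&` [set p | etal * a kl <= `|(visits kl p)%:R - a kl * M|].
apply: (@le_lt_trans _ _ (leb2 (N `|` (Au `|` Al)))).
  apply: le_measure; rewrite ?inE.
  - exact: measurable_deviation.
  - by apply: measurableU => //; apply: measurableU; exact: mV.
  move=> p [Dp hp]; have [gp|ngp] := pselect (generic p); last first.
    by left; apply: HN => /= /(_ Dp).
  right; have := le_lt_trans ee hp.
  rewrite ltNge ler_norml negb_and -!ltNge => /orP[h|h]; [right|left]; split => //=.
  - apply: Hln => //.
    by rewrite -ltr_pdivrMr// mulrC; lra.
  - apply: Hun => //.
    by rewrite -ltr_pdivlMr// mulrC; lra.
apply: le_lt_trans (measureU2 _ _ _) _ => //; first by apply: measurableU; exact: mV.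
have N0' : (leb2 N <= 0)%E by rewrite le_eqVlt; apply/orP; left; apply/eqP; exact: N0.
apply: le_lt_trans (leeD N0' (lexx _)) _.
rewrite add0e; apply: le_lt_trans (measureU2 _ _ _) _; [exact: mV|exact: mV|].
apply: le_lt_trans (leeD lu ll) _.
by rewrite -EFinD lte_fin; lra.
Qed.

End inverse.
End deviation.

Unset Implicit Arguments.

Theorem corollary3p3 (R : realType)
    (Prob : probability (plane R) R)
    (Prob_tri_bar : Prob (@tri_bar R) = 1%E)
    (Prob_ac : Prob `<< lebesgue2 R)
    (Shat : (plane R -> R) -> plane R -> R)
    (Shat_transfer : transfer_operator (@mu R) (@Smap R) Shat)
    (a : nat -> R)
    (a_return : return_sequence (@mu R) Shat a)
    (a_rv : regularly_varying 1 a) :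
  (exists b : nat -> R,
     (forall eps : R, 0 < eps ->
        Prob [set p | tri_bar p /\
          `|(b n)^-1 * (\sum_(1 <= k < n.+1) digit k p)%:R - 1| > eps]
          @[n --> \oo] --> 0%E)
     /\ asymp b (fun n => n%:R * ln (n%:R) ^+ 2))
  /\
  {ae lebesgue2 R, forall p, tri_bar p ->
     (n%:R^-1 * (\sum_(1 <= k < n.+1) digit k p)%:R : R) @[n --> \oo] --> +oo_R}.
Proof.
split; last exact: ae_digits_average.
have [r [c [C [c0 C0 r0 rh [rS cr rl ru]]]]] := scaled_reference Shat_transfer a_return.
have [b [rb cb]] := inverse_sequence (ltW C0) r0 rh rS (ratio_cvgy Shat_transfer a_return cr).
exists (fun n => (b n)%:R); split; last exact: (asymp_inverse c0 C0 r0 rl ru rb).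
move=> eps eps0; apply/fine_cvgP; split.
  by apply: nearW => n; apply: fin_num_measure; exact: measurable_deviation.
apply/cvgr0Pnorm_lt => e e0 /=.
have [dlt dlt0 H] := null_dominates_small Prob_ac e0.
have := lebesgue2_deviation Shat_transfer a_return a_rv C0 cr ru rb cb eps0 dlt0.
apply: filterS => n hn; have mA := measurable_deviation b eps n.
rewrite ger0_norm ?fine_ge0// -lte_fin fineK; last exact: fin_num_measure.
exact: H.
Qed.
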